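(* Let $P\subset\mathbb{R}^d$ be a closed convex cone with $P-P=\mathbb{R}^d$ and $P\cap(-P)=\{0\}$. Let $(Y,\mathcal{B}_Y)$ be a measurable space with $\mathcal{B}_Y$ countably generated, on which $\mathbb{R}^d$ acts measurably, let $\rho_0$ be an $\mathbb{R}^d$-invariant $\sigma$-finite measure on $Y$, and let $X\in\mathcal{B}_Y$ satisfy $X+a\subset X$ for all $a\in P$ and $\bigcap_{a\in P}(X+a)=\emptyset$. Let $\nu$ be a measure on $(0,\infty)$ with $\int (r\wedge1)\,\nu(dr)<\infty$, let $\eta$ be a Poisson process on $Y\times(0,\infty)$ with intensity measure $\rho_0\otimes\nu$, and let $\xi(B)=\int r1_B(y)\,\eta(d(y,r))$, $B\in\mathcal{B}_Y$, be the associated $\rho_0$-symmetric compound Poisson process on $Y$ with Lévy measure $\nu$. For $a\in P$ let $\mathcal{F}_a$ be the $\sigma$-algebra generated by $\{\xi(B):B\in\mathcal{B}_Y,\ B\subset X\setminus(X+a)\}$. Then $$E=\{(a,f):a\in P,\ f\in L^2(\Omega,\mathcal{F}_a,\mathbb{P})\},$$ with the measurable structure inherited from $P\times L^2(\Omega,\mathcal{F},\mathbb{P})$, the projection $(a,f)\mapsto a$, and the product $(a,f)(b,g)=(a+b,fS_a(g))$, is a product system over $P$.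
   Context: All probability spaces and sub-$\sigma$-algebras are complete; ''generated by random variables'' means the smallest complete $\sigma$-algebra making them measurable. For $a,b\in P$, $a\le b$ means $b-a\in P$. The action of $\mathbb{R}^d$ on $Y$ is written additively. Poisson process: with $\overline{\mathbb{N}}=\{0,1,2,\dots\}\cup\{\infty\}$, a point process on a measurable space is a measurable map $\eta$ from a probability space $(\Omega,\mathcal{F},\mathbb{P})$ to the $\overline{\mathbb{N}}$-valued $\sigma$-finite measures (with the smallest $\sigma$-algebra making each $\mu\mapsto\mu(B)$ measurable). It is a Poisson process with intensity $\lambda$ if each $\eta(B)$ is Poisson with parameter $\lambda(B)$ (a.s. $\infty$ if $\lambda(B)=\infty$) and $\eta(B_1),\dots,\eta(B_n)$ are independent for disjoint measurable $B_i$. Here $(\Omega,\mathcal{F},\mathbb{P})$ realises $\eta$ and $\mathcal{F}$ is generated by the random variables $\eta(B)$, $B$ measurable in $Y\times(0,\infty)$. Shift unitaries: for $a\le b$ in $P$ let $\mathcal{F}_{a,b}$ be generated by $\{\xi(B):B\in\mathcal{B}_Y,\ B\subset(X+a)\setminus(X+b)\}$, so $\mathcal{F}_a=\mathcal{F}_{0,a}$. For $c\in P$, $S_c:L^2(\Omega,\mathcal{F}_{a,b},\mathbb{P})\to L^2(\Omega,\mathcal{F}_{a+c,b+c},\mathbb{P})$ is the unitary with $S_c(f(\xi(B_1),\dots,\xi(B_n)))=f(\xi(B_1+c),\dots,\xi(B_n+c))$ for measurable $B_i\subset(X+a)\setminus(X+b)$; it exists by stationarity of $\xi$. Product system over $P$: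 a standard Borel space $E$ with a measurable surjection $p:E\to P$ such that (i) each fibre $E(a)=p^{-1}(a)$ is a non-zero separable Hilbert space; (ii) there is a measurable associative multiplication $E\times E\to E$ with $E(a)E(b)\subset E(a+b)$ and, for all $a,b\in P$, the map $u\otimes v\mapsto uv$ extends to a unitary $E(a)\otimes E(b)\to E(a+b)$; (iii) with $\Gamma$ the set of measurable maps $s:P\to E$ with $s(a)\in E(a)$ for all $a$, the pair $(E,\Gamma)$ is a measurable field of Hilbert spaces, i.e. $\Gamma$ is a vector space, $a\mapsto\langle s(a)|t(a)\rangle$ is measurable for $s,t\in\Gamma$, any section $t$ such that $a\mapsto\langle t(a)|s(a)\rangle$ is measurable for every $s\in\Gamma$ lies in $\Gamma$, and there is a sequence $(s_n)$ in $\Gamma$ such that $\{s_n(a)\}_n$ is total in $E(a)$ for every $a\in P$. *)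

(* Defs.v *)
(* MathComp; the field of complex numbers is R[i] from mathcomp-real-closed. *)
From HB Require Import structures.
From mathcomp Require Import all_boot all_order all_algebra.
From mathcomp Require Import interval_inference ring_quotient generic_quotient.
From mathcomp Require Import complex ring.
From mathcomp Require Import all_classical all_reals all_analysis measurable_realfun.

Set Implicit Arguments.
Unset Strict Implicit.
Unset Printing Implicit Defensive.
Import Order.TTheory GRing.Theory Num.Theory numFieldNormedType.Exports.
Local Open Scope classical_set_scope.
Local Open Scope ring_scope.
Local Open Scope quotient_scope.

(* The total space of a product system is not given as a [measurableType], so
   sigma-algebras on it are handled as sets of sets. *)
Section set_systems.
Context (T U : Type).

Definition sys_measurable (S : set (set T)) (S' : set (set U)) (f : T -> U) :=
  forall B, S' B -> S (f @^-1` B).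

Definition sys_prod (S : set (set T)) (S' : set (set U)) : set (set (T * U)) :=
  <<s [set A `*` B | A in S & B in S'] >>.

End set_systems.

Definition borel (T : topologicalType) : set (set T) := <<s @open T >>.

Definition cmeasurable (T : Type) (R : realType) (S : set (set T))
    (f : T -> R[i]) :=
  sys_measurable S (@measurable _ R) (fun x => complex.Re (f x)) /\
  sys_measurable S (@measurable _ R) (fun x => complex.Im (f x)).

(* Isomorphic to a Borel subset of a Polish space. *)
Definition standard_borel (R : realType) (T : Type) (S : set (set T)) :=
  exists (Z : completePseudoMetricType R) (f : T -> Z),
    [/\ hausdorff_space Z, @second_countable Z, injective f,
        borel (range f) & S = preimage_set_system setT f (@borel Z)].

Definition countably_generated (T : Type) (S : set (set T)) :=
  exists G : nat -> set T, S = <<s range G >>.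

(* Inner products are linear in the second variable. *)

Section hilbert.
Context (R : realType) (V : lmodType R[i]) (dot : V -> V -> R[i]).

Record inner_product : Prop := {
  ip_linear : forall u (c : R[i]) v w, dot u (c *: v + w) = c * dot u v + dot u w;
  ip_conj : forall u v, dot v u = conjc (dot u v);
  ip_ge0 : forall u, 0 <= dot u u;
  ip_eq0 : forall u, dot u u = 0 -> u = 0 }.

Definition hnorm (u : V) : R := Num.sqrt (complex.Re (dot u u)).

Definition hcomplete :=
  forall u : nat -> V,
    (forall e : R, 0 < e -> exists N, forall m n,
        (N <= m)%N -> (N <= n)%N -> hnorm (u m - u n) < e) ->
    exists l, (fun n => hnorm (u n - l)) @ \oo --> (0 : R).

Definition hilbert := inner_product /\ hcomplete.

Definition hseparable :=
  exists u : nat -> V, forall v (e : R), 0 < e -> exists n, hnorm (v - u n) < e.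

Definition htotal (S : set V) :=
  forall v (e : R), 0 < e ->
    exists (n : nat) (c : 'I_n -> R[i]) (s : 'I_n -> V),
      (forall i, S (s i)) /\ hnorm (v - \sum_(i < n) c i *: s i) < e.

Definition hopen (U : set V) :=
  forall u, U u -> exists2 e : R, 0 < e & forall v, hnorm (v - u) < e -> U v.

Definition hborel : set (set V) := <<s hopen >>.

End hilbert.

(* The map U restricts to a unitary from the subspace A of V onto the subspace B of W. *)
Definition unitary_on (R : realType) (V W : lmodType R[i])
    (dotV : V -> V -> R[i]) (dotW : W -> W -> R[i])
    (A : set V) (B : set W) (U : V -> W) :=
  [/\ U @` A = B,
      forall (c : R[i]) u v, A u -> A v -> U (c *: u + v) = c *: U u + U v &
      forall u v, A u -> A v -> dotW (U u) (U v) = dotV u v].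

(* (T, tens) is a model of the Hilbert space tensor product of V and W; it is
   unique up to a unitary intertwining the maps tens. *)
Record hilbert_tensor (R : realType) (V W T : lmodType R[i])
    (dotV : V -> V -> R[i]) (dotW : W -> W -> R[i]) (dotT : T -> T -> R[i])
    (tens : V -> W -> T) : Prop := {
  ht_hilbert : hilbert dotT;
  ht_linearl : forall (c : R[i]) u u' v,
    tens (c *: u + u') v = c *: tens u v + tens u' v;
  ht_linearr : forall (c : R[i]) u v v',
    tens u (c *: v + v') = c *: tens u v + tens u v';
  ht_dot : forall u u' v v',
    dotT (tens u v) (tens u' v') = dotV u u' * dotW v v';
  ht_total : htotal dotT [set tens u v | u in setT & v in setT] }.

(* The fibration p : E -> P is presented as the family of its fibres E a, with
   total space {a : P & E a} and p = tag. *)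
Section product_system.
Context (R : realType) (d : nat) (P : set 'rV[R]_d).
Context (E : P -> lmodType R[i]) (dot : forall a, E a -> E a -> R[i]).
Context (SE : set (set {a : P & E a})).
Context (mul : {a : P & E a} -> {a : P & E a} -> {a : P & E a}).

Definition borel_cone : set (set P) :=
  preimage_set_system setT (val : P -> 'rV[R]_d) (@borel 'rV[R]_d).

Definition msection (s : forall a, E a) :=
  sys_measurable borel_cone SE (fun a => Tagged E (s a)).

Record measurable_field : Prop := {
  mf_zero : msection (fun a => 0);
  mf_linear : forall (c : R[i]) s t,
    msection s -> msection t -> msection (fun a => c *: s a + t a);
  mf_dot : forall s t, msection s -> msection t ->
    cmeasurable borel_cone (fun a => dot (s a) (t a));
  mf_closed : forall t : (forall a, E a),
    (forall s, msection s -> cmeasurable borel_cone (fun a => dot (t a) (s a))) ->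
    msection t;
  mf_total : exists s : nat -> forall a, E a,
    (forall n, msection (s n)) /\
    forall a, htotal (@dot a) (range (fun n => s n a)) }.

Record product_system : Prop := {
  ps_standard : standard_borel R SE;
  ps_proj_measurable : sys_measurable SE borel_cone (fun x => tag x);
  ps_proj_surj : range (fun x : {a : P & E a} => tag x) = setT;
  ps_hilbert : forall a, hilbert (@dot a);
  ps_separable : forall a, hseparable (@dot a);
  ps_nonzero : forall a, exists u : E a, u != 0;
  ps_mul_measurable :
    sys_measurable (sys_prod SE SE) SE (fun xy => mul xy.1 xy.2);
  ps_mulA : associative mul;
  ps_mul_proj : forall x y, val (tag (mul x y)) = val (tag x) + val (tag y);
  (* u (x) v |-> u v extends to a unitary E(a) (x) E(b) -> E(a + b) *)
  ps_mul_unitary : forall a b c : P, val c = val a + val b ->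
    forall (T : lmodType R[i]) (dotT : T -> T -> R[i]) (tens : E a -> E b -> T),
    hilbert_tensor (@dot a) (@dot b) dotT tens ->
    exists2 U : T -> E c, unitary_on dotT (@dot c) setT setT U &
      forall u v, mul (Tagged E u) (Tagged E v) = Tagged E (U (tens u v));
  ps_field : measurable_field }.

End product_system.

Arguments borel_cone {R d} P.

Lemma cmeasurable_lin (T : pointedType) (R : realType) (G : set (set T))
    (c : R[i]) (f g : T -> R[i]) :
  cmeasurable <<s G>> f -> cmeasurable <<s G>> g ->
  cmeasurable <<s G>> (c *: f + g).
Proof.
have sysP (h : T -> R) : sys_measurable <<s G>> (@measurable _ R) h <->
    measurable_fun (setT : set (g_sigma_algebraType G)) h.
  split=> [mh _ B mB|mh B mB]; first by rewrite setTI; exact: mh.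
  by have := mh measurableT B mB; rewrite setTI.
case=> /sysP f1 /sysP f2 [/sysP g1 /sysP g2]; split; apply/sysP.
- rewrite (_ : (fun x => _) = fun x => complex.Re c * complex.Re (f x)
      - complex.Im c * complex.Im (f x) + complex.Re (g x)); last first.
    by apply/funext => x; rewrite !fctE /=; case: c (f x) (g x) => [? ?] [? ?] [].
  apply: measurable_funD => //; apply: measurable_funB;
    by apply: measurable_funM => //; exact: measurable_cst.
- rewrite (_ : (fun x => _) = fun x => complex.Re c * complex.Im (f x)
      + complex.Im c * complex.Re (f x) + complex.Im (g x)); last first.
    by apply/funext => x; rewrite !fctE /=; case: c (f x) (g x) => [? ?] [? ?] [].
  apply: measurable_funD => //; apply: measurable_funD;
    by apply: measurable_funM => //; exact: measurable_cst.
Qed.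

Section L2.
Context d (T : measurableType d) (R : realType) (mu : {measure set T -> \bar R}).

Let sqc (f : T -> R[i]) x : R := complex.Re (f x) ^+ 2 + complex.Im (f x) ^+ 2.

Let measurable_sqc f : cmeasurable (@measurable _ T) f ->
  measurable_fun setT (sqc f).
Proof.
move=> [f1 f2]; apply: measurable_funD; apply: measurable_funX => _ B mB.
- by rewrite setTI; exact: f1.
- by rewrite setTI; exact: f2.
Qed.

Definition L2pred : {pred T -> R[i]} :=
  mem [set f : T -> R[i] | cmeasurable (@measurable _ T) f /\
    (\int[mu]_x (complex.Re (f x) ^+ 2 + complex.Im (f x) ^+ 2)%:E < +oo)%E].

Lemma L2pred_closed : submod_closed L2pred.
Proof.
have mE : @measurable _ T = <<s @measurable _ T>>.
  by rewrite sigma_algebra_id //; exact: sigma_algebra_measurable.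
split.
  rewrite inE /=; split.
    by split=> B _; rewrite preimage_cst; case: ifP.
  under eq_integral do rewrite /= expr0n /= addr0.
  by rewrite integral0.
move=> c f g; rewrite !inE /= => -[mf fi] [mg gi].
have mh : cmeasurable (@measurable _ T) (c *: f + g).
  by rewrite mE; apply: cmeasurable_lin; rewrite -mE.
split=> //.
set C := complex.Re c ^+ 2 + complex.Im c ^+ 2.
have C0 : 0 <= C by rewrite addr_ge0 ?sqr_ge0.
apply: (@le_lt_trans _ _
  (\int[mu]_x ((2 * C)%:E * (sqc f x)%:E + 2%:E * (sqc g x)%:E))%E).
  apply: ge0_le_integral => //.
  - by move=> x _; rewrite lee_fin addr_ge0 ?sqr_ge0.
  - by apply/measurable_EFinP; exact: (measurable_sqc mh).
  - by apply: emeasurable_funD; apply: measurable_funeM; apply/measurable_EFinP;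
      exact: measurable_sqc.
  - move=> x _; rewrite -!EFinM -EFinD lee_fin /sqc /C !fctE /=.
    case: c (f x) (g x) {C C0 mh} => [a b] [u v] [s t] /=.
    rewrite -subr_ge0.
    rewrite (_ : _ - _ = (a * u - b * v - s) ^+ 2 + (a * v + b * u - t) ^+ 2).
      by rewrite addr_ge0 ?sqr_ge0.
    by rewrite !expr2; ring.
have m2 f' : cmeasurable (@measurable _ T) f' ->
    measurable_fun setT (fun x => (sqc f' x)%:E).
  by move=> ?; apply/measurable_EFinP; exact: measurable_sqc.
have p2 f' x : (0 <= (sqc f' x)%:E)%E by rewrite lee_fin addr_ge0 ?sqr_ge0.
rewrite ge0_integralD //=; last 4 first.
- by move=> x _; rewrite mule_ge0 // lee_fin mulr_ge0.
- by apply: measurable_funeM; exact: m2.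
- by move=> x _; rewrite mule_ge0 // lee_fin.
- by apply: measurable_funeM; exact: m2.
rewrite !ge0_integralZl //; try exact: m2; try by rewrite lee_fin // mulr_ge0.
by rewrite lte_add_pinfty // lte_mul_pinfty // ?lee_fin ?mulr_ge0.
Qed.

HB.instance Definition _ := GRing.isSubmodClosed.Build _ _ L2pred L2pred_closed.

Record L2fun := MkL2fun { L2val :> T -> R[i]; _ : L2val \in L2pred }.
HB.instance Definition _ := [isSub for L2val].
HB.instance Definition _ := [Choice of L2fun by <:].
HB.instance Definition _ := [SubChoice_isSubLmodule of L2fun by <:].

Definition L2null : {pred L2fun} := mem [set f : L2fun | {ae mu, forall x, f x = 0}].

Lemma L2null_closed : submod_closed L2null.
Proof.
split; first by rewrite inE /=; apply: aeW.
move=> c f g; rewrite !inE /=; apply: filterS2 => x.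
by rewrite !fctE /= => -> ->; rewrite scaler0 addr0.
Qed.

HB.instance Definition _ := GRing.isSubmodClosed.Build _ _ L2null L2null_closed.

Definition L2 : Type := Quotient.quot L2null.
HB.instance Definition _ := GRing.Zmodule.on L2.
HB.instance Definition _ := EqQuotient.on L2.

Definition L2scale (c : R[i]) (u : L2) : L2 := \pi_L2 (c *: repr u).

Lemma pi_L2scale c (f : L2fun) : L2scale c (\pi_L2 f) = \pi_L2 (c *: f).
Proof.
apply/eqP; rewrite -Quotient.idealrBE -scalerBr; apply: rpredZ.
by rewrite Quotient.idealrBE reprK.
Qed.

Lemma pi_L2D (f g : L2fun) : \pi_L2 (f + g) = \pi_L2 f + \pi_L2 g :> L2.
Proof. exact: Quotient.pi_add. Qed.

Let L2scaleA a b u : L2scale a (L2scale b u) = L2scale (a * b) u.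
Proof. by rewrite -[u](@reprK _ L2) !pi_L2scale scalerA. Qed.
Let L2scale1 : left_id 1 L2scale.
Proof. by move=> u; rewrite -[u](@reprK _ L2) pi_L2scale scale1r. Qed.
Let L2scaleDr : right_distributive L2scale +%R.
Proof.
move=> a u v; rewrite -[u](@reprK _ L2) -[v](@reprK _ L2).
by rewrite -pi_L2D !pi_L2scale scalerDr pi_L2D.
Qed.
Let L2scaleDl u : {morph L2scale^~ u : a b / a + b}.
Proof. by move=> a b; rewrite -[u](@reprK _ L2) !pi_L2scale scalerDl pi_L2D. Qed.

HB.instance Definition _ := GRing.Zmodule_isLmodule.Build R[i] L2
  L2scaleA L2scale1 L2scaleDr L2scaleDl.

(* The class of f, or 0 if f is not square integrable. *)
Definition toL2 (f : T -> R[i]) : L2 := \pi_L2 (insubd (0 : L2fun) f).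

Definition cintegral (f : T -> R[i]) : R[i] :=
  ((\int[mu]_x complex.Re (f x))%R +i* (\int[mu]_x complex.Im (f x))%R)%C.

Definition L2dot (u v : L2) : R[i] :=
  cintegral (fun x => conjc (repr u x) * repr v x).

Definition L2mul (u v : L2) : L2 := toL2 (fun x => repr u x * repr v x).

(* The smallest complete sigma-algebra containing G. *)
Definition complete_gen (G : set (set T)) : set (set T) :=
  <<s G `|` [set N | exists2 A, <<s G>> A & mu A = 0%E /\ N `<=` A] >>.

(* L^2(T, complete_gen G, mu) inside L^2(T, mu). *)
Definition L2meas (G : set (set T)) : {pred L2} :=
  mem [set u | exists2 f : L2fun, u = \pi_L2 f & cmeasurable (complete_gen G) f].

Lemma L2meas_closed G : submod_closed (L2meas G).
Proof.
split.
  rewrite inE /=; exists 0; first by apply: (addIr (\pi_L2 0)); rewrite -pi_L2D !add0r.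
  have s0 : complete_gen G set0 by exact: sigma_algebra0.
  split=> B _; rewrite preimage_cst; case: ifP => _ //;
    by rewrite -(setD0 setT); exact: sigma_algebraCD.
move=> c u v; rewrite !inE /= => -[f -> mf] [g -> mg].
exists (c *: f + g); first by rewrite pi_L2D -pi_L2scale.
exact: cmeasurable_lin.
Qed.

HB.instance Definition _ G :=
  GRing.isSubmodClosed.Build _ _ (L2meas G) (L2meas_closed G).

Record L2sub G := MkL2sub { L2sub_val :> L2; _ : L2sub_val \in L2meas G }.
HB.instance Definition _ G := [isSub for @L2sub_val G].
HB.instance Definition _ G := [Choice of L2sub G by <:].
HB.instance Definition _ G := [SubChoice_isSubLmodule of L2sub G by <:].

End L2.

Arguments L2pred {d T R} mu.
Arguments toL2 {d T R} mu f.
Arguments L2dot {d T R} mu u v.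
Arguments complete_gen {d T R} mu G.
Arguments L2meas {d T R} mu G.
Arguments L2sub {d T R} mu G.

Definition gen_by (I : Type) d (T : measurableType d) (R : realType) (D : set I)
    (f : I -> T -> \bar R) : set (set T) :=
  [set f i @^-1` A | i in D & A in @measurable _ (\bar R)].

Section point_process.
Context d (T : measurableType d) (R : realType) (Pr : probability T R).
Context d' (Z : measurableType d').
Local Open Scope ereal_scope.

Record point_process (eta : T -> {measure set Z -> \bar R}) : Prop := {
  pp_sigma_finite : forall w, sigma_finite setT (eta w);
  pp_nat : forall w B, measurable B ->
    (exists k : nat, eta w B = k%:R%:E) \/ eta w B = +oo;
  pp_measurable : forall B, measurable B ->
    measurable_fun setT (fun w => eta w B) }.

(* The Poisson weights are written out because [poisson_pmf 0 k] is 1 for all k. *)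
Record poisson_process (lambda : set Z -> \bar R)
    (eta : T -> {measure set Z -> \bar R}) : Prop := {
  poisson_point_process : point_process eta;
  poisson_fin : forall B (k : nat), measurable B -> lambda B < +oo ->
    Pr [set w | eta w B = k%:R%:E] =
    (fine (lambda B) ^+ k / k`!%:R * expR (- fine (lambda B)))%:E;
  poisson_infty : forall B, measurable B -> lambda B = +oo ->
    Pr [set w | eta w B = +oo] = 1;
  poisson_independent : forall n (B : 'I_n -> set Z),
    (forall i, measurable (B i)) -> trivIset setT B ->
    forall A : 'I_n -> set (\bar R), (forall i, measurable (A i)) ->
    Pr (\bigcap_i [set w | A i (eta w (B i))]) =
    \prod_(i < n) Pr [set w | A i (eta w (B i))] }.

End point_process.

Definition pos_real (R : realType) : Type := {r : R | 0 < r}.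
HB.instance Definition _ (R : realType) := Choice.on (pos_real R).
HB.instance Definition _ (R : realType) :=
  isPointed.Build (pos_real R) (exist _ 1 ltr01).
Definition pos_val (R : realType) (r : pos_real R) : R := sval r.

(* (0, oo) with its Borel sigma-algebra. *)
Notation posR R := (g_sigma_algebra_preimageType (@pos_val R)).

Section compound_poisson.
Context (R : realType) (d : nat) (P : set 'rV[R]_d).
Context dY (Y : measurableType dY) (act : 'rV[R]_d -> Y -> Y) (X : set Y).
Context dT (T : measurableType dT) (Pr : probability T R).
Context (eta : T -> {measure set (Y * posR R) -> \bar R}).

Definition compound_poisson (B : set Y) (w : T) : \bar R :=
  (\int[eta w]_z (pos_val z.2 * \1_B z.1)%:E)%E.
Local Notation xi := compound_poisson.

Definition translate (B : set Y) (a : 'rV[R]_d) : set Y := act a @` B.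

Definition eta_gen : set (set T) := gen_by measurable (fun B w => eta w B).

Definition xi_gen (C : set Y) : set (set T) :=
  gen_by [set B | measurable B /\ B `<=` C] xi.

(* Generators of F_{a,b} and of F_a. *)
Definition xi_gen2 a b := xi_gen (translate X a `\` translate X b).
Definition xi_gen1 a := xi_gen (X `\` translate X a).

Definition is_shift (S : 'rV[R]_d -> L2 Pr -> L2 Pr) :=
  forall a b c, P a -> P b -> P c -> P (b - a) ->
    unitary_on (L2dot Pr) (L2dot Pr)
      [set u | u \in L2meas Pr (xi_gen2 a b)]
      [set u | u \in L2meas Pr (xi_gen2 (a + c) (b + c))] (S c) /\
    forall n (B : 'I_n -> set Y) (f : n.-tuple (\bar R) -> R[i]),
      (forall i, measurable (B i) /\
                 B i `<=` translate X a `\` translate X b) ->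
      cmeasurable measurable f ->
      (fun w => f [tuple xi (B i) w | i < n]) \in L2pred Pr ->
      S c (toL2 Pr (fun w => f [tuple xi (B i) w | i < n])) =
      toL2 Pr (fun w => f [tuple xi (translate (B i) c) w | i < n]).

(* The shift unitaries. Each S_c is determined on every L^2(F_{a,b}), hence on
   their union; values elsewhere are irrelevant. *)
Definition shift : 'rV[R]_d -> L2 Pr -> L2 Pr :=
  @xget ('rV[R]_d -> L2 Pr -> L2 Pr)%type (fun=> id) is_shift.

Definition cpp_fibre (a : P) : lmodType R[i] := L2sub Pr (xi_gen1 (val a)).

Definition cpp_dot (a : P) (u v : cpp_fibre a) : R[i] := L2dot Pr (val u) (val v).

Definition cpp_sigma : set (set {a : P & cpp_fibre a}) :=
  preimage_set_system setT
    (fun x : {a : P & cpp_fibre a} => (tag x, val (tagged x)))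
    (sys_prod (borel_cone P) (hborel (L2dot Pr))).

(* [insubd] only serves to inject a + b into P and the product f S_a(g) into
   L^2(F_{a+b}). *)
Definition cpp_mul (x y : {a : P & cpp_fibre a}) : {a : P & cpp_fibre a} :=
  let c : P := insubd (tag x) (val (tag x) + val (tag y)) in
  Tagged cpp_fibre (insubd (0 : cpp_fibre c)
    (L2mul (val (tagged x)) (shift (val (tag x)) (val (tagged y))))).

End compound_poisson.

Arguments cpp_fibre {R d} P {dY Y} act X {dT T} Pr eta a.
Arguments cpp_dot {R d} P {dY Y} act X {dT T} Pr eta [a] u v.
Arguments cpp_sigma {R d} P {dY Y} act X {dT T} Pr eta.
Arguments cpp_mul {R d} P {dY Y} act X {dT T} Pr eta x y.

(* Main.v *)
Require Import Defs.
From HB Require Import structures.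
From mathcomp Require Import all_boot all_order all_algebra.
From mathcomp Require Import interval_inference ring_quotient generic_quotient.
From mathcomp Require Import complex ring lra.
From mathcomp Require Import all_classical all_reals all_analysis measurable_realfun.

(** Values of the process on disjoint sets are independent, so for
    u in L^2(F_a) and v in L^2(F_{a,a+b}) the pointwise product uv is square
    integrable and u (x) v |-> uv is isometric; its range is total because the
    events cut out over X \ (X+a) and over (X+a) \ (X+a+b) form a pi-system
    generating F_{a+b}.

    A Poisson process and its translate have the same law, since this law is
    determined by the values on finitely many disjoint sets. Hence
    F(eta) |-> F(eta(. + c)) is a well-defined unitary, multiplicative
    representation of R^d on L^2(Omega). It satisfies the conditions defining the
    shifts, and these conditions determine the shifts on each L^2(F_a) because
    the cylinder functions are dense there.

    For measurability, L^2(F_a) is the closure of countably many step functions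
    built from the events xi(C /\ (X \ (X+a))) < q, with C in a countable
    pi-system and q rational, and these depend measurably on a. A map into a
    separable Hilbert space is measurable as soon as it is approximated by
    measurable maps up to measurable errors, which gives the measurability of
    the shifts, of the product and of the sections, and exhibits the total space
    as a Borel subset of the Polish space R^d x L^2(Omega). *)

Set Implicit Arguments.
Unset Strict Implicit.
Unset Printing Implicit Defensive.
Import Order.TTheory GRing.Theory Num.Theory numFieldNormedType.Exports.
Local Open Scope classical_set_scope.
Local Open Scope ring_scope.

(** * Inner product spaces *)

(** The probability space need not carry a transformation that moves the process, so the shift
    cannot act on sample points. It acts on the space of all functions [set Z -> \bar R], where
    [eta] takes its values, and every class of L^2 is factored through [eta] by the Doob-Dynkin
    lemma; this is where [Omega_gen] enters. Points of that space are arbitrary set functions,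
    against which nothing can be integrated, so [marked] replaces the integral defining xi by a
    limsup of finite sums of rectangle values.

    Three constructions return a default outside their intended domain: [L2mul] when the product is
    not square integrable, [cpp_mul] through [insubd], and [shift] through [xget]. Hence square
    integrability of products is carried along as [L2mulable], above all for associativity, and the
    shift is shown to exist and to be unique before any product is computed.

    Null sets are the other obstacle: [eta] is finite on the sets of its cover only almost surely,
    whereas joint measurability in the parameter and the sample point is proved by subtracting
    finite measures at every point. Hence [eta0], and the sigma-algebra [ae_gen] of events known up
    to null sets. *)

Section inner_product_theory.
Context (R : realType) (V : lmodType R[i]) (dot : V -> V -> R[i]).
Hypothesis ip : inner_product dot.

Local Notation rdot u v := (complex.Re (dot u v)).
Local Notation N u := (hnorm dot u).

Lemma cReD (x y : R[i]) : complex.Re (x + y) = complex.Re x + complex.Re y.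
Proof. by case: x y => [? ?] []. Qed.
Lemma cImD (x y : R[i]) : complex.Im (x + y) = complex.Im x + complex.Im y.
Proof. by case: x y => [? ?] []. Qed.
Lemma cReN (x : R[i]) : complex.Re (- x) = - complex.Re x.
Proof. by case: x. Qed.
Lemma cImN (x : R[i]) : complex.Im (- x) = - complex.Im x.
Proof. by case: x. Qed.
Lemma Re_conjc (x : R[i]) : complex.Re (conjc x) = complex.Re x.
Proof. by case: x. Qed.
Lemma Im_conjc (x : R[i]) : complex.Im (conjc x) = - complex.Im x.
Proof. by case: x. Qed.
Lemma cReM (x y : R[i]) : complex.Re (x * y) =
  complex.Re x * complex.Re y - complex.Im x * complex.Im y.
Proof. by case: x y => [? ?] []. Qed.
Lemma cImM (x y : R[i]) : complex.Im (x * y) =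
  complex.Re x * complex.Im y + complex.Im x * complex.Re y.
Proof. by case: x y => [? ?] []. Qed.

Lemma complex_ext (x y : R[i]) : complex.Re x = complex.Re y ->
  complex.Im x = complex.Im y -> x = y.
Proof. by case: x y => [? ?] [? ?] /= -> ->. Qed.

Lemma dotDr u v w : dot u (v + w) = dot u v + dot u w.
Proof. by have := ip_linear ip u 1 v w; rewrite scale1r mul1r. Qed.

Lemma dot0r u : dot u 0 = 0.
Proof. by apply: (addIr (dot u 0)); rewrite -dotDr addr0 add0r. Qed.

Lemma dotZr c u v : dot u (c *: v) = c * dot u v.
Proof. by have := ip_linear ip u c v 0; rewrite dot0r !addr0. Qed.

Lemma dotNr u v : dot u (- v) = - dot u v.
Proof. by rewrite -scaleN1r dotZr mulN1r. Qed.

Lemma dotBr u v w : dot u (v - w) = dot u v - dot u w.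
Proof. by rewrite dotDr dotNr. Qed.

Lemma dotDl u v w : dot (u + v) w = dot u w + dot v w.
Proof. by rewrite (ip_conj ip) dotDr rmorphD /= -!(ip_conj ip). Qed.

Lemma dotNl u v : dot (- u) v = - dot u v.
Proof. by rewrite (ip_conj ip) dotNr rmorphN /= -!(ip_conj ip). Qed.

Lemma dotZl c u v : dot (c *: u) v = conjc c * dot u v.
Proof. by rewrite (ip_conj ip) dotZr rmorphM /= -!(ip_conj ip). Qed.

Lemma dot0l u : dot 0 u = 0.
Proof. by rewrite (ip_conj ip) dot0r conjc0. Qed.

Lemma rdotC u v : rdot u v = rdot v u.
Proof. by rewrite (ip_conj ip) Re_conjc. Qed.

Lemma rdot_ge0 u : 0 <= rdot u u.
Proof. by have := ip_ge0 ip u; rewrite lecE => /andP[_]. Qed.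

Lemma hnormE u : (N u) ^+ 2 = rdot u u.
Proof. by rewrite /hnorm sqr_sqrtr // rdot_ge0. Qed.

Lemma hnorm_ge0 u : 0 <= (N u).
Proof. exact: sqrtr_ge0. Qed.

Lemma dotii u : dot u u = ((N u) ^+ 2)%:C%C.
Proof.
rewrite hnormE; apply: complex_ext => //=.
by have := ger0_Im (ip_ge0 ip u).
Qed.

Lemma hnorm0 : (N 0) = 0.
Proof. by rewrite /hnorm dot0l sqrtr0. Qed.

Lemma hnorm0_eq0 u : (N u) = 0 -> u = 0.
Proof. by move=> u0; apply: (ip_eq0 ip); rewrite dotii u0 expr0n. Qed.

Definition cabs (c : R[i]) : R := Num.sqrt (complex.Re c ^+ 2 + complex.Im c ^+ 2).

Lemma cabs_ge0 c : 0 <= cabs c.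
Proof. exact: sqrtr_ge0. Qed.

Lemma hnormZ c u : (N (c *: u)) = cabs c * (N u).
Proof.
rewrite /hnorm /cabs -sqrtrM ?addr_ge0 ?sqr_ge0 //; congr Num.sqrt.
rewrite dotZr dotZl dotii; case: c => a b.
by rewrite !cReM !cImM /=; ring.
Qed.

Lemma hnormN u : (N (- u)) = (N u).
Proof. by rewrite /hnorm dotNl dotNr opprK. Qed.

Lemma hnormBC u v : (N (u - v)) = (N (v - u)).
Proof. by rewrite -hnormN opprB. Qed.

Lemma hnormD_sqr u v : (N (u + v)) ^+ 2 = (N u) ^+ 2 + 2 * rdot u v + (N v) ^+ 2.
Proof. by rewrite !hnormE dotDr !dotDl !cReD (rdotC v u); ring. Qed.

Lemma hnormB_sqr u v : (N (u - v)) ^+ 2 = (N u) ^+ 2 - 2 * rdot u v + (N v) ^+ 2.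
Proof. by rewrite hnormD_sqr hnormN dotNr cReN mulrN. Qed.

Lemma rdot_le u v : rdot u v <= (N u) * (N v).
Proof.
have H (x y : V) (t : R) : 0 <= (N x) ^+ 2 - 2 * t * rdot x y + t ^+ 2 * (N y) ^+ 2.
  have := sqr_ge0 ((N (x - t%:C%C *: y))); rewrite hnormB_sqr dotZr cReM /= mul0r subr0.
  rewrite hnormZ /cabs /= expr0n /= addr0 sqrtr_sqr exprMn real_normK ?num_real //.
  by rewrite mulrA.
have [v0|v0] := eqVneq (N v) 0.
  by rewrite (hnorm0_eq0 v0) dot0r hnorm0 mulr0.
have vp : 0 < (N v) by rewrite lt_neqAle eq_sym v0 hnorm_ge0.
have [u0|u0] := eqVneq (N u) 0.
  by rewrite (hnorm0_eq0 u0) dot0l hnorm0 mul0r.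
have up : 0 < (N u) by rewrite lt_neqAle eq_sym u0 hnorm_ge0.
(* This [t] makes the terms [(N u) ^+ 2] and [t ^+ 2 * (N v) ^+ 2] equal, so that a single factor
   [N u] can be cancelled. *)
have := H u v ((N u) / (N v)).
rewrite exprMn exprVn divfK ?expf_neq0 // -addrA addrC -addrA -mulr2n -mulr_natl.
rewrite -mulrA -[X in _ + X]opprK -opprD.
rewrite (_ : - _ = 2 * ((N u) ^+ 2 - (N u) / (N v) * rdot u v)); last by ring.
rewrite pmulr_rge0 // subr_ge0 mulrAC -mulrA expr2.
by rewrite ler_pM2l // ler_pdivrMr.
Qed.

Lemma hnormD u v : (N (u + v)) <= (N u) + (N v).
Proof.
rewrite -ler_sqr ?nnegrE ?addr_ge0 ?hnorm_ge0 //.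
by rewrite hnormD_sqr sqrrD lerD2r lerD2l -(mulr_natl (_ * _)) ler_wpM2l // rdot_le.
Qed.

Lemma hnorm_dist v u w : (N (u - w)) <= (N (u - v)) + (N (v - w)).
Proof. by rewrite -(subrKA v) hnormD. Qed.

Lemma hnorm_lip u v : `|(N u) - (N v)| <= (N (u - v)).
Proof.
rewrite ler_norml; apply/andP; split.
  by rewrite lerNl opprB lerBlDr hnormBC (le_trans _ (hnormD _ _)) ?subrK.
by rewrite lerBlDr (le_trans _ (hnormD _ _)) ?subrK.
Qed.

Lemma abs_rdot_le u v : `|rdot u v| <= (N u) * (N v).
Proof.
rewrite ler_norml rdot_le andbT lerNl -cReN -dotNr (le_trans (rdot_le _ _)) //.
by rewrite hnormN.
Qed.

(** Linearity in the second variable turns an imaginary part into the real part against a rotated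
    vector, so polarisation and measurability arguments need only treat real parts. *)
Lemma Im_dot u v : complex.Im (dot u v) = - rdot u ('i%C *: v).
Proof. by rewrite dotZr cReM /=; ring. Qed.

Definition hcvg (u : nat -> V) (l : V) := (fun n => (N (u n - l))) @ \oo --> (0 : R).

Lemma hcvg_near u l e : hcvg u l -> 0 < e -> \forall n \near \oo, N (u n - l) < e.
Proof.
move=> ul e0; have /cvgrPdist_lt /(_ e e0) := ul; apply: filterS => n.
by rewrite sub0r normrN ger0_norm ?hnorm_ge0.
Qed.

Lemma hcvg_unique u l l' : hcvg u l -> hcvg u l' -> l = l'.
Proof.
move=> ul ul'; apply/eqP; rewrite -subr_eq0; apply/eqP/hnorm0_eq0/eqP.
rewrite eq_le hnorm_ge0 andbT -[leRHS](addr0 0).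
rewrite -(cvg_lim _ (cvgD ul ul')) //; apply: limr_ge; first by apply: cvgP (cvgD ul ul').
by near=> n; rewrite hnormBC (le_trans (hnorm_dist (u n) _ _)) //= hnormBC addrC lerD // hnormBC.
Unshelve. all: by end_near. Qed.

Lemma hcvg_rdot u l w : hcvg u l -> (fun n => rdot w (u n)) @ \oo --> rdot w l.
Proof.
move=> ul; apply/cvgrPdist_le => e e0.
have w1 : 0 < (N w) + 1 by rewrite ltr_wpDl ?hnorm_ge0.
have := hcvg_near ul (divr_gt0 e0 w1).
apply: filterS => n /ltW h.
rewrite -cReN -cReD -dotBr (le_trans (abs_rdot_le _ _)) // hnormBC.
rewrite (@le_trans _ _ (((N w) + 1) * (N (u n - l)))) //.
  by rewrite ler_wpM2r ?hnorm_ge0 // lerDl.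
by rewrite mulrC -ler_pdivlMr.
Qed.

Lemma hcvg_norm u l : hcvg u l -> (fun n => (N (u n))) @ \oo --> (N l).
Proof.
move=> ul; apply/cvgrPdist_le => e e0.
have := hcvg_near ul e0; apply: filterS => n.
move=> /ltW; rewrite hnormBC; apply: le_trans.
exact: hnorm_lip.
Qed.

Lemma cvg_to0 (f : nat -> R) : (forall n, 0 <= f n) ->
  (forall e, 0 < e -> \forall n \near \oo, f n <= e) -> f @ \oo --> (0 : R).
Proof.
move=> f0 h; apply/cvgrPdist_le => e /h; apply: filterS => n.
by rewrite sub0r normrN ger0_norm.
Qed.

Lemma hcvg_seq u l : (forall n, (N (l - u n)) < n.+1%:R^-1) -> hcvg u l.
Proof.
move=> h; apply: cvg_to0 => [n|e e0]; first exact: hnorm_ge0.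
have := near_infty_natSinv_lt (PosNum e0); apply: filterS => n /ltW /=.
by apply: le_trans; rewrite hnormBC ltW.
Qed.

(** Serves as an induction principle: a property extends from generators to their closed span as
    soon as the vectors having it form such a set. *)
Record closed_subspace (K : set V) : Prop := {
  cs_0 : K 0;
  cs_lin : forall c u v, K u -> K v -> K (c *: u + v);
  cs_closed : forall u, (forall e : R, 0 < e -> exists2 v, K v & (N (u - v)) < e) -> K u }.

Lemma cs_D K u v : closed_subspace K -> K u -> K v -> K (u + v).
Proof. by move=> cK Ku Kv; rewrite -[u]scale1r; apply: (cs_lin cK). Qed.

Lemma cs_Z K c u : closed_subspace K -> K u -> K (c *: u).
Proof. by move=> cK Ku; rewrite -[_ *: _]addr0; apply: (cs_lin cK) => //; exact: cs_0. Qed.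

Lemma cs_B K u v : closed_subspace K -> K u -> K v -> K (u - v).
Proof. by move=> cK Ku Kv; rewrite -scaleN1r addrC; apply: (cs_lin cK). Qed.

Lemma cs_cvg K u l : closed_subspace K -> (forall n, K (u n)) -> hcvg u l -> K l.
Proof.
move=> cK Ku ul; apply: (cs_closed cK) => e e0.
have [k _ /(_ k (leqnn k)) h] := hcvg_near ul e0.
by exists (u k) => //; rewrite hnormBC.
Qed.

(** Coefficients are attached to indices and not to vectors, so that one list can be evaluated along
    two families living in different spaces. *)
Definition comb (I : Type) (a : I -> V) (s : seq (R[i] * I)) : V :=
  \sum_(x <- s) x.1 *: a x.2.

Lemma comb_cons I (a : I -> V) x s : comb a (x :: s) = x.1 *: a x.2 + comb a s.
Proof. by rewrite /comb big_cons. Qed.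

Lemma comb_cat I (a : I -> V) s t : comb a (s ++ t) = comb a s + comb a t.
Proof. by rewrite /comb big_cat. Qed.

Lemma comb_scale I (a : I -> V) c s :
  comb a [seq (c * x.1, x.2) | x <- s] = c *: comb a s.
Proof.
by rewrite /comb big_map scaler_sumr; apply: eq_bigr => x _; rewrite scalerA.
Qed.

Lemma htotal_comb (I : Type) (a : I -> V) : htotal dot (range a) ->
  forall v (e : R), 0 < e -> exists s, (N (v - comb a s)) < e.
Proof.
move=> ta v e /(ta v)[n [c [s [sa h]]]].
have /choice[j jE] i : exists j, s i = a j by have [j _ <-] := sa i; exists j.
exists [seq (c i, j i) | i <- enum 'I_n].
rewrite /comb big_map big_enum /=.
by under eq_bigr do rewrite -jE.
Qed.

Lemma comb_htotal (I : Type) (a : I -> V) :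
  (forall v (e : R), 0 < e -> exists s, (N (v - comb a s)) < e) -> htotal dot (range a).
Proof.
move=> h v e e0; have [[|x0 s] vs] := h v e e0.
  exists 0, (fun _ => 0), (fun _ => 0); split; first by case.
  by rewrite big_ord0; rewrite /comb big_nil in vs.
exists (size (x0 :: s)), (fun i => (nth x0 (x0 :: s) i).1),
  (fun i => a (nth x0 (x0 :: s) i).2); split.
  by move=> i; exists (nth x0 (x0 :: s) i).2.
by move: vs; rewrite /comb (big_nth x0) big_mkord.
Qed.

(* The closure of the span of S is the intersection of the closed subspaces
   containing S. *)
Lemma htotal_closed_subspace (S : set V) : S !=set0 ->
  (forall K, closed_subspace K -> S `<=` K -> forall v, K v) -> htotal dot S.
Proof.
move=> [s0 Ss0] H.
pose a (x : {x | S x}) := sval x.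
suff h : htotal dot (range a).
  move=> v e /(h v)[n [c [s [sa hv]]]]; exists n, c, s; split=> // i.
  by have [x _ <-] := sa i; exact: (svalP x).
apply: comb_htotal => v0.
apply: (H [set v | forall e : R, 0 < e -> exists s, N (v - comb a s) < e]); last first.
  move=> s Ss e e0; exists [:: (1, exist _ s Ss)].
  by rewrite comb_cons /comb big_nil scale1r addr0 subrr hnorm0.
split.
- by move=> e e0; exists [::]; rewrite /comb big_nil subr0 hnorm0.
- move=> c u v Ku Kv e e0.
  have c1 : 0 < cabs c + 1 by rewrite ltr_wpDl ?cabs_ge0.
  have [s us] := Ku (e / 2 / (cabs c + 1)) ltac:(by rewrite !divr_gt0).
  have [t vt] := Kv (e / 2) ltac:(by rewrite !divr_gt0).
  exists ([seq (c * x.1, x.2) | x <- s] ++ t).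
  rewrite comb_cat comb_scale opprD addrACA -scalerBr.
  rewrite (le_lt_trans (hnormD _ _)) // (splitr e) ler_ltD // hnormZ.
  rewrite (@le_trans _ _ ((cabs c + 1) * (N (u - comb a s)))) //.
    by rewrite ler_wpM2r ?hnorm_ge0 // lerDl.
  by rewrite mulrC -ler_pdivlMr // ltW.
- move=> u Ku e e0.
  have [v Kv uv] := Ku (e / 2) ltac:(by rewrite divr_gt0).
  have [s vs] := Kv (e / 2) ltac:(by rewrite divr_gt0).
  by exists s; rewrite (le_lt_trans (hnorm_dist v _ _)) // (splitr e) ltrD.
Qed.

End inner_product_theory.

Arguments comb {R V I} a s.

(** * Isometries determined on a total family *)

Section isometry_extension.
Context (R : realType) (V W : lmodType R[i]).
Context (dV : V -> V -> R[i]) (dW : W -> W -> R[i]).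
Context (I : Type) (a : I -> V) (b : I -> W).
Hypotheses (hV : hilbert dV) (hW : hilbert dW).
Hypothesis ab : forall i j, dW (b i) (b j) = dV (a i) (a j).

Let ipV := hV.1.
Let ipW := hW.1.

Let dot_comb s t : dW (comb b s) (comb b t) = dV (comb a s) (comb a t).
Proof.
elim: s => [|x s IH]; first by rewrite /comb !big_nil !(dot0l ipV) !(dot0l ipW).
rewrite !comb_cons !(dotDl ipV) !(dotDl ipW) IH; congr (_ + _).
rewrite (dotZl ipV) (dotZl ipW); congr (_ * _).
elim: t {IH} => [|y t IH]; first by rewrite /comb !big_nil !(dot0r ipV) !(dot0r ipW).
by rewrite !comb_cons !(dotDr ipV) !(dotDr ipW) IH !(dotZr ipV) !(dotZr ipW) ab.
Qed.

Let hnorm_comb s : hnorm dW (comb b s) = hnorm dV (comb a s).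
Proof. by rewrite /hnorm dot_comb. Qed.

Let combB (U : lmodType R[i]) (c : I -> U) s t :
  comb c (s ++ [seq (-1 * x.1, x.2) | x <- t]) = comb c s - comb c t.
Proof. by rewrite comb_cat comb_scale scaleN1r. Qed.

(* The closure of the graph of the linear extension of a i |-> b i. *)
Let graph v w := forall e : R, 0 < e ->
  exists s, hnorm dV (v - comb a s) < e /\ hnorm dW (w - comb b s) < e.

Let graph_i i : graph (a i) (b i).
Proof.
move=> e e0; exists [:: (1, i)].
by rewrite !comb_cons /comb !big_nil !scale1r !addr0 !subrr (hnorm0 ipV) (hnorm0 ipW).
Qed.

Let graph_lin c v w v' w' : graph v w -> graph v' w' ->
  graph (c *: v + v') (c *: w + w').
Proof.
move=> g g' e e0.
have c1 : 0 < cabs c + 1 by rewrite ltr_wpDl ?cabs_ge0.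
have [s [vs ws]] := g (e / 2 / (cabs c + 1)) ltac:(by rewrite !divr_gt0).
have [t [vt wt]] := g' (e / 2) ltac:(by rewrite !divr_gt0).
have H (U : lmodType R[i]) (dU : U -> U -> R[i]) (ipU : inner_product dU) u u' x x' :
    hnorm dU (u - x) < e / 2 / (cabs c + 1) -> hnorm dU (u' - x') < e / 2 ->
    hnorm dU (c *: u + u' - (c *: x + x')) < e.
  move=> ux ux'; rewrite opprD addrACA -scalerBr.
  rewrite (le_lt_trans (hnormD ipU _ _)) // (splitr e) ler_ltD // (hnormZ ipU).
  rewrite (@le_trans _ _ ((cabs c + 1) * hnorm dU (u - x))) //.
    by rewrite ler_wpM2r ?hnorm_ge0 // lerDl.
  by rewrite mulrC -ler_pdivlMr // ltW.
exists ([seq (c * x.1, x.2) | x <- s] ++ t).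
by rewrite !comb_cat !comb_scale; split; apply: H.
Qed.

Let graph_norm v w : graph v w -> hnorm dW w = hnorm dV v.
Proof.
move=> g; apply/eqP; rewrite eq_sym -subr_eq0 -normr_le0; apply/ler_addgt0Pr => e e0.
have [s [vs ws]] := g (e / 2) ltac:(by rewrite divr_gt0).
rewrite add0r -(subrKA (hnorm dV (comb a s))) (splitr e) (le_trans (ler_normD _ _)) //.
apply: lerD; first by rewrite (le_trans (hnorm_lip ipV _ _)) // ltW.
by rewrite -hnorm_comb distrC (le_trans (hnorm_lip ipW _ _)) // ltW.
Qed.

Let graph_unique v w w' : graph v w -> graph v w' -> w = w'.
Proof.
move=> g g'; apply/eqP; rewrite eq_sym -subr_eq0; apply/eqP/(hnorm0_eq0 ipW).
rewrite addrC -scaleN1r (@graph_norm (-1 *: v + v)); last exact: graph_lin.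
by rewrite scaleN1r addNr (hnorm0 ipV).
Qed.

(** Polarisation: the norm of a sum is preserved along the graph, which gives the real parts;
    rotating the second pair by ['i] gives the imaginary parts. *)
Let graph_dot v w v' w' : graph v w -> graph v' w' -> dW w w' = dV v v'.
Proof.
have H u x u' x' : graph u x -> graph u' x' ->
    complex.Re (dW x x') = complex.Re (dV u u').
  move=> g g'.
  have : hnorm dW (1 *: x + x') ^+ 2 = hnorm dV (1 *: u + u') ^+ 2.
    by rewrite (graph_norm (graph_lin _ g g')).
  rewrite !scale1r (hnormD_sqr ipV) (hnormD_sqr ipW) (graph_norm g) (graph_norm g').
  by move=> /addIr /addrI /mulfI; apply; rewrite pnatr_eq0.
move=> g g'; apply: complex_ext; first exact: H.
rewrite (Im_dot ipV) (Im_dot ipW); congr (- _); apply: H => //.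
rewrite -[_ *: v']addr0 -[_ *: w']addr0; apply: graph_lin => // e e0.
by exists [::]; rewrite /comb !big_nil !subr0 (hnorm0 ipV) (hnorm0 ipW).
Qed.

(** Combinations of the [b i] have the same mutual distances as those of the [a i], so the images of
    a sequence of combinations tending to [v] form a Cauchy sequence, which converges by
    completeness of [W]. *)
Let graph_ex v : htotal dV (range a) -> exists w, graph v w.
Proof.
move=> ta.
have /choice[s vs] n := htotal_comb ta v (ltac:(by rewrite invr_gt0) : 0 < n.+1%:R^-1 :> R).
have cs : hcvg dV (fun n => comb a (s n)) v by exact: hcvg_seq.
have [e e0|w ws] := hW.2 (fun n => comb b (s n)).
  have [N _ hN] := hcvg_near cs (ltac:(by rewrite divr_gt0) : 0 < e / 2).
  exists N => m n Nm Nn.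
  rewrite -combB hnorm_comb combB (le_lt_trans (hnorm_dist ipV v _ _)) //.
  by rewrite (splitr e) ltrD // ?(hnormBC ipV v) hN.
exists w => e e0.
have [N _ hN] := hcvg_near cs e0; have [M _ hM] := hcvg_near ws e0.
exists (s (maxn N M)); rewrite (hnormBC ipV) (hnormBC ipW).
by split; [apply: hN; exact: leq_maxl|apply: hM; exact: leq_maxr].
Qed.

Lemma isometry_extension : htotal dV (range a) ->
  exists2 U : V -> W, (forall i, U (a i) = b i) &
    (forall c u v, U (c *: u + v) = c *: U u + U v) /\
    (forall u v, dW (U u) (U v) = dV u v).
Proof.
move=> ta; have /choice[U gU] v := graph_ex v ta.
exists U => [i|]; first exact: graph_unique (gU _) (graph_i i).
split=> [c u v|u v]; last exact: graph_dot.
by apply: graph_unique (gU _) _; exact: graph_lin.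
Qed.

End isometry_extension.

Lemma unitary_extension (R : realType) (V W : lmodType R[i])
  (dV : V -> V -> R[i]) (dW : W -> W -> R[i]) (I : Type) (a : I -> V) (b : I -> W) :
  hilbert dV -> hilbert dW -> (forall i j, dW (b i) (b j) = dV (a i) (a j)) ->
  htotal dV (range a) -> htotal dW (range b) ->
  exists2 U : V -> W, unitary_on dV dW setT setT U & forall i, U (a i) = b i.
Proof.
move=> hV hW ab ta tb.
have [U Uab [Ul Ud]] := isometry_extension hV hW ab ta.
(* Surjectivity comes from totality of [b]: the extension in the opposite direction supplies the
   preimage [U' w], and [U (U' w) = w] holds on combinations of the [b i], hence everywhere by
   density. *)
have [U' Uba [U'l U'd]] := isometry_extension hW hV (fun i j => esym (ab i j)) tb.
exists U => //; split; [|by move=> *|by move=> *].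
apply/seteqP; split=> // w _; exists (U' w) => //.
have U0 : U 0 = 0 by have := Ul (-1) 0 0; rewrite scaler0 addr0 scaleN1r addNr.
have U'0 : U' 0 = 0 by have := U'l (-1) 0 0; rewrite scaler0 addr0 scaleN1r addNr.
have Ucomb s : U (comb a s) = comb b s.
  by elim: s => [|x s IH]; rewrite ?comb_cons ?Ul ?IH ?Uab // /comb !big_nil.
have U'comb s : U' (comb b s) = comb a s.
  by elim: s => [|x s IH]; rewrite ?comb_cons ?U'l ?IH ?Uba // /comb !big_nil.
have nU u v : hnorm dW (U u - U v) = hnorm dV (u - v).
  have -> : U u - U v = U (u - v) by rewrite addrC -scaleN1r -Ul scaleN1r addrC.
  by rewrite /hnorm Ud.
have nU' u v : hnorm dV (U' u - U' v) = hnorm dW (u - v).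
  have -> : U' u - U' v = U' (u - v) by rewrite addrC -scaleN1r -U'l scaleN1r addrC.
  by rewrite /hnorm U'd.
apply/eqP; rewrite -subr_eq0; apply/eqP/(hnorm0_eq0 hW.1)/eqP.
rewrite -(normr_le0 (hnorm _ _)) ger0_norm ?hnorm_ge0 //; apply/ler_addgt0Pr => e e0.
have [s ws] := htotal_comb tb w (ltac:(by rewrite divr_gt0) : 0 < e / 2).
rewrite add0r (le_trans (hnorm_dist hW.1 (comb b s) _ _)) // (splitr e) lerD //.
  by rewrite -Ucomb nU -U'comb nU' ltW.
by rewrite (hnormBC hW.1) ltW.
Qed.

(* If delta n t is a distance from phi n t to phi t that is arbitrarily small in n,
   choosing the first n with delta n t < 1/(k+1) exhibits phi as a limit. *)
Lemma measurable_fun_nearest d (T : measurableType d) (R : realType)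
    (phi_ delta : nat -> T -> R) (phi : T -> R) :
  (forall n, measurable_fun setT (phi_ n)) ->
  (forall n, measurable_fun setT (delta n)) ->
  (forall t (e : R), 0 < e -> exists n, delta n t < e) ->
  (forall t (s : nat -> nat), (forall k, delta (s k) t < k.+1%:R^-1) ->
     (fun k => phi_ (s k) t) @ \oo --> phi t) ->
  measurable_fun setT phi.
Proof.
move=> mphi mdelta ex cv.
have exb t k : exists n, (delta n t < k.+1%:R^-1) by apply: ex; rewrite invr_gt0.
pose s k t := ex_minn (exb t k).
pose f k t := phi_ (s k t) t.
apply: (@measurable_fun_cvg _ _ _ setT f) => // [k|t _]; last first.
  by apply: cv => k; rewrite /s; case: ex_minnP.
have ms n : measurable [set t | s k t = n].
  have -> : [set t | s k t = n] = [set t | delta n t < k.+1%:R^-1] `&`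
      \bigcap_(m in [set m | (m < n)%N]) ~` [set t | delta m t < k.+1%:R^-1].
    apply/seteqP; split=> [t <-|t [tn tm]]; rewrite /s /=; case: ex_minnP => m mt mmin.
      by split=> // j /= jm jt; have := mmin _ jt; rewrite leqNgt jm.
    by apply/eqP; rewrite eqn_leq mmin //= leqNgt; apply/negP => /tm; apply.
  have mlt m : measurable [set t | delta m t < k.+1%:R^-1].
    rewrite (_ : mkset _ = setT `&` delta m @^-1` `]-oo, k.+1%:R^-1[%classic).
      exact: mdelta.
    by apply/seteqP; split=> u /=; rewrite in_itv/=; [move=> ?; split|case].
  by apply: measurableI => //; apply: bigcap_measurableType => m _; exact: measurableC.
move=> _ B mB; rewrite setTI.
have -> : f k @^-1` B = \bigcup_n ([set t | s k t = n] `&` phi_ n @^-1` B).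
  apply/seteqP; split=> [t ft|t [n _ [<- //]]]; exists (s k t) => //; split=> //.
by apply: bigcup_measurable => n _; apply: measurableI => //; rewrite -[X in measurable X]setTI; exact: mphi.
Qed.

(** * The Hilbert space L^2 *)

Lemma sys_measurable_funP d d' (T : measurableType d) (U : measurableType d')
    (f : T -> U) :
  sys_measurable (@measurable _ T) (@measurable _ U) f <-> measurable_fun setT f.
Proof.
split=> [mf _ B mB|mf B mB]; first by rewrite setTI; exact: mf.
by rewrite -[X in measurable X]setTI; exact: mf.
Qed.

Lemma cmeasurable_funP d (T : measurableType d) (R : realType) (f : T -> R[i]) :
  cmeasurable (@measurable _ T) f <->
  measurable_fun setT (fun x => complex.Re (f x)) /\
  measurable_fun setT (fun x => complex.Im (f x)).
Proof. by split=> -[/sys_measurable_funP ? /sys_measurable_funP ?]. Qed.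

Section L2_basics.
Context d (T : measurableType d) (R : realType) (P : probability T R).
Local Open Scope quotient_scope.
Local Notation L2 := (L2 P).
Local Notation toL2 := (toL2 P).
Local Notation L2p := (L2pred P).
Local Notation dot := (L2dot P).
Local Notation N := (hnorm (L2dot P)).

Definition rL2 (f : T -> R) := measurable_fun setT f /\ (\int[P]_x ((f x) ^+ 2)%:E < +oo)%E.

Lemma rL2_le (f g : T -> R) : measurable_fun setT f -> rL2 g ->
  (forall x, `|f x| <= `|g x|) -> rL2 f.
Proof.
move=> mf [mg ig] fg; split=> //; apply: le_lt_trans ig.
apply: ge0_le_integral => //.
- by move=> x _; rewrite lee_fin sqr_ge0.
- by apply/measurable_EFinP; exact: measurable_funX.
- by apply/measurable_EFinP; exact: measurable_funX.
- by move=> x _; rewrite lee_fin -[leLHS]real_normK ?num_real // -[leRHS]real_normK ?num_real // lerXn2r ?nnegrE.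
Qed.

Lemma L2predP (f : T -> R[i]) :
  f \in L2p <-> rL2 (fun x => complex.Re (f x)) /\ rL2 (fun x => complex.Im (f x)).
Proof.
rewrite inE /=; split=> [[/cmeasurable_funP[mr mi] lt]|[[mr ir] [mi ii]]].
  split; (split=> //; apply: le_lt_trans lt; apply: ge0_le_integral => //;
    [by move=> x _; rewrite lee_fin sqr_ge0
    |by apply/measurable_EFinP; exact: measurable_funX
    |by apply/measurable_EFinP; apply: measurable_funD; exact: measurable_funX
    |by move=> x _; rewrite lee_fin ?lerDl ?lerDr sqr_ge0]).
split; first exact/cmeasurable_funP.
under eq_integral do rewrite EFinD.
rewrite ge0_integralD //=; first exact: lte_add_pinfty.
- by move=> x _; rewrite lee_fin sqr_ge0.
- by apply/measurable_EFinP; exact: measurable_funX.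
- by move=> x _; rewrite lee_fin sqr_ge0.
- by apply/measurable_EFinP; exact: measurable_funX.
Qed.

Lemma rL2_integrableM (f g : T -> R) : rL2 f -> rL2 g ->
  P.-integrable setT (EFin \o (fun x => f x * g x)).
Proof.
move=> [mf lf] [mg lg].
have mf2 : measurable_fun setT (fun x => (f x ^+ 2)%:E).
  by apply/measurable_EFinP; exact: measurable_funX.
have mg2 : measurable_fun setT (fun x => (g x ^+ 2)%:E).
  by apply/measurable_EFinP; exact: measurable_funX.
apply: (@le_integrable _ _ _ P _ measurableT _ (fun x => (f x ^+ 2 + g x ^+ 2)%:E)).
- by apply/measurable_EFinP; exact: measurable_funM.
- move=> x _ /=; rewrite lee_fin [leRHS]ger0_norm ?addr_ge0 ?sqr_ge0 //.
  have := sqr_ge0 (`|f x| - `|g x|); rewrite sqrrB !real_normK ?num_real // normrM => h.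
  have := mulr_ge0 (normr_ge0 (f x)) (normr_ge0 (g x)); move: h; lra.
- apply/integrableP; split.
    apply/measurable_EFinP; apply: measurable_funD; exact: measurable_funX.
  under eq_integral do rewrite gee0_abs ?lee_fin ?addr_ge0 ?sqr_ge0 // EFinD.
  rewrite ge0_integralD //=; first exact: lte_add_pinfty.
  - by move=> x _; rewrite lee_fin sqr_ge0.
  - by move=> x _; rewrite lee_fin sqr_ge0.
Qed.

Lemma rL2D f g : rL2 f -> rL2 g -> rL2 (fun x => f x + g x).
Proof.
move=> lf lg; have [mf _] := lf; have [mg _] := lg.
split; first exact: measurable_funD.
have := integrableD measurableT (integrableD measurableT (rL2_integrableM lf lf)
  (rL2_integrableM lg lg)) (integrableD measurableT (rL2_integrableM lf lg)
  (rL2_integrableM lf lg)) => /integrableP[_].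
apply: le_lt_trans; apply: ge0_le_integral => //.
- by move=> x _; rewrite lee_fin sqr_ge0.
- by apply/measurable_EFinP/measurable_funX; exact: measurable_funD.
- apply: measurableT_comp => //; do ![apply: emeasurable_funD];
    apply/measurable_EFinP; exact: measurable_funM.
- by move=> x _ /=; rewrite lee_fin (le_trans _ (ler_norm _)) // sqrrD !expr2 mulr2n; lra.
Qed.

Lemma rL2Z (c : R) f : rL2 f -> rL2 (fun x => c * f x).
Proof.
move=> lf; have [mf _] := lf; split; first by apply: measurable_funM => //; exact: measurable_cst.
have /integrableP[_] := integrableZl measurableT (c ^+ 2) (rL2_integrableM lf lf).
apply: le_lt_trans; apply: ge0_le_integral => //.
- by move=> x _; rewrite lee_fin sqr_ge0.
- by apply/measurable_EFinP/measurable_funX/measurable_funM => //; exact: measurable_cst.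
- apply: measurableT_comp => //; apply: measurable_funeM.
  by apply/measurable_EFinP; exact: measurable_funM.
- by move=> x _ /=; rewrite lee_fin (le_trans _ (ler_norm _)) // exprMn expr2.
Qed.

Lemma rL2N f : rL2 f -> rL2 (fun x => - f x).
Proof. by move=> /(rL2Z (-1)); under eq_fun do rewrite mulN1r. Qed.

Lemma rL2B f g : rL2 f -> rL2 g -> rL2 (fun x => f x - g x).
Proof. by move=> lf /rL2N; exact: rL2D. Qed.

Lemma bounded_rL2 (f : T -> R) (M : R) : measurable_fun setT f ->
  (forall x, `|f x| <= M) -> rL2 f.
Proof.
move=> mf fM; apply: (@rL2_le _ (cst M)) => //; last first.
  by move=> x; rewrite (le_trans (fM x)) // ler_norm.
split; first exact: measurable_cst.
have -> : (\int[P]_x (cst M x ^+ 2)%:E = \int[P]_x cst (M ^+ 2)%:E x)%E by [].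
rewrite integral_cst //.
suff -> : ((M ^+ 2)%:E * P setT = (M ^+ 2)%:E)%E by rewrite ltry.
by rewrite -[RHS]mule1; congr (_ * _)%E; exact: probability_setT.
Qed.

Lemma L2fun_pred (f : L2fun P) : (f : T -> R[i]) \in L2p.
Proof. by case: f. Qed.

Lemma pi_L2P (f g : L2fun P) :
  \pi_L2 f = \pi_L2 g :> L2 <-> {ae P, forall x, f x = g x}.
Proof.
have -> : (\pi_L2 f = \pi_L2 g :> L2) <-> (f - g \in @L2null _ _ _ P).
  split=> [/eqP|h]; first by rewrite -Quotient.idealrBE.
  by apply/eqP; rewrite -Quotient.idealrBE.
rewrite inE /=; split; apply: filterS => x; rewrite !fctE.
  by move=> /eqP; rewrite subr_eq0 => /eqP.
by move=> ->; rewrite subrr.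
Qed.

Lemma repr_pi (f : L2fun P) : {ae P, forall x, (repr (\pi_L2 f : L2) : L2fun P) x = f x}.
Proof. by apply/pi_L2P; rewrite reprK. Qed.

Lemma toL2E f (fL : f \in L2p) : toL2 f = \pi_L2 (MkL2fun fL).
Proof.
rewrite /Defs.toL2; congr (\pi_L2 _); apply: val_inj.
by rewrite /insubd insubT.
Qed.

(** Elimination principle: an argument about a class may start from a square integrable function, so
    the representatives chosen by [repr] rarely have to be seen. *)
Lemma toL2W (Q : L2 -> Prop) : (forall f, f \in L2p -> Q (toL2 f)) -> forall u, Q u.
Proof.
move=> h u; have := h _ (L2fun_pred (repr u)).
rewrite (toL2E (L2fun_pred (repr u))).
rewrite (_ : MkL2fun _ = repr u) ?reprK //; exact: val_inj.
Qed.

Lemma toL2_ae f : f \in L2p -> {ae P, forall x, (repr (toL2 f) : L2fun P) x = f x}.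
Proof. by move=> fL; rewrite toL2E; exact: repr_pi. Qed.

Lemma toL2_eqP f g : f \in L2p -> g \in L2p ->
  toL2 f = toL2 g <-> {ae P, forall x, f x = g x}.
Proof. by move=> fL gL; rewrite !toL2E pi_L2P. Qed.

Lemma toL2_lin c f g : f \in L2p -> g \in L2p -> c *: f + g \in L2p.
Proof. by move=> fL gL; apply: rpredD => //; exact: rpredZ. Qed.

Lemma toL2_linE c f g : f \in L2p -> g \in L2p ->
  toL2 (c *: f + g) = c *: toL2 f + toL2 g.
Proof.
move=> fL gL; rewrite !(toL2E fL, toL2E gL, toL2E (toL2_lin c fL gL)).
have -> : c *: (\pi_L2 (MkL2fun fL) : L2) = \pi_L2 (c *: MkL2fun fL).
  by rewrite -pi_L2scale.
by rewrite -pi_L2D; congr (\pi_L2 _); exact: val_inj.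
Qed.

Lemma L2pred0 : (fun=> 0) \in L2p. Proof. exact: rpred0. Qed.

Lemma toL20 : toL2 (fun=> 0) = 0.
Proof.
rewrite -[RHS](addNr (toL2 (fun=> 0))) -scaleN1r -toL2_linE ?L2pred0 //.
by congr toL2; apply/funext => x; rewrite !fctE scaler0 addr0.
Qed.

Lemma L2predB f g : f \in L2p -> g \in L2p -> (fun x => f x - g x) \in L2p.
Proof. exact: rpredB. Qed.
Lemma L2predZ c f : f \in L2p -> (fun x => c * f x) \in L2p.
Proof. exact: rpredZ. Qed.

Lemma toL2D f g : f \in L2p -> g \in L2p ->
  toL2 (fun x => f x + g x) = toL2 f + toL2 g.
Proof.
move=> fL gL; rewrite -[in RHS](scale1r (toL2 f)) -toL2_linE //; congr toL2.
by apply/funext => x; rewrite !fctE scale1r.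
Qed.

Lemma toL2Z c f : f \in L2p -> toL2 (fun x => c * f x) = c *: toL2 f.
Proof.
move=> fL; rewrite -[RHS]addr0 -toL20 -toL2_linE ?L2pred0 //; congr toL2.
by apply/funext => x; rewrite !fctE addr0.
Qed.

Lemma toL2B f g : f \in L2p -> g \in L2p ->
  toL2 (fun x => f x - g x) = toL2 f - toL2 g.
Proof.
move=> fL gL; rewrite addrC -scaleN1r -toL2_linE //; congr toL2.
by apply/funext => x; rewrite !fctE scaleN1r addrC.
Qed.

Local Notation E f := (\int[P]_x (f x)%R)%R.

Lemma cintegral_ae f g : cmeasurable measurable f -> cmeasurable measurable g ->
  {ae P, forall x, f x = g x} -> cintegral P f = cintegral P g.
Proof.
move=> /cmeasurable_funP[mfr mfi] /cmeasurable_funP[mgr mgi] fg.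
congr (Complex _ _); congr fine; apply: ae_eq_integral => //;
  try exact/measurable_EFinP; by apply: filterS fg => x -> _.
Qed.

Lemma measurable_cmul (f g : T -> R[i]) : cmeasurable measurable f ->
  cmeasurable measurable g -> cmeasurable measurable (fun x => f x * g x).
Proof.
move=> /cmeasurable_funP[mfr mfi] /cmeasurable_funP[mgr mgi].
apply/cmeasurable_funP; split => /=.
  rewrite [X in measurable_fun _ X](_ : _ = fun x => complex.Re (f x) * complex.Re (g x) -
    complex.Im (f x) * complex.Im (g x)); last by apply/funext => x; rewrite cReM.
  by apply: measurable_funB; exact: measurable_funM.
rewrite [X in measurable_fun _ X](_ : _ = fun x => complex.Re (f x) * complex.Im (g x) +
  complex.Im (f x) * complex.Re (g x)); last by apply/funext => x; rewrite cImM.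
by apply: measurable_funD; exact: measurable_funM.
Qed.

Lemma measurable_conjc (f : T -> R[i]) : cmeasurable measurable f ->
  cmeasurable measurable (fun x => conjc (f x)).
Proof.
move=> /cmeasurable_funP[mfr mfi]; apply/cmeasurable_funP; split => /=.
  by under eq_fun do rewrite Re_conjc.
by under eq_fun do rewrite Im_conjc; exact: measurableT_comp.
Qed.

Lemma L2pred_cmeas f : f \in L2p -> cmeasurable measurable f.
Proof. by rewrite inE => -[]. Qed.

Lemma L2dotE f g : f \in L2p -> g \in L2p ->
  dot (toL2 f) (toL2 g) = cintegral P (fun x => conjc (f x) * g x).
Proof.
move=> fL gL; apply: cintegral_ae; first 2 last.
- by apply: filterS2 (toL2_ae fL) (toL2_ae gL) => x -> ->.
- by apply: measurable_cmul; [apply: measurable_conjc|]; apply: L2pred_cmeas; exact: L2fun_pred.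
- by apply: measurable_cmul; [apply: measurable_conjc|]; exact: L2pred_cmeas.
Qed.

Lemma Re_L2dot f g : f \in L2p -> g \in L2p ->
  complex.Re (dot (toL2 f) (toL2 g)) =
  E (fun x => complex.Re (f x) * complex.Re (g x)) +
  E (fun x => complex.Im (f x) * complex.Im (g x)).
Proof.
move=> fL gL; rewrite L2dotE //=; have [fr fi] := (L2predP f).1 fL.
have [gr gi] := (L2predP g).1 gL.
rewrite -RintegralD //; try exact: rL2_integrableM.
apply: eq_Rintegral => x _ /=; rewrite cReM Re_conjc Im_conjc; ring.
Qed.

Lemma Im_L2dot f g : f \in L2p -> g \in L2p ->
  complex.Im (dot (toL2 f) (toL2 g)) =
  E (fun x => complex.Re (f x) * complex.Im (g x)) -
  E (fun x => complex.Im (f x) * complex.Re (g x)).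
Proof.
move=> fL gL; rewrite L2dotE //=; have [fr fi] := (L2predP f).1 fL.
have [gr gi] := (L2predP g).1 gL.
rewrite -RintegralB //; try exact: rL2_integrableM.
by apply: eq_Rintegral => x _ /=; rewrite cImM Re_conjc Im_conjc; ring.
Qed.

Lemma rL2_sqr0 f : rL2 f -> E (fun x => f x * f x) = 0 -> {ae P, forall x, f x = 0}.
Proof.
move=> lf Ef; have [mf _] := lf.
have : (\int[P]_x (f x * f x)%:E = 0)%E.
  rewrite -(@fineK _ (\int[P]_x _)%E); first by rewrite -[fine _]/(E (fun x => f x * f x)) Ef.
  by apply: integrable_fin_num => //; exact: rL2_integrableM.
move=> h.
have [H _] := ae_eq_integral_abs P measurableT
  ((measurable_EFinP _ _).2 (measurable_funM mf mf)).
have /H : (\int[P]_x `|(f x * f x)%:E| = 0)%E.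
  by rewrite -h; apply: eq_integral => x _; rewrite gee0_abs // lee_fin -expr2 sqr_ge0.
apply: filterS => x /(_ I) /eqP; rewrite eqe mulf_eq0 orbb.
by move/eqP.
Qed.

Lemma L2_inner_product : inner_product dot.
Proof.
split.
- move=> u c v w; elim/toL2W: u => f fL; elim/toL2W: v => g gL; elim/toL2W: w => h hL.
  have cL := toL2_lin c gL hL; rewrite -toL2_linE //.
  have [fr fi] := (L2predP f).1 fL; have [gr gi] := (L2predP g).1 gL.
  have [hr hi] := (L2predP h).1 hL.
  have I1 := rL2_integrableM.
  have E4 (a b : R) p q r s : rL2 p -> rL2 q -> rL2 r -> rL2 s ->
      E (fun x => p x * (a * q x + b * r x + s x)) =
      a * E (fun x => p x * q x) + b * E (fun x => p x * r x) + E (fun x => p x * s x).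
    move=> lp lq lr ls.
    rewrite -!RintegralZl //; try exact: I1.
    rewrite -RintegralD //; last 2 first.
    + by have := integrableZl measurableT a (I1 _ _ lp lq).
    + by have := integrableZl measurableT b (I1 _ _ lp lr).
    rewrite -RintegralD //; last 2 first.
    + by have := integrableD measurableT (integrableZl measurableT a (I1 _ _ lp lq))
        (integrableZl measurableT b (I1 _ _ lp lr)).
    + exact: I1.
    by apply: eq_Rintegral => x _; ring.
  have cRe x : complex.Re ((c *: g + h) x) = complex.Re c * complex.Re (g x) +
     (- complex.Im c) * complex.Im (g x) + complex.Re (h x).
    by rewrite !fctE /= cReD cReM mulNr.
  have cIm x : complex.Im ((c *: g + h) x) = complex.Re c * complex.Im (g x) +
     complex.Im c * complex.Re (g x) + complex.Im (h x).
    by rewrite !fctE /= cImD cImM.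
  move: (Re_L2dot fL cL) (Im_L2dot fL cL) (Re_L2dot fL gL) (Im_L2dot fL gL)
    (Re_L2dot fL hL) (Im_L2dot fL hL).
  move: (dot (toL2 f) _) (dot (toL2 f) _) (dot (toL2 f) _) => A B C Ar Ai Br Bi Cr Ci.
  apply: complex_ext.
    rewrite cReD cReM Ar Br Bi Cr.
    under eq_Rintegral do rewrite cRe.
    under [X in _ + X = _]eq_Rintegral do rewrite cIm.
    by rewrite !E4 //; ring.
  rewrite cImD cImM Ai Br Bi Ci.
  under eq_Rintegral do rewrite cIm.
  under [X in _ - X = _]eq_Rintegral do rewrite cRe.
  by rewrite !E4 //; ring.
- move=> u v; elim/toL2W: u => f fL; elim/toL2W: v => g gL.
  move: (Re_L2dot fL gL) (Im_L2dot fL gL) (Re_L2dot gL fL) (Im_L2dot gL fL).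
  move: (dot _ _) (dot _ _) => A B Ar Ai Br Bi.
  apply: complex_ext; first rewrite Re_conjc Ar Br.
    by congr (_ + _); apply: eq_Rintegral => x _; rewrite mulrC.
  rewrite Im_conjc Ai Bi.
  by rewrite opprB; congr (_ - _); apply: eq_Rintegral => x _; rewrite mulrC.
- move=> u; elim/toL2W: u => f fL; move: (Re_L2dot fL fL) (Im_L2dot fL fL).
  move: (dot _ _) => A Ar Ai; rewrite lecE Ar Ai /=.
  apply/andP; split.
    rewrite subr_eq0; apply/eqP; apply: eq_Rintegral => x _; exact: mulrC.
  by apply: addr_ge0; apply: Rintegral_ge0 => x _; rewrite -expr2 sqr_ge0.
- move=> u; elim/toL2W: u => f fL; move: (Re_L2dot fL fL).
  move: (dot _ _) => A Ar /(congr1 (@complex.Re R)); rewrite Ar /= => {A Ar}.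
  have [fr fi] := (L2predP f).1 fL.
  have p0 g : 0 <= E (fun x => g x * g x) by apply: Rintegral_ge0 => x _; rewrite -expr2 sqr_ge0.
  move/eqP; rewrite paddr_eq0 ?p0 // => /andP[/eqP /(rL2_sqr0 fr) r0 /eqP /(rL2_sqr0 fi) i0].
  rewrite -toL20; apply/toL2_eqP; rewrite ?L2pred0 //.
  by apply: filterS2 r0 i0 => x ? ?; exact: complex_ext.
Qed.

Lemma L2_hnorm_sqr f : f \in L2p -> N (toL2 f) ^+ 2 =
  E (fun x => complex.Re (f x) ^+ 2) + E (fun x => complex.Im (f x) ^+ 2).
Proof.
by move=> fL; rewrite (hnormE L2_inner_product) Re_L2dot //.
Qed.

End L2_basics.

(** * Dominated convergence and completeness of L^2 *)

Section L2_convergence.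
Context d (T : measurableType d) (R : realType) (P : probability T R).
Local Notation toL2 := (toL2 P).
Local Notation L2p := (L2pred P).
Local Notation dot := (L2dot P).
Local Notation N := (hnorm (L2dot P)).
Local Notation E f := (\int[P]_x (f x)%R)%R.
Let ip := L2_inner_product P.

Lemma rL2_sqr_EFin (f : T -> R) : rL2 P f ->
  (\int[P]_x (f x ^+ 2)%:E)%E = (E (fun x => f x ^+ 2))%:E.
Proof.
move=> lf; rewrite /Rintegral fineK //; apply: integrable_fin_num => //.
by have := rL2_integrableM lf lf; apply: eq_integrable => // x _ /=; rewrite expr2.
Qed.

Lemma rL2_dominated (f_ : nat -> T -> R) (f g : T -> R) :
  (forall n, rL2 P (f_ n)) -> rL2 P f -> rL2 P g ->
  (forall n x, `|f_ n x - f x| <= g x) ->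
  (forall x, f_ ^~ x @ \oo --> f x) ->
  (fun n => E (fun x => (f_ n x - f x) ^+ 2)) @ \oo --> (0 : R).
Proof.
move=> lf_ lf lg dom cv.
have lB n := rL2B (lf_ n) lf.
have [|||||_ _] := @dominated_convergence _ _ _ P setT measurableT
  (fun n x => ((f_ n x - f x) ^+ 2)%:E) (cst 0%E) (fun x => (g x ^+ 2)%:E).
- by move=> n; apply/measurable_EFinP/measurable_funX; case: (lB n).
- exact: measurable_cst.
- apply: aeW => x _; rewrite (_ : cst 0%E x = ((f x - f x) ^+ 2)%:E); last first.
    by rewrite subrr expr0n.
  apply: cvg_EFin; first by near=> n.
  rewrite (_ : fine \o _ = fun n => (f_ n x - f x) ^+ 2); last exact/funext.
  rewrite /=; under eq_fun do rewrite expr2; rewrite expr2.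
  by apply: cvgM; (apply: cvgB; [exact: cv|exact: cvg_cst]).
- by have := rL2_integrableM lg lg; apply: eq_integrable => // x _ /=; rewrite expr2.
- apply: aeW => x n _ /=; rewrite lee_fin ger0_norm ?sqr_ge0 //.
  by rewrite -[leLHS]real_normK ?num_real // lerXn2r ?nnegrE // (le_trans _ (dom n x)).
rewrite integral0 => h; apply: cvg_trans (fine_cvg h) => /=.
by apply: near_eq_cvg; near=> n => /=; rewrite (rL2_sqr_EFin (lB n)).
Unshelve. all: end_near. Qed.

Lemma L2_dominated (f_ : nat -> T -> R[i]) (f : T -> R[i]) (g : T -> R) :
  (forall n, f_ n \in L2p) -> f \in L2p -> rL2 P g ->
  (forall n x, `|complex.Re (f_ n x) - complex.Re (f x)| <= g x) ->
  (forall n x, `|complex.Im (f_ n x) - complex.Im (f x)| <= g x) ->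
  (forall x, (fun n => complex.Re (f_ n x)) @ \oo --> complex.Re (f x)) ->
  (forall x, (fun n => complex.Im (f_ n x)) @ \oo --> complex.Im (f x)) ->
  hcvg dot (fun n => toL2 (f_ n)) (toL2 f).
Proof.
move=> fL_ fL gL domr domi cvr cvi.
have [lfr lfi] := (L2predP P f).1 fL.
have Er := rL2_dominated (fun n => ((L2predP P _).1 (fL_ n)).1) lfr gL domr cvr.
have Ei := rL2_dominated (fun n => ((L2predP P _).1 (fL_ n)).2) lfi gL domi cvi.
have h : (fun n => N (toL2 (f_ n) - toL2 f) ^+ 2) @ \oo --> (0 : R).
  rewrite -[0]addr0; apply: cvg_trans (cvgD Er Ei); apply: near_eq_cvg; near=> n.
  rewrite -toL2B // L2_hnorm_sqr ?L2predB //.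
  by congr (_ + _); apply: eq_Rintegral => x _; rewrite !(cReD, cImD, cReN, cImN).
apply: cvg_to0 => [n|e e0]; first exact: hnorm_ge0.
have /cvgrPdist_lt /(_ _ (exprn_gt0 2 e0)) := h; apply: filterS => n.
rewrite sub0r normrN ger0_norm ?sqr_ge0 // => /ltW.
by rewrite ler_sqr ?nnegrE ?hnorm_ge0 // ltW.
Unshelve. all: end_near. Qed.

(* On a probability space the estimate 2 |x| <= t x^2 + 1 / t bounds the L^1 norm
   of the increments, so the series of increments converges absolutely a.e. *)
Lemma rL2_fast_cvg (f_ : nat -> T -> R) : (forall n, rL2 P (f_ n)) ->
  (forall n, E (fun x => (f_ n.+1 x - f_ n x) ^+ 2) <= (2 ^- n) ^+ 2) ->
  {ae P, forall x, cvgn (f_ ^~ x)}.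
Proof.
move=> lf fast.
pose g n x := `|f_ n.+1 x - f_ n x|.
have g0 n x : (0 <= (g n x)%:E)%E by rewrite lee_fin normr_ge0.
have lB n := rL2B (lf n.+1) (lf n).
have mg n : measurable_fun setT (fun x => (g n x)%:E).
  by apply/measurable_EFinP; apply: measurableT_comp => //; case: (lB n).
(* The increment has L^2 norm at most [2 ^- n], so the estimate is used with [t = 2 ^+ n]; the
   resulting bound [2 ^- n] is written as [2 / 2 ^ n.+1] to be summed by [epsilon_trick0]. *)
have ig n : (\int[P]_x (g n x)%:E <= (2 / (2 ^ n.+1)%:R)%:E)%E.
  have ib : P.-integrable setT (EFin \o (fun x => (f_ n.+1 x - f_ n x) ^+ 2)).
    by have := rL2_integrableM (lB n) (lB n); apply: eq_integrable => // x _ /=; rewrite expr2.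
  have i1 : P.-integrable setT (EFin \o (fun x => 2 ^+ n * (f_ n.+1 x - f_ n x) ^+ 2 + 2 ^- n)).
    have ic : P.-integrable setT (EFin \o cst (2 ^- n : R)).
      by apply: finite_measure_integrable_cst.
    by have := integrableD measurableT (integrableZl measurableT (2 ^+ n) ib) ic.
  apply: (@le_trans _ _ (\int[P]_x (2^-1 * (2 ^+ n * (f_ n.+1 x - f_ n x) ^+ 2 + 2 ^- n))%:E)%E).
    apply: ge0_le_integral => //.
    - apply/measurable_EFinP; apply: measurable_funM; first exact: measurable_cst.
      by have /integrableP[/measurable_EFinP] := i1.
    - move=> x _; rewrite lee_fin /g; set u := f_ _ _ - _.
      have p0 : 0 < (2 : R) ^+ n by rewrite exprn_gt0.
      have := sqr_ge0 (2 ^+ n * `|u| - 1); rewrite sqrrB1 exprMn real_normK ?num_real // => h.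
      rewrite ler_pdivlMl // -(ler_pM2l p0) mulrDr divff ?gt_eqF //.
      by move: h; rewrite expr2 -mulr_natl; set v := `|u|; nra.
  rewrite -[leLHS](@fineK _) ?lee_fin; last first.
    by have := integrable_fin_num measurableT (integrableZl measurableT 2^-1 i1).
  rewrite -[fine _]/(E (fun x => 2^-1 * (2 ^+ n * (f_ n.+1 x - f_ n x) ^+ 2 + 2 ^- n))).
  rewrite RintegralZl // RintegralD //; last 2 first.
  - by have := integrableZl measurableT (2 ^+ n) ib.
  - exact: finite_measure_integrable_cst.
  rewrite RintegralZl // Rintegral_cst //.
  have -> : fine (P setT) = 1 by rewrite -[RHS]/(fine 1%:E); congr fine; exact: probability_setT.
  have p0 : 0 < (2 : R) ^+ n by rewrite exprn_gt0.
  rewrite mulr1 natrX exprS invfM mulrA divff // mul1r ler_pdivrMl //.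
  rewrite mulr_natl (mulr2n (2 ^- n)) lerD2r -ler_pdivlMl // (le_trans (fast n)) // expr2 //.
have sg : (\int[P]_x (\sum_(n <oo) (g n x)%:E) < +oo)%E.
  rewrite integral_nneseries //.
  apply: (@le_lt_trans _ _ (2%:E)%E); last by rewrite ltry.
  apply: le_trans (epsilon_trick0 xpredT (ler0n R 2)).
  by apply: lee_nneseries => [n _ _|n _]; [exact: integral_ge0|exact: ig].
have : P.-integrable setT (fun x => \sum_(n <oo) (g n x)%:E)%E.
  apply/integrableP; split.
    exact: ge0_emeasurable_sum.
  by under eq_integral do rewrite gee0_abs ?nneseries_ge0 //.
move=> /(integrable_ae measurableT); apply: filterS => x /(_ I) fin.
have cg : cvgn (series (g ^~ x)).
  apply: nondecreasing_is_cvgn.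
    apply/nondecreasing_seqP => n; rewrite !seriesEnat /= big_nat_recr //= lerDl.
    exact: normr_ge0.
  exists (fine (\sum_(n <oo) (g n x)%:E)%E) => _ [n _ <-].
  rewrite -lee_fin fineK // seriesEnat /= -sumEFin.
  exact: nneseries_lim_ge.
have /(normed_cvg (V := R^o)) ct : cvgn [normed series (fun n => f_ n.+1 x - f_ n x : R^o)].
  exact: cg.
have -> : f_ ^~ x = (cst (f_ 0 x)) \+ series (telescope (f_ ^~ x)).
  by apply/funext => n; rewrite [LHS](eq_sum_telescope (f_ ^~ x)).
by apply: is_cvgD; [exact: is_cvg_cst|exact: ct].
Qed.

(** A limsup is measurable without any convergence, and it equals the limit at every point where the
    sequence converges to a real number. *)
Definition rlim (f_ : nat -> T -> R) x := fine (limn_esup (fun n => (f_ n x)%:E)).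

(** The summable bound on successive increments gives convergence almost everywhere; Fatou's lemma
    along [f_ (m + n)] then passes the bound [eps n] on later increments to the limit. *)
Lemma rL2_limit (f_ : nat -> T -> R) (eps : nat -> R) : (forall n, rL2 P (f_ n)) ->
  (forall n, E (fun x => (f_ n.+1 x - f_ n x) ^+ 2) <= (2 ^- n) ^+ 2) ->
  (forall n m, (n <= m)%N -> E (fun x => (f_ m x - f_ n x) ^+ 2) <= eps n) ->
  rL2 P (rlim f_) /\ forall n, E (fun x => (rlim f_ x - f_ n x) ^+ 2) <= eps n.
Proof.
move=> lf fast slow; have ae := rL2_fast_cvg lf fast.
have mF : measurable_fun setT (rlim f_).
  apply: measurableT_comp => //; apply: measurable_fun_limn_esup => n.
  by apply/measurable_EFinP; case: (lf n).
have key n : (\int[P]_x ((rlim f_ x - f_ n x) ^+ 2)%:E <= (eps n)%:E)%E.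
  pose h m x := ((f_ (m + n)%N x - f_ n x) ^+ 2)%:E.
  have lB m := rL2B (lf (m + n)%N) (lf n).
  have mh m : measurable_fun setT (h m).
    by apply/measurable_EFinP/measurable_funX; case: (lB m).
  have h0 m x : (0 <= h m x)%E by rewrite lee_fin sqr_ge0.
  have -> : (\int[P]_x ((rlim f_ x - f_ n x) ^+ 2)%:E = \int[P]_x (limn_einf (h ^~ x)))%E.
    apply: ge0_ae_eq_integral => //.
    - by apply/measurable_EFinP/measurable_funX/measurable_funB => //; case: (lf n).
    - have -> : (fun x => limn_einf (h ^~ x)) = (fun x => - limn_esup (fun m => - h m x))%E.
        by apply/funext => x; rewrite -limn_einfN; congr limn_einf; apply/funext => m; exact: esym (oppeK _).
      by apply: measurableT_comp => //; apply: measurable_fun_limn_esup => m; exact: measurableT_comp.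
    - by move=> x _; rewrite lee_fin sqr_ge0.
    - move=> x _; rewrite limn_einf_lim; apply: lime_ge; first exact: is_cvg_einfs.
      by near=> m; apply: le_ereal_inf_tmp => _ [k _ <-].
    apply: filterS ae => x cx _.
    have cl : (fun m => f_ m x) @ \oo --> rlim f_ x.
      rewrite /rlim.
      have ce : (fun m => (f_ m x)%:E) @ \oo --> (limn (f_ ^~ x))%:E by apply: cvg_EFin; [near=> m|exact: cx].
      by rewrite is_cvg_limn_esupE ?(cvg_lim _ ce) //; apply: cvgP ce.
    have cs : h ^~ x @ \oo --> ((rlim f_ x - f_ n x) ^+ 2)%:E.
      apply: cvg_EFin; first by near=> m.
      rewrite (_ : fine \o _ = fun m => (f_ (m + n)%N x - f_ n x) * (f_ (m + n)%N x - f_ n x)); last first.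
        by apply/funext => m; rewrite /= expr2.
      rewrite expr2; have cB : (fun m => f_ (m + n)%N x - f_ n x) @ \oo --> rlim f_ x - f_ n x.
        apply: cvgB; last exact: cvg_cst.
        by move: cl; rewrite -(cvg_shiftn n).
      exact: (cvgM cB cB).
    by rewrite is_cvg_limn_einfE ?(cvg_lim _ cs) //; apply: cvgP cs.
  apply: (le_trans (fatou P measurableT mh (fun m x _ => h0 m x))).
  rewrite limn_einf_lim; apply: lime_le; first exact: is_cvg_einfs.
  near=> m; apply: (@le_trans _ _ (\int[P]_x h m x)%E).
    by apply: ereal_inf_lbound; exists m => //=.
  by rewrite (rL2_sqr_EFin (lB m)) lee_fin slow // leq_addl.
have lBF n : rL2 P (fun x => rlim f_ x - f_ n x).
  split; first by apply: measurable_funB => //; case: (lf n).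
  by rewrite (le_lt_trans (key n)) // ltry.
split=> [|n]; last by rewrite -lee_fin -(rL2_sqr_EFin (lBF n)).
have := rL2D (lBF 0) (lf 0); congr rL2; apply/funext => x; exact: subrK.
Unshelve. all: end_near. Qed.

Definition climit (f_ : nat -> T -> R[i]) x : R[i] :=
  (rlim (fun n x => complex.Re (f_ n x)) x +i* rlim (fun n x => complex.Im (f_ n x)) x)%C.

Lemma L2_fast_limit (f_ : nat -> T -> R[i]) : (forall n, f_ n \in L2p) ->
  (forall n, N (toL2 (f_ n.+1) - toL2 (f_ n)) <= 2 ^- n) ->
  climit f_ \in L2p /\ hcvg dot (fun n => toL2 (f_ n)) (toL2 (climit f_)).
Proof.
move=> fL fast.
(* Telescoping the bounds [2 ^- k] for [n <= k < m] gives a geometric sum, equal to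
   [2 * (2 ^- n - 2 ^- m)]. *)
have dist n m : (n <= m)%N -> N (toL2 (f_ m) - toL2 (f_ n)) <= 2 * 2 ^- n.
  move=> nm; suff : N (toL2 (f_ m) - toL2 (f_ n)) <= 2 * (2 ^- n - 2 ^- m).
    by move=> /le_trans; apply; rewrite ler_pM2l // gerBl invr_ge0 exprn_ge0.
  rewrite -(subnK nm); elim: (m - n)%N => [|k IH].
    by rewrite add0n !subrr (hnorm0 ip) mulr0.
  rewrite addSn (le_trans (hnorm_dist ip (toL2 (f_ (k + n)%N)) _ _)) //.
  rewrite (le_trans (lerD (fast _) IH)) // exprS invfM.
  set u := 2 ^- (k + n); set v := 2 ^- n; lra.
have sq n m : N (toL2 (f_ m) - toL2 (f_ n)) ^+ 2 =
    E (fun x => (complex.Re (f_ m x) - complex.Re (f_ n x)) ^+ 2) +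
    E (fun x => (complex.Im (f_ m x) - complex.Im (f_ n x)) ^+ 2).
  rewrite -toL2B // L2_hnorm_sqr ?L2predB //.
  by congr (_ + _); apply: eq_Rintegral => x _; rewrite !(cReD, cImD, cReN, cImN).
have E0 (h : T -> R) : 0 <= E (fun x => h x ^+ 2).
  by apply: Rintegral_ge0 => x _; rewrite sqr_ge0.
have mono (a b : R) : 0 <= a -> a <= b -> a ^+ 2 <= b ^+ 2.
  by move=> a0 ab; rewrite lerXn2r ?nnegrE // (le_trans a0).
have [lr kr] : rL2 P (rlim (fun n x => complex.Re (f_ n x))) /\ forall n,
    E (fun x => (rlim (fun n x => complex.Re (f_ n x)) x - complex.Re (f_ n x)) ^+ 2) <= (2 * 2 ^- n) ^+ 2.
  apply: rL2_limit => [n|n|n m nm]; first exact: ((L2predP P _).1 (fL n)).1.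
    by rewrite (le_trans _ (mono _ _ (hnorm_ge0 _ _) (fast n))) // sq lerDl.
  by rewrite (le_trans _ (mono _ _ (hnorm_ge0 _ _) (dist _ _ nm))) // sq lerDl.
have [li ki] : rL2 P (rlim (fun n x => complex.Im (f_ n x))) /\ forall n,
    E (fun x => (rlim (fun n x => complex.Im (f_ n x)) x - complex.Im (f_ n x)) ^+ 2) <= (2 * 2 ^- n) ^+ 2.
  apply: rL2_limit => [n|n|n m nm]; first exact: ((L2predP P _).1 (fL n)).2.
    by rewrite (le_trans _ (mono _ _ (hnorm_ge0 _ _) (fast n))) // sq lerDr.
  by rewrite (le_trans _ (mono _ _ (hnorm_ge0 _ _) (dist _ _ nm))) // sq lerDr.
have cL : climit f_ \in L2p by apply/L2predP; split.
split=> //; apply: cvg_to0 => [n|e e0]; first exact: hnorm_ge0.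
have := near_infty_natSinv_expn_lt (PosNum (divr_gt0 e0 (ltr0n R 4 : 0 < 4 :> R))).
apply: filterS => n /= hn.
(* Real and imaginary parts contribute at most [(2 * 2 ^- n) ^+ 2] each, and [(4 * 2 ^- n) ^+ 2] is
   four times that quantity, which leaves room for both. *)
have h : N (toL2 (f_ n) - toL2 (climit f_)) ^+ 2 <= (4 * 2 ^- n) ^+ 2.
  rewrite (hnormBC ip) -toL2B // L2_hnorm_sqr ?L2predB //.
  have -> : (4 * 2 ^- n) ^+ 2 = (2 * 2 ^- n) ^+ 2 + (2 * 2 ^- n) ^+ 2 + 2 * (2 * 2 ^- n) ^+ 2 :> R.
    by rewrite !exprMn; ring.
  apply: (@le_trans _ _ ((2 * 2 ^- n) ^+ 2 + (2 * 2 ^- n) ^+ 2)).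
    by apply: lerD; [apply: le_trans (kr n)|apply: le_trans (ki n)];
      rewrite le_eqVlt; apply/orP; left; apply/eqP; apply: eq_Rintegral => x _;
      rewrite !(cReD, cImD, cReN, cImN).
  by rewrite lerDl mulr_ge0 ?sqr_ge0.
rewrite ler_sqr ?nnegrE ?hnorm_ge0 ?mulr_ge0 ?invr_ge0 ?exprn_ge0 // in h.
apply: (le_trans h); rewrite -ler_pdivlMl // mulrC ltW //.
by move: hn; rewrite div1r.
Qed.

Lemma cauchy_fast_subseq (V : lmodType R[i]) (dV : V -> V -> R[i]) (u : nat -> V) :
  (forall e : R, 0 < e -> exists N, forall m n,
    (N <= m)%N -> (N <= n)%N -> hnorm dV (u m - u n) < e) ->
  exists2 s : nat -> nat, (forall n, (n <= s n)%N) &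
    forall n, hnorm dV (u (s n.+1) - u (s n)) <= 2 ^- n.
Proof.
move=> uC; have /choice[M hM] n := uC (2 ^- n) ltac:(by rewrite invr_gt0 exprn_gt0).
pose s := fix s n := if n is k.+1 then maxn k.+1 (maxn (s k) (M k.+1)) else M 0%N.
have sM n : (M n <= s n)%N.
  by case: n => // n /=; rewrite !leq_max leqnn !orbT.
have sS n : (s n <= s n.+1)%N by rewrite /= !leq_max leqnn !orbT.
exists s => [[|n]|n] //; first by rewrite leq_max leqnn.
by rewrite ltW // hM // (leq_trans (sM n)).
Qed.

Lemma cauchy_subseq_cvg (V : lmodType R[i]) (dV : V -> V -> R[i]) (ipV : inner_product dV)
    (u : nat -> V) (s : nat -> nat) l :
  (forall e : R, 0 < e -> exists N, forall m n,
    (N <= m)%N -> (N <= n)%N -> hnorm dV (u m - u n) < e) ->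
  (forall n, (n <= s n)%N) -> hcvg dV (u \o s) l -> hcvg dV u l.
Proof.
move=> uC sn sl; apply: cvg_to0 => [n|e e0]; first exact: hnorm_ge0.
have e2 : 0 < e / 2 by rewrite divr_gt0.
have [M hM] := uC _ e2; have [K _ hK] := hcvg_near sl e2.
exists M => // n /= Mn.
rewrite (le_trans (hnorm_dist ipV (u (s (maxn M K))) _ _)) // (splitr e) lerD // ltW //.
  by apply: hM => //; rewrite (leq_trans _ (sn _)) // leq_maxl.
by apply: hK => /=; rewrite leq_maxr.
Qed.

Lemma L2_complete : hcomplete dot.
Proof.
move=> u uC; have [s sn sf] := cauchy_fast_subseq uC.
have /choice[f hf] n : exists f, f \in L2p /\ u n = toL2 f.
  by elim/toL2W: (u n) => g gL; exists g.
have [] := @L2_fast_limit (fun n => f (s n)).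
- by move=> n; case: (hf (s n)).
- by move=> n; rewrite -!(hf _).2; exact: sf.
move=> cL cv; exists (toL2 (climit (fun n => f (s n)))).
apply: (cauchy_subseq_cvg ip uC sn).
by rewrite (_ : _ \o _ = fun n => toL2 (f (s n))) //; apply/funext => n; rewrite /= (hf _).2.
Qed.

Lemma L2_hilbert : hilbert dot.
Proof. by split; [exact: L2_inner_product|exact: L2_complete]. Qed.

End L2_convergence.

Lemma smallest_sub_measurable d (T : measurableType d) (G : set (set T)) :
  G `<=` measurable -> <<s G>> `<=` @measurable _ T.
Proof. by move=> GM; apply: smallest_sub => //; exact: sigma_algebra_measurable. Qed.

Lemma cmeasurable_sub (T : Type) (R : realType) (S S' : set (set T)) (f : T -> R[i]) :
  S `<=` S' -> cmeasurable S f -> cmeasurable S' f.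
Proof. by move=> SS' [f1 f2]; split=> B mB; apply: SS'; [exact: f1|exact: f2]. Qed.

Definition cindic (T : Type) (R : realType) (V : set T) (x : T) : R[i] := (\1_V x)%:C%C.

(** * Factorisation of measurable functions modulo null sets *)

Section doob_dynkin.
Context d (T : measurableType d) (R : realType) (P : probability T R).
Local Notation toL2 := (toL2 P).
Local Notation L2p := (L2pred P).

(** The sets that agree almost surely with a preimage under [phi] form a sigma-algebra; it contains
    [G], and it contains the subsets of null sets because these agree with the empty preimage. *)
Lemma complete_gen_pullback (G : set (set T)) d' (S : measurableType d') (phi : T -> S) :
  G `<=` measurable ->
  (forall B, G B -> exists2 A, measurable A & B = phi @^-1` A) ->
  forall B, complete_gen P G B ->
    exists2 A : set S, measurable A & {ae P, forall x, B x <-> A (phi x)}.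
Proof.
move=> GM GS; have GM' := smallest_sub_measurable GM.
apply: smallest_sub.
  split.
  - by exists set0 => //; apply: aeW.
  - move=> B [A mA BA]; exists (~` A); first exact: measurableC.
    by apply: filterS BA => x BA /=; split=> [[_ nB] /BA|nA] //; split=> // /BA.
  - move=> F FA; have /choice[A hA] n : exists A, measurable A /\ {ae P, forall x, F n x <-> A (phi x)}.
      by have [A mA h] := FA n; exists A.
    exists (\bigcup_n A n); first by apply: bigcup_measurable => n _; case: (hA n).
    have : {ae P, forall x, forall n, F n x <-> A n (phi x)}.
      by apply: ae_foralln => n; case: (hA n).
    by apply: filterS => x h; split=> -[n _ /h]; exists n.
move=> B [/GS[A mA ->]|[A GA [A0 BA]]]; first by exists A => //; apply: aeW.
exists set0 => //; exists A; split=> //; first exact: GM'.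
by move=> x /= nB; apply: BA; apply: contrapT => Bx; apply: nB; split.
Qed.

(** A real number is the infimum of the rationals above it, so [F e] is the infimum of the [q] with
    [e] in [A q]; membership in the [A q] is correct simultaneously for all rationals outside one
    null set. *)
Lemma doob_dynkin_real d' (S : measurableType d') (phi : T -> S) (h : T -> R) :
  (forall q : rat, exists2 A : set S, measurable A &
    {ae P, forall x, (h x < ratr q) <-> A (phi x)}) ->
  exists2 F : S -> R, measurable_fun setT F & {ae P, forall x, h x = F (phi x)}.
Proof.
move=> hA; have /choice[A mA] q : exists A : set S, measurable A /\
    {ae P, forall x, (h x < ratr q) <-> A (phi x)} by have [A ? ?] := hA q; exists A.
pose u n (e : S) : \bar R := if @unpickle rat n is Some q then
  (if e \in A q then (ratr q)%:E else +oo%E) else +oo%E.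
exists (fun e => fine (einfs (u ^~ e) 0)).
  apply: measurableT_comp => //; apply: measurable_fun_einfs => n.
  rewrite /u; case: unpickle => [q|]; last exact: measurable_cst.
  apply: measurable_fun_ifT => //; apply: (measurable_fun_bool true).
  rewrite setTI (_ : _ @^-1` _ = A q); first by case: (mA q).
  by apply/seteqP; split=> e /=; [exact: set_mem|exact: mem_set].
have : {ae P, forall x, forall n, if @unpickle rat n is Some q then
    (h x < ratr q) <-> A q (phi x) else True}.
  apply: ae_foralln => n; case: unpickle => [q|]; last by apply: aeW.
  by case: (mA q).
apply: filterS => x hx.
suff -> : einfs (u ^~ (phi x)) 0 = (h x)%:E by [].
apply/eqP; rewrite eq_le; apply/andP; split.
  apply/lee_addgt0Pr => e e0.
  have /rat_in_itvoo[q] : h x < h x + e by rewrite ltrDl.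
  rewrite in_itv /= => /andP[hq qe].
  apply: (@le_trans _ _ (ratr q)%:E); last by rewrite -EFinD lee_fin ltW.
  apply: ereal_inf_lbound; exists (pickle q) => //=.
  by rewrite /u pickleK ifT //; apply/mem_set; have := hx (pickle q); rewrite pickleK => <-.
apply: le_ereal_inf_tmp => _ [n _ <-]; rewrite /u.
have := hx n; case: unpickle => [q hq|_]; last by rewrite leey.
by case: ifPn => [/set_mem /hq /ltW|_]; rewrite ?lee_fin ?leey.
Qed.

Lemma L2meas_doob (G : set (set T)) d' (S : measurableType d') (phi : T -> S) u :
  G `<=` measurable -> measurable_fun setT phi ->
  (forall B, G B -> exists2 A, measurable A & B = phi @^-1` A) ->
  u \in L2meas P G -> exists F : S -> R[i],
    [/\ cmeasurable measurable F, F \o phi \in L2p & u = toL2 (F \o phi)].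
Proof.
move=> GM mphi GS; rewrite inE /= => -[f -> [fr fi]].
have pull (h : T -> R) : sys_measurable (complete_gen P G) (@measurable _ R) h ->
    exists2 F : S -> R, measurable_fun setT F & {ae P, forall x, h x = F (phi x)}.
  move=> mh; apply: doob_dynkin_real => q.
  have := complete_gen_pullback GM GS (mh `]-oo, ratr q[%classic (measurable_itv _)).
  by move=> [A mA hA]; exists A => //; apply: filterS hA => x <-; rewrite /= in_itv.
have [Fr mFr fFr] := pull _ fr; have [Fi mFi fFi] := pull _ fi.
pose F e := (Fr e +i* Fi e)%C.
have fF : {ae P, forall x, f x = F (phi x)}.
  by apply: filterS2 fFr fFi => x h1 h2; exact: complex_ext.
have [lr li] := (L2predP P f).1 (L2fun_pred f).
have ae2 (a b : T -> R) : {ae P, forall x, a x = b x} -> measurable_fun setT b ->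
    rL2 P a -> rL2 P b.
  move=> ab mb [ma la]; split=> //; apply: le_lt_trans la.
  rewrite le_eqVlt; apply/orP; left; apply/eqP; apply: ae_eq_integral => //.
  - by apply/measurable_EFinP; exact: measurable_funX.
  - by apply/measurable_EFinP; exact: measurable_funX.
  - by apply: filterS ab => x -> _.
have FL : F \o phi \in L2p.
  apply/L2predP; split; [apply: ae2 fFr _ lr|apply: ae2 fFi _ li].
    exact: (measurableT_comp mFr).
  exact: (measurableT_comp mFi).
exists F; split=> //; first by apply/cmeasurable_funP.
rewrite toL2E; apply/pi_L2P; exact: fF.
Qed.

(** Factorisation through the identity, seen as a map into the space with sigma-algebra [<<s G>>]:
    it removes the completion, so that representatives are measurable without recourse to null
    sets. *)
Lemma L2meas_rep (G : set (set T)) u : G `<=` measurable -> u \in L2meas P G ->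
  exists f, [/\ cmeasurable <<s G>> f, f \in L2p & u = toL2 f].
Proof.
move=> GM uG; have GM' := smallest_sub_measurable GM.
have [||F [mF FL uF]] := @L2meas_doob G _ (g_sigma_algebraType G) id u GM _ _ uG.
- by move=> _ B mB; rewrite setTI; exact: GM'.
- by move=> B GB; exists B => //; exact: sub_gen_smallest.
by exists F.
Qed.

Lemma L2meas_toL2 (G : set (set T)) f : cmeasurable <<s G>> f -> f \in L2p ->
  toL2 f \in L2meas P G.
Proof.
move=> mf fL; rewrite inE /=; exists (MkL2fun fL); first by rewrite toL2E.
apply: cmeasurable_sub mf; apply: smallest_sub; first exact: smallest_sigma_algebra.
by move=> B GB; apply: sub_gen_smallest; left.
Qed.

Lemma measurable_rlim (f_ : nat -> T -> R) : (forall n, measurable_fun setT (f_ n)) ->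
  measurable_fun setT (rlim f_).
Proof.
move=> mf; apply: measurableT_comp => //; apply: measurable_fun_limn_esup => n.
exact/measurable_EFinP.
Qed.

End doob_dynkin.

(** * L^2 of a sub-sigma-algebra as a Hilbert space *)

Section L2meas_closed.
Context d (T : measurableType d) (R : realType) (P : probability T R).
Local Notation toL2 := (toL2 P).
Local Notation L2p := (L2pred P).
Local Notation dot := (L2dot P).
Local Notation N := (hnorm (L2dot P)).
Let ip := L2_inner_product P.

(** Representatives measurable for [<<s G>>] are chosen along an approximating sequence. [climit] is
    built from limsups of these, so it stays measurable for the same sigma-algebra; completeness
    alone would give no control on the representative. *)
Lemma L2meas_closed_subspace (G : set (set T)) : G `<=` measurable ->
  closed_subspace dot [set u | u \in L2meas P G].
Proof.
move=> GM; split.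
- exact: rpred0.
- by move=> c u v uG vG; apply: rpredD => //; exact: rpredZ.
move=> u hu; rewrite /mkset.
(* The exponent [n.+1] makes consecutive approximants differ by at most [2 ^- n.+1 + 2 ^- n.+2],
   which is below [2 ^- n]. *)
have /choice[f hf] n : exists f, [/\ cmeasurable <<s G>> f, f \in L2p & N (u - toL2 f) < 2 ^- n.+1].
  have [v vG uv] := hu (2 ^- n.+1) ltac:(by rewrite invr_gt0 exprn_gt0).
  by have [f [mf fL vf]] := L2meas_rep GM vG; exists f; rewrite -vf.
have [n||cL cv] := @L2_fast_limit _ _ _ P f; first by case: (hf n).
  move=> n; rewrite (le_trans (hnorm_dist ip u _ _)) // (hnormBC ip).
  have [_ _ /ltW h1] := hf n; have [_ _ /ltW h2] := hf n.+1.
  apply: (le_trans (lerD h2 h1)).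
  have {h1 h2} : 0 < (2 ^- n : R) by rewrite invr_gt0 exprn_gt0.
  by rewrite !exprS !invfM; move: (_ ^-1 : R) => v v0; lra.
have cu : hcvg dot (fun n => toL2 (f n)) u.
  apply: (hcvg_seq ip) => n; have [_ _ h] := hf n; apply: (lt_le_trans h).
  rewrite lef_pV2 ?posrE ?exprn_gt0 // -natrX ler_nat.
  by rewrite ltnW // ltn_expl.
rewrite (hcvg_unique ip cu cv); apply: L2meas_toL2 => //.
split; apply/(@sys_measurable_funP _ _ (g_sigma_algebraType G));
  apply: (@measurable_rlim _ (g_sigma_algebraType G)) => n.
  by have [[+ _] _ _] := hf n => /(@sys_measurable_funP _ _ (g_sigma_algebraType G)).
by have [[_ +] _ _] := hf n => /(@sys_measurable_funP _ _ (g_sigma_algebraType G)).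
Qed.

Definition L2sub_dot G (u v : L2sub P G) : R[i] := dot (val u) (val v).

Lemma hnorm_L2sub G (u : L2sub P G) : hnorm (@L2sub_dot G) u = N (val u).
Proof. by []. Qed.

Lemma L2sub_inner_product G : inner_product (@L2sub_dot G).
Proof.
split.
- by move=> u c v w; rewrite /L2sub_dot linearP (ip_linear ip).
- by move=> u v; exact: (ip_conj ip).
- by move=> u; exact: (ip_ge0 ip).
- by move=> u u0; apply: val_inj; rewrite (ip_eq0 ip u0) raddf0.
Qed.

Lemma L2sub_hilbert G : G `<=` measurable -> hilbert (@L2sub_dot G).
Proof.
move=> GM; split; first exact: L2sub_inner_product.
move=> u uC; have [|l ul] := L2_complete (P := P) (u := fun n => val (u n)).
  move=> e /uC[M hM]; exists M => m n Mm Mn; have := hM m n Mm Mn.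
  by rewrite hnorm_L2sub raddfB.
have lG : l \in L2meas P G.
  apply: (cs_cvg ip (L2meas_closed_subspace GM) _ ul) => n.
  exact: (valP (u n)).
by exists (Sub l lG).
Qed.

End L2meas_closed.

(** * Density of the indicators of a pi-system *)

Section L2_density.
Import HBNNSimple.
Context d (T : measurableType d) (R : realType) (P : probability T R).
Local Notation toL2 := (toL2 P).
Local Notation L2p := (L2pred P).
Local Notation dot := (L2dot P).
Local Notation N := (hnorm (L2dot P)).
Let ip := L2_inner_product P.

Lemma rL2_cst (c : R) : rL2 P (fun=> c).
Proof. by apply: (@bounded_rL2 _ _ _ _ _ `|c|) => //; exact: measurable_cst. Qed.

Lemma real_L2pred (f : T -> R) : rL2 P f -> (fun x => (f x)%:C%C) \in L2p.
Proof.
by move=> lf; apply/L2predP; split=> //=; exact: rL2_cst.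
Qed.

Lemma bounded_L2pred (f : T -> R[i]) (M : R) : cmeasurable measurable f ->
  (forall x, `|complex.Re (f x)| <= M) -> (forall x, `|complex.Im (f x)| <= M) ->
  f \in L2p.
Proof.
by move=> /cmeasurable_funP[mr mi] br bi; apply/L2predP; split; exact: bounded_rL2.
Qed.

Lemma indic_rL2 (V : set T) : measurable V -> rL2 P \1_V.
Proof.
move=> mV; apply: (@bounded_rL2 _ _ _ _ _ 1) => // x.
by rewrite indicE; case: (_ \in _); rewrite ?normr1 ?normr0.
Qed.

Lemma cindic_L2pred (V : set T) : measurable V -> cindic R V \in L2p.
Proof. by move=> mV; apply: real_L2pred; exact: indic_rL2. Qed.

(** A functional monotone class argument: Dynkin induction yields the indicators over [<<s Pi>>],
    linearity the simple functions, dominated convergence the nonnegative functions, and positive,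
    negative, real and imaginary parts the rest. *)
Lemma L2_pi_dense (Pi : set (set T)) (K : set (L2 P)) :
  closed_subspace dot K -> setI_closed Pi -> Pi `<=` measurable ->
  K (toL2 (fun=> 1)) -> (forall V, Pi V -> K (toL2 (cindic R V))) ->
  forall f, f \in L2p -> cmeasurable <<s Pi>> f -> K (toL2 f).
Proof.
move=> cK PiI PiM K1 KPi.
have PiM' := smallest_sub_measurable PiM.
have L1 : (fun=> 1) \in L2p.
  have -> : (fun=> 1) = cindic R (@setT T) by apply/funext => x; rewrite /cindic indicT.
  exact: cindic_L2pred.
have KV V : <<s Pi>> V -> K (toL2 (cindic R V)).
  move: V; apply: (@dynkin_induction _ (g_sigma_algebraType Pi)) => //.
  - by rewrite (_ : cindic R _ = fun=> 1) //; apply/funext => x; rewrite /cindic indicT.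
  - move=> V mV KV; have -> : cindic R (~` V) = fun x => 1 - cindic R V x.
      apply/funext => x; rewrite /cindic !indicE in_setC.
      by case: (_ \in _); apply: complex_ext; rewrite !(cReD, cImD, cReN, cImN) /= ?subrr ?subr0.
    by rewrite toL2B ?cindic_L2pred //; [exact: (cs_B cK)|exact: PiM'].
  (* Finite partial unions are handled by linearity since the pieces are disjoint; their indicators
     converge pointwise to that of the whole union, and the differences are dominated by 1. *)
  - move=> F mF tF KF; pose G n := \big[setU/set0]_(i < n) F i.
    have mG n : @measurable _ T (G n) by apply: bigsetU_measurable => i _; exact: (PiM' _ (mF i)).
    have KG n : K (toL2 (cindic R (G n))).
      elim: n => [|n IH].
        rewrite /G big_ord0 (_ : cindic R _ = fun=> 0) ?toL20; first exact: (cs_0 cK).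
        by apply/funext => x; rewrite /cindic indic0.
      have -> : cindic R (G n.+1) = fun x => cindic R (G n) x + cindic R (F n) x.
        apply/funext => x; rewrite /cindic -rmorphD /=; congr (_%:C)%C.
        rewrite /G big_ord_recr /= -/(G n) !indicE in_setU.
        case: (boolP (x \in F n)) => xF; last by rewrite orbF addr0.
        suff -> : (x \in G n) = false by rewrite add0r.
        apply/negP => /set_mem; rewrite /G -bigcup_mkord => -[i /= ni xi].
        by have := tF i n I I ltac:(by exists x; split=> //; exact: set_mem) => ein; rewrite ein ltnn in ni.
      rewrite toL2D ?cindic_L2pred //; last exact: (PiM' _ (mF n)).
      apply: (cs_D cK) => //; exact: KF.
    have mU : @measurable _ T (\bigcup_k F k) by apply: bigcup_measurable => k _; exact: (PiM' _ (mF k)).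
    have le1 (A : set T) (B : set T) x : `|(\1_A x : R) - \1_B x| <= 1.
      by rewrite !indicE; do 2 case: (_ \in _);
         rewrite /= ?subrr ?subr0 ?sub0r ?normrN ?normr0 ?normr1.
    apply: (cs_cvg ip cK KG); apply: (@L2_dominated _ _ _ _ _ _ (cst 1)).
    + by move=> n; exact: cindic_L2pred.
    + exact: cindic_L2pred.
    + exact: rL2_cst.
    + by move=> n x; exact: le1.
    + by move=> n x; rewrite /= subrr normr0.
    + move=> x /=; have [[k _ xk]|xN] := pselect ((\bigcup_k F k) x).
        apply: cvg_near_cst.
        exists k.+1 => // n /= kn; rewrite !indicE !mem_set //; first by exists k.
        by rewrite /G -bigcup_mkord; exists k.
      apply: cvg_near_cst.
      exists 0 => // n _ /=; rewrite !indicE !memNset //.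
      by rewrite /G -bigcup_mkord => -[i _ xi]; apply: xN; exists i.
    + by move=> x /=; exact: cvg_cst.
have Ksum (s : seq R) (V : R -> set T) : (forall y, <<s Pi>> (V y)) ->
    rL2 P (fun x => \sum_(y <- s) y * \1_(V y) x) /\
    K (toL2 (fun x => (\sum_(y <- s) y * \1_(V y) x)%:C%C)).
  move=> mV; elim: s => [|y s [lI KI]].
    under eq_fun do rewrite big_nil; split; first exact: rL2_cst.
    under eq_fun do rewrite big_nil; rewrite (_ : (fun=> _) = fun=> 0) // toL20.
    exact: (cs_0 cK).
  have lZ := rL2Z y (indic_rL2 (PiM' _ (mV y))).
  under eq_fun do rewrite big_cons; split; first exact: rL2D.
  under eq_fun do rewrite big_cons rmorphD rmorphM /=.
  have LZ := L2predZ (y%:C%C) (cindic_L2pred (PiM' _ (mV y))).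
  rewrite (toL2D LZ) ?real_L2pred // (toL2Z _ (cindic_L2pred (PiM' _ (mV y)))).
  by apply: (cs_lin cK) => //; exact: KV.
have Knn (f : T -> R) : measurable_fun (setT : set (g_sigma_algebraType Pi)) f ->
    rL2 P f -> (forall x, 0 <= f x) -> K (toL2 (fun x => (f x)%:C%C)).
  move=> mf lf f0.
  have mEf : measurable_fun (setT : set (g_sigma_algebraType Pi)) (EFin \o f).
    exact/measurable_EFinP.
  pose g := nnsfun_approx measurableT mEf.
  pose h n (x : T) : R := g n x.
  have hE n : h n = fun x => \sum_(y <- finmap.enum_fset (fset_set (range (g n)))) y * \1_(g n @^-1` [set y]) x.
    by apply/funext => x; rewrite /h {1}(fimfunE (g n) x) fsbig_finite.
  have lh n : rL2 P (h n) /\ K (toL2 (fun x => (h n x)%:C%C)).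
    have := Ksum (finmap.enum_fset (fset_set (range (g n)))) (fun y => g n @^-1` [set y]).
    rewrite -hE => /(_ _)[y|lhn Khn]; first by have := @measurable_sfunP _ _ _ _ (g n) [set y] (measurable_set1 y).
    by split=> //; rewrite hE.
  have cvh x : (fun n => h n x) @ \oo --> f x.
    have := @cvg_nnsfun_approx _ (g_sigma_algebraType Pi) R setT measurableT _ mEf _ x I.
    move=> /(_ (fun x _ => f0 x)) => /fine_cvgP[_]; exact.
  have hf n x : h n x <= f x.
    have -> : f x = limn (fun n => h n x) by rewrite (cvg_lim _ (cvh x)).
    apply: (@nondecreasing_cvgn_le R (fun n => h n x)); last exact: (cvgP _ (cvh x)).
    by move=> m k mk; have /lefP := nd_nnsfun_approx measurableT mEf mk; apply.
  have dom n x : `|h n x - f x| <= f x.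
    rewrite ler0_norm ?subr_le0 ?hf // opprB gerBl.
    exact: fun_ge0.
  apply: (cs_cvg ip cK (fun n => (lh n).2)).
  apply: (@L2_dominated _ _ _ _ _ _ f) => //=.
  - by move=> n; apply: real_L2pred; case: (lh n).
  - exact: real_L2pred.
  - by move=> n x; rewrite subrr normr0.
  - by move=> x; exact: cvg_cst.
have Kr (f : T -> R) : measurable_fun (setT : set (g_sigma_algebraType Pi)) f ->
    rL2 P f -> K (toL2 (fun x => (f x)%:C%C)).
  move=> mf lf; have [mf' _] := lf.
  have mp : measurable_fun (setT : set (g_sigma_algebraType Pi)) (fun x => Num.max (f x) 0).
    by apply: measurable_maxr => //; exact: measurable_cst.
  have mn : measurable_fun (setT : set (g_sigma_algebraType Pi)) (fun x => Num.max (- f x) 0).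
    by apply: measurable_maxr; [exact: measurableT_comp|exact: measurable_cst].
  have lp : rL2 P (fun x => Num.max (f x) 0).
    apply: rL2_le lf _; first by apply: measurable_maxr => //; exact: measurable_cst.
    by move=> x; rewrite ger0_norm ?le_max ?lexx ?orbT // ge_max ler_norm normr_ge0.
  have ln : rL2 P (fun x => Num.max (- f x) 0).
    apply: rL2_le lf _; first by apply: measurable_maxr; [exact: measurableT_comp|exact: measurable_cst].
    by move=> x; rewrite -(normrN (f x)) ger0_norm ?le_max ?lexx ?orbT // ge_max ler_norm normr_ge0.
  have -> : (fun x => (f x)%:C%C) =
     fun x => (Num.max (f x) 0)%:C%C - (Num.max (- f x) 0)%:C%C.
    apply/funext => x; rewrite -rmorphB /=; congr (_%:C)%C.
    have /orP[f0|f0] := le_total 0 (f x).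
      by rewrite max_l // max_r ?oppr_le0 // subr0.
    by rewrite max_r // max_l ?oppr_ge0 // sub0r opprK.
  rewrite toL2B ?real_L2pred //; apply: (cs_B cK); apply: Knn => // x;
    by rewrite le_max lexx orbT.
move=> f fL [/(@sys_measurable_funP _ _ (g_sigma_algebraType Pi)) mr
  /(@sys_measurable_funP _ _ (g_sigma_algebraType Pi)) mi].
have [lr li] := (L2predP P f).1 fL.
have -> : f = fun x => (complex.Re (f x))%:C%C + 'i%C * (complex.Im (f x))%:C%C.
  by apply/funext => x; rewrite -complexE.
rewrite toL2D ?real_L2pred //; last by apply: L2predZ; exact: real_L2pred.
rewrite toL2Z ?real_L2pred //; apply: (cs_D cK); first exact: Kr.
by apply: (cs_Z _ cK); exact: Kr.
Qed.

End L2_density.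

(** * Measurable maps into a separable Hilbert space *)

Section hilbert_measurability.
Context (R : realType) (V : lmodType R[i]) (dot : V -> V -> R[i]).
Hypothesis ip : inner_product dot.
Local Notation rdot u v := (complex.Re (dot u v)).
Local Notation N u := (hnorm dot u).
Context (h : nat -> V).
Hypothesis h_dense : forall v (e : R), 0 < e -> exists n, N (v - h n) < e.

Lemma dense_seq v : exists2 s : nat -> nat, hcvg dot (h \o s) v & forall n, N (v - h (s n)) < n.+1%:R^-1.
Proof.
have /choice[s hs] n := h_dense v (ltac:(by rewrite invr_gt0) : 0 < n.+1%:R^-1 :> R).
by exists s => //; apply: hcvg_seq.
Qed.

(** Duality: letting [h m] tend to [w] turns the conditions into [N w ^+ 2 <= q * N w]. A closed
    ball thus becomes a countable intersection of half-spaces. *)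
Lemma hnorm_le_dense w (q : R) : 0 <= q ->
  N w <= q <-> forall m, rdot (h m) w <= q * N (h m).
Proof.
move=> q0; split=> [wq m|hm].
  by rewrite (le_trans (rdot_le ip _ _)) // mulrC ler_wpM2r ?hnorm_ge0.
have [->|w0] := eqVneq w 0; first by rewrite (hnorm0 ip).
have wp : 0 < N w.
  rewrite lt_neqAle hnorm_ge0 andbT eq_sym; apply/eqP => /(hnorm0_eq0 ip) /eqP.
  by rewrite (negbTE w0).
have [s sw _] := dense_seq w.
suff : N w * N w <= q * N w by rewrite ler_pM2r.
rewrite -expr2 (hnormE ip).
have c1 : (fun n => rdot (h (s n)) w) @ \oo --> rdot w w.
  rewrite (_ : (fun n => _) = fun n => rdot w ((h \o s) n)); first exact: (hcvg_rdot ip).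
  by apply/funext => n; rewrite (rdotC ip).
have c2 : (fun n => q * N ((h \o s) n)) @ \oo --> q * N w.
  by apply: cvgMr; exact: (hcvg_norm ip).
rewrite -(cvg_lim _ c1) // -(cvg_lim _ c2) //; apply: ler_lim; [exact: cvgP c1|exact: cvgP c2|].
by near=> n; exact: hm.
Unshelve. all: end_near. Qed.

Lemma hopen_ball v (e : R) : hopen dot [set w | N (w - v) < e].
Proof.
move=> u /= uv; exists (e - N (u - v)); first by rewrite subr_gt0.
move=> w wu; rewrite (le_lt_trans (hnorm_dist ip u _ _)) //.
by rewrite -ltrBrDr.
Qed.

Lemma hopen_lt (phi : V -> R) (c : R) :
  (forall (u : V) (e : R), 0 < e -> exists2 del : R, 0 < del &
     forall w, N (w - u) < del -> `|phi w - phi u| < e) ->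
  hopen dot [set w | phi w < c].
Proof.
move=> hphi u /= uc; have [del d0 hd] := hphi u (c - phi u) ltac:(by rewrite subr_gt0).
exists del => // w /hd /ltr_normlW; rewrite ltrBrDr; first by rewrite subrK.
Qed.

Section fixed_domain.
Context d (U : measurableType d).
Local Notation hmeas f := (sys_measurable (@measurable _ U) (hborel dot) f).

(** Pettis' criterion: an open set is a countable union of closed balls with centre [h n] and
    rational radius, and each of these is cut out by countably many real functionals. *)
Lemma hmeas_weak (f : U -> V) :
  (forall n, measurable_fun setT (fun x => rdot (h n) (f x))) -> hmeas f.
Proof.
move=> mf B.
suff : hborel dot `<=` [set B | measurable (f @^-1` B)] by apply.
apply: smallest_sub.
  split=> /= [|A mA|F mF].
  - by rewrite preimage_set0.
  - by rewrite setTD preimage_setC; exact: measurableC.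
  - by rewrite preimage_bigcup; exact: bigcup_measurable.
move=> W oW /=.
pose C n q := [set v | N (v - h n) <= q].
pose J := [set nq : nat * rat | 0 <= (ratr nq.2 : R) /\ C nq.1 (ratr nq.2) `<=` W].
have -> : W = \bigcup_(nq in J) C nq.1 (ratr nq.2).
  apply/seteqP; split=> [u Wu|u [nq [_ CW] /CW //]].
  have [e e0 eW] := oW u Wu.
  have [n un] := h_dense u (ltac:(by rewrite divr_gt0) : 0 < e / 2).
  have [q] := rat_in_itvoo un; rewrite in_itv /= => /andP[q1 q2].
  exists (n, q) => /=; last exact: ltW.
  split; first by rewrite (le_trans (hnorm_ge0 dot (u - h n))) // ltW.
  move=> v /= vn; apply: eW; rewrite (le_lt_trans (hnorm_dist ip (h n) _ _)) // (splitr e).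
  by rewrite ltrD // ?(hnormBC ip (h n)) // (le_lt_trans vn).
rewrite preimage_bigcup bigcup_mkcond.
apply: countable_bigcupT_measurable => [|[n q]]; first exact: countableP.
case: ifPn => // /set_mem [/= q0 _].
have -> : f @^-1` C n (ratr q) =
    \bigcap_m [set x | rdot (h m) (f x) <= ratr q * N (h m) + rdot (h m) (h n)].
  apply/seteqP; split=> x /=.
    move=> /(hnorm_le_dense _ q0) hx m _ /=; have := hx m.
    by rewrite (dotBr ip) cReD cReN lerBlDr.
  move=> hx; apply/(hnorm_le_dense _ q0) => m; have := hx m I.
  by rewrite (dotBr ip) cReD cReN lerBlDr.
apply: bigcap_measurableType => m _.
rewrite (_ : mkset _ = setT `&` (fun x => rdot (h m) (f x)) @^-1`
    `]-oo, ratr q * N (h m) + rdot (h m) (h n)]%classic); first exact: mf.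
by apply/seteqP; split=> x /=; rewrite in_itv /=; [move=> ?; split|case].
Qed.

Lemma hmeas_real (f : U -> V) (phi : V -> R) : hmeas f ->
  (forall (u : V) (e : R), 0 < e -> exists2 del : R, 0 < del &
     forall w, N (w - u) < del -> `|phi w - phi u| < e) ->
  measurable_fun setT (phi \o f).
Proof.
move=> mf hphi; apply: (measurability _ (RGenInftyO.measurableE R)).
move=> _ [_ [c ->] <-]; rewrite setTI.
rewrite (_ : _ @^-1` _ = f @^-1` [set w | phi w < c]).
  by apply: mf; apply: sub_gen_smallest; exact: hopen_lt.
by apply/seteqP; split=> x /=; rewrite in_itv.
Qed.

Lemma hmeas_rdot (f : U -> V) v : hmeas f -> measurable_fun setT (fun x => rdot v (f x)).
Proof.
move=> mf; apply: (@hmeas_real f (fun w => rdot v w)) => // u e e0.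
have v1 : 0 < N v + 1 by rewrite ltr_wpDl ?hnorm_ge0.
exists (e / (N v + 1)); first by rewrite divr_gt0.
move=> w wu; rewrite -cReN -cReD -(dotBr ip) (le_lt_trans (abs_rdot_le ip _ _)) //.
rewrite (@le_lt_trans _ _ ((N v + 1) * N (w - u))) //.
  by rewrite ler_wpM2r ?hnorm_ge0 // lerDl.
by rewrite mulrC -ltr_pdivlMr.
Qed.

Lemma hmeas_dist (f : U -> V) v : hmeas f -> measurable_fun setT (fun x => N (f x - v)).
Proof.
move=> mf; apply: (@hmeas_real f (fun w => N (w - v))) => // u e e0; exists e => // w wu.
by rewrite (le_lt_trans (hnorm_lip ip _ _)) // opprB addrA subrK.
Qed.

Lemma hmeas_cst v : hmeas (cst v).
Proof.
by apply: hmeas_weak => n; exact: (measurable_cst (complex.Re (dot (h n) v))).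
Qed.

Lemma hmeas_lin (c : R[i]) (f g : U -> V) : hmeas f -> hmeas g -> hmeas (fun x => c *: f x + g x).
Proof.
move=> mf mg; apply: hmeas_weak => n.
rewrite (_ : (fun x => _) = fun x => rdot (conjc c *: h n) (f x) + rdot (h n) (g x)).
  by apply: measurable_funD; exact: hmeas_rdot.
by apply/funext => x; rewrite (dotDr ip) (dotZr ip) (dotZl ip) conjcK cReD.
Qed.

(** Replacing the first argument by a near point of the dense sequence leaves a function of [g]
    alone, which avoids any sigma-algebra on [V * V]. *)
Lemma hmeas_dist2 (f g : U -> V) : hmeas f -> hmeas g ->
  measurable_fun setT (fun x => N (f x - g x)).
Proof.
move=> mf mg; apply: (@measurable_fun_nearest _ _ _ (fun n x => N (h n - g x)) (fun n x => N (f x - h n))).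
- by move=> n; under eq_fun do rewrite (hnormBC ip); exact: hmeas_dist.
- by move=> n; exact: hmeas_dist.
- by move=> x e /(h_dense (f x)).
move=> x s hs; have cs : hcvg dot (h \o s) (f x) by exact: hcvg_seq.
apply: (hcvg_norm ip (u := fun k => h (s k) - g x)).
rewrite /hcvg; apply: cvg_trans cs; apply: near_eq_cvg; near=> k => /=.
by rewrite opprB addrA subrK.
Unshelve. all: end_near. Qed.

Lemma hmeas_rdot2 (f g : U -> V) : hmeas f -> hmeas g ->
  measurable_fun setT (fun x => rdot (f x) (g x)).
Proof.
move=> mf mg; apply: (@measurable_fun_nearest _ _ _ (fun n x => rdot (h n) (g x)) (fun n x => N (f x - h n))).
- by move=> n; exact: hmeas_rdot.
- by move=> n; exact: hmeas_dist.
- by move=> x e /(h_dense (f x)).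
move=> x s hs; have cs : hcvg dot (h \o s) (f x) by exact: hcvg_seq.
rewrite (rdotC ip (f x)) (_ : (fun k => _) = fun k => rdot (g x) ((h \o s) k)).
  exact: hcvg_rdot.
by apply/funext => k; rewrite (rdotC ip).
Qed.

(** Only an upper bound [delta n] of the error has to be measurable, and the [n] that makes it small
    may depend on the point. *)
Lemma hmeas_nearest (fn : nat -> U -> V) (delta : nat -> U -> R) (f : U -> V) :
  (forall n, hmeas (fn n)) -> (forall n, measurable_fun setT (delta n)) ->
  (forall n x, N (f x - fn n x) <= delta n x) ->
  (forall x (e : R), 0 < e -> exists n, delta n x < e) -> hmeas f.
Proof.
move=> mfn mdelta fd dd; apply: hmeas_weak => m.
apply: (@measurable_fun_nearest _ _ _ (fun n x => rdot (h m) (fn n x)) delta) => //.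
  by move=> n; exact: hmeas_rdot.
move=> x s hs; apply: (hcvg_rdot ip (u := fun k => fn (s k) x)).
by apply: (hcvg_seq ip) => k; exact: le_lt_trans (fd _ _) (hs k).
Qed.

End fixed_domain.
End hilbert_measurability.

Section L2_products.
Context d (T : measurableType d) (R : realType) (P : probability T R).
Local Notation toL2 := (toL2 P).
Local Notation L2p := (L2pred P).

Lemma L2pred_ae (f g : T -> R[i]) : f \in L2p -> cmeasurable measurable g ->
  {ae P, forall x, f x = g x} -> g \in L2p.
Proof.
move=> /L2predP[[mfr lfr] [mfi lfi]] /cmeasurable_funP[mgr mgi] fg; apply/L2predP.
have H (a b : T -> R) : measurable_fun setT a -> measurable_fun setT b ->
   {ae P, forall x, a x = b x} -> (\int[P]_x (a x ^+ 2)%:E = \int[P]_x (b x ^+ 2)%:E)%E.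
  move=> ma mb ab; apply: ae_eq_integral => //.
  - by apply/measurable_EFinP; exact: measurable_funX.
  - by apply/measurable_EFinP; exact: measurable_funX.
  - by apply: filterS ab => x -> _.
split; split=> //; [rewrite -(H _ _ mfr)|rewrite -(H _ _ mfi)] => //;
  by apply: filterS fg => x ->.
Qed.

Lemma L2mul_toL2 (f g : T -> R[i]) : f \in L2p -> g \in L2p ->
  (fun x => f x * g x) \in L2p ->
  L2mul (toL2 f) (toL2 g) = toL2 (fun x => f x * g x).
Proof.
move=> fL gL fgL.
have ae : {ae P, forall x, f x * g x = (repr (toL2 f) : L2fun P) x * (repr (toL2 g) : L2fun P) x}.
  by apply: filterS2 (toL2_ae fL) (toL2_ae gL) => x -> ->.
apply/toL2_eqP => //.
  apply: (L2pred_ae fgL) => //.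
  by apply: measurable_cmul; apply: L2pred_cmeas; exact: L2fun_pred.
by apply: filterS ae => x ->.
Qed.

End L2_products.

Lemma cabs_le (R : realType) (z : R[i]) :
  cabs z <= `|complex.Re z| + `|complex.Im z|.
Proof.
rewrite -ler_sqr ?nnegrE ?cabs_ge0 ?addr_ge0 // /cabs sqr_sqrtr ?addr_ge0 ?sqr_ge0 //.
by rewrite sqrrD !real_normK ?num_real // addrAC lerDl mulrn_wge0 // mulr_ge0.
Qed.

Lemma rat_approx (R : realType) (x e : R) : 0 < e -> exists p : rat, `|x - ratr p| < e.
Proof.
move=> e0; have [p] : exists p : rat, ratr p \in `]x - e, x + e[.
  by apply: rat_in_itvoo; lra.
rewrite in_itv /= => /andP[p1 p2]; exists p; rewrite ltr_norml.
by apply/andP; split; lra.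
Qed.

(** * Rational step functions over a countable family of sets *)

Section countable_dense.
Context (T : Type) (R : realType).

(** Finite intersections are coded by lists of indices: there are countably many of them, the empty
    list gives the whole space and concatenation gives intersection, so they form a pi-system. *)
Definition capseq (V : nat -> set T) (s : seq nat) : set T :=
  [set x | forall i, i \in s -> V i x].

Definition qc (x : rat * rat) : R[i] := (ratr x.1 +i* ratr x.2)%C.

Definition qsimple (V : nat -> set T) (s : seq (rat * rat * seq nat)) (x : T) : R[i] :=
  \sum_(y <- s) qc y.1 * cindic R (capseq V y.2) x.

Definition qsimple_enum V n : T -> R[i] := qsimple V (odflt [::] (unpickle n)).

(** Involves the coefficients only, so the resulting bound is uniform in the sets [V], and therefore
    in any parameter on which these depend. *)
Definition qbound (s : seq (rat * rat * seq nat)) : R :=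
  \sum_(y <- s) (`|ratr y.1.1| + `|ratr y.1.2|).

Lemma qsimple_bound V s x : `|complex.Re (qsimple V s x)| <= qbound s /\
  `|complex.Im (qsimple V s x)| <= qbound s.
Proof.
rewrite /qsimple /qbound; elim: s => [|y s [IHr IHi]].
  by rewrite !big_nil /= normr0.
rewrite !big_cons; set z := \sum_(j <- s) _ in IHr IHi *.
rewrite cReD cImD cReM cImM /= !mulr0 subr0 add0r indicE.
split; (rewrite (le_trans (ler_normD _ _)) // lerD //); case: (_ \in _);
  by rewrite ?mulr0 ?mulr1 ?normr0 ?addr_ge0 // ?lerDl ?lerDr.
Qed.

Lemma qcM x y : qc x * qc y = qc (x.1 * y.1 - x.2 * y.2, x.1 * y.2 + x.2 * y.1).
Proof.
by apply: complex_ext; rewrite ?cReM ?cImM /= ?rmorphB ?rmorphD /= !rmorphM.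
Qed.

Lemma capseq_cat V s t : capseq V (s ++ t) = capseq V s `&` capseq V t.
Proof.
apply/seteqP; split=> [x h|x [h1 h2] i]; last by rewrite mem_cat => /orP[/h1|/h2].
by split=> i si; apply: h; rewrite mem_cat si ?orbT.
Qed.

Lemma capseqE V s : capseq V s = \big[setI/setT]_(i <- s) V i.
Proof.
elim: s => [|i s IH]; first by rewrite big_nil; apply/seteqP; split.
rewrite big_cons -IH; apply/seteqP; split=> [x h|x [h1 h2] j].
  by split=> [|j js]; apply: h; rewrite inE ?eqxx // js orbT.
by rewrite inE => /predU1P[->//|/h2].
Qed.

End countable_dense.

Section L2_countable_dense.
Context d (T : measurableType d) (R : realType) (P : probability T R).
Local Notation toL2 := (toL2 P).
Local Notation L2p := (L2pred P).
Local Notation dot := (L2dot P).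
Local Notation N := (hnorm (L2dot P)).
Let ip := L2_inner_product P.
Context (V : nat -> set T).

Lemma measurable_capseq s : <<s range V>> (capseq V s).
Proof.
rewrite capseqE; elim: s => [|i s IH].
  by rewrite big_nil; have := @measurableT _ (g_sigma_algebraType (range V)).
rewrite big_cons; apply: (@measurableI _ (g_sigma_algebraType (range V))) => //.
by apply: sub_gen_smallest; exists i.
Qed.

Lemma measurable_qsimple s : cmeasurable <<s range V>> (qsimple R V s).
Proof.
suff [mr mi] : measurable_fun (setT : set (g_sigma_algebraType (range V)))
    (fun x => complex.Re (qsimple R V s x)) /\
  measurable_fun (setT : set (g_sigma_algebraType (range V)))
    (fun x => complex.Im (qsimple R V s x)).
  by split; exact/(@sys_measurable_funP _ _ (g_sigma_algebraType (range V))).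
rewrite /qsimple; elim: s => [|y s [IHr IHi]].
  by split; (rewrite (_ : (fun x => _) = cst 0); first exact: measurable_cst);
    apply/funext => x; rewrite big_nil.
have mI : measurable_fun (setT : set (g_sigma_algebraType (range V))) (\1_(capseq V y.2) : _ -> R).
  by apply: (@measurable_indic _ (g_sigma_algebraType (range V))); exact: measurable_capseq.
have c1 (c : R) := measurable_funM (measurable_cst (D := setT) c) mI.
split.
  rewrite (_ : (fun x => _) = fun x => ratr y.1.1 * \1_(capseq V y.2) x +
    complex.Re (\sum_(y <- s) qc R y.1 * cindic R (capseq V y.2) x)).
    by apply: measurable_funD => //; exact: c1.
  by apply/funext => x; rewrite big_cons cReD cReM /= mulr0 subr0.
rewrite (_ : (fun x => _) = fun x => ratr y.1.2 * \1_(capseq V y.2) x +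
    complex.Im (\sum_(y <- s) qc R y.1 * cindic R (capseq V y.2) x)).
  by apply: measurable_funD => //; exact: c1.
by apply/funext => x; rewrite big_cons cImD cImM /= mulr0 add0r.
Qed.

Hypothesis mV : forall i, measurable (V i).

Let mVs : <<s range V>> `<=` @measurable _ T.
Proof. by apply: smallest_sub_measurable => _ [i _ <-]. Qed.

Lemma L2pred_qsimple s : qsimple R V s \in L2p.
Proof.
apply: (@bounded_L2pred _ _ _ _ _ (qbound R s)); first exact: cmeasurable_sub (measurable_qsimple s).
- by move=> x; case: (qsimple_bound R V s x).
- by move=> x; case: (qsimple_bound R V s x).
Qed.

Lemma qsimple_dense f : f \in L2p -> cmeasurable <<s range V>> f ->
  forall e : R, 0 < e -> exists n, N (toL2 f - toL2 (qsimple_enum R V n)) < e.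
Proof.
move=> fL mf.
pose K := [set u | forall e : R, 0 < e -> exists s, N (u - toL2 (qsimple R V s)) < e].
suff Kf : K (toL2 f).
  by move=> e /Kf[s hs]; exists (pickle s); rewrite /qsimple_enum pickleK.
pose Pi := range (capseq V).
have PiM : Pi `<=` measurable.
  by move=> _ [s _ <-]; apply: mVs; exact: measurable_capseq.
have mf' : cmeasurable <<s Pi>> f.
  apply: cmeasurable_sub mf; apply: smallest_sub; first exact: smallest_sigma_algebra.
  move=> _ [i _ <-]; apply: sub_gen_smallest; exists [:: i] => //.
  by rewrite capseqE big_seq1.
have qI s : qsimple R V [:: (1, 0, s)] = cindic R (capseq V s).
  by apply/funext => x; rewrite /qsimple big_seq1 /qc /= rmorph1 rmorph0 mul1r.
have K1 s : K (toL2 (cindic R (capseq V s))).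
  by move=> e e0; exists [:: (1, 0, s)]; rewrite qI subrr (hnorm0 ip).
apply: (L2_pi_dense _ _ PiM) mf' => //; last 2 first.
- by have := K1 [::]; congr (K (toL2 _)); apply/funext => x; rewrite /cindic capseqE big_nil indicT.
- by move=> _ [s _ <-].
- split.
  + move=> e e0; exists [::]; rewrite (_ : qsimple R V [::] = fun=> 0); last first.
      by apply/funext => x; rewrite /qsimple big_nil.
    by rewrite toL20 subrr (hnorm0 ip).
  + move=> c u v Ku Kv e e0.
    have c1 : 0 < cabs c + 1 by rewrite ltr_wpDl ?cabs_ge0.
    have e3 : 0 < e / 3 by rewrite divr_gt0.
    have [s us] := Ku _ (divr_gt0 e3 c1).
    have [t vt] := Kv _ e3.
    set w := toL2 (qsimple R V s) in us; set z := toL2 (qsimple R V t) in vt.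
    have w1 : 0 < 2 * (N w + 1) by rewrite mulr_gt0 // ltr_wpDl ?hnorm_ge0.
    (* A complex multiple of a rational step function need not be rational, so [c] is replaced by
       [p + i q] with both parts within [del]. The error is at most [2 * del * N w], and adding 1 to
       [N w] keeps the denominator of [del] positive. *)
    pose del := e / 3 / (2 * (N w + 1)); have d0 : 0 < del by rewrite divr_gt0.
    have [p hp] := rat_approx (complex.Re c) d0.
    have [q hq] := rat_approx (complex.Im c) d0.
    pose sc (y : rat * rat * seq nat) := ((p * y.1.1 - q * y.1.2, p * y.1.2 + q * y.1.1), y.2).
    exists (map sc s ++ t).
    have -> : toL2 (qsimple R V (map sc s ++ t)) = qc R (p, q) *: w + z.
      rewrite /w -toL2Z ?L2pred_qsimple // -toL2D ?L2pred_qsimple //; last first.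
        by apply: L2predZ; exact: L2pred_qsimple.
      congr toL2; apply/funext => x; rewrite /qsimple big_cat big_map mulr_sumr; congr (_ + _).
      by apply: eq_bigr => y _; rewrite mulrA qcM.
    have -> : c *: u + v - (qc R (p, q) *: w + z) =
        c *: (u - w) + ((c - qc R (p, q)) *: w + (v - z)).
      by rewrite scalerBr scalerBl opprD; rewrite !addrA; congr (_ + _); rewrite addrAC subrK addrAC.
    rewrite (le_lt_trans (hnormD ip _ _)) //.
    rewrite (_ : e = e / 3 + (e / 3 + e / 3)); last by field.
    apply: ler_ltD.
      rewrite (hnormZ ip) (@le_trans _ _ ((cabs c + 1) * N (u - w))) //.
        by rewrite ler_wpM2r ?hnorm_ge0 // lerDl.
      by rewrite mulrC -ler_pdivlMr // ltW.
    rewrite (le_lt_trans (hnormD ip _ _)) //; apply: ler_ltD => //.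
    rewrite (hnormZ ip).
    have cd : cabs (c - qc R (p, q)) <= 2 * del.
      rewrite (le_trans (cabs_le _)) // cReD cImD cReN cImN /= mulr_natl mulr2n.
      by rewrite lerD // ltW.
    apply: (@le_trans _ _ (2 * del * (N w + 1))).
      by apply: ler_pM; rewrite ?cabs_ge0 ?hnorm_ge0 // lerDl.
    by rewrite mulrAC mulrC /del divfK // gt_eqF.
  + move=> u hu e e0; have e2 : 0 < e / 2 by rewrite divr_gt0.
    have [v Kv uv] := hu _ e2; have [s vs] := Kv _ e2.
    by exists s; rewrite (le_lt_trans (hnorm_dist ip v _ _)) // (splitr e) ltrD.
- by move=> _ _ [s _ <-] [t _ <-]; exists (s ++ t) => //; rewrite capseq_cat.
Qed.

End L2_countable_dense.

(** * Laws on cylinder sigma-algebras *)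

Section cylinders.
Context (R : realType) (I : Type).

(** The points are all functions on [I], with no additivity required; only the coordinates in [D]
    are made measurable, so an event cannot depend on any other coordinate. *)
Definition cyl (D : set I) : set (set (I -> \bar R)) :=
  [set (fun e : I -> \bar R => e i) @^-1` A | i in D & A in @measurable _ (\bar R)].

Definition cylType (D : set I) : Type := g_sigma_algebraType (cyl D).
HB.instance Definition _ D := Measurable.copy (cylType D) (g_sigma_algebraType (cyl D)).

Lemma measurable_cyl_eval (D : set I) i : D i ->
  measurable_fun setT (fun e : cylType D => e i).
Proof.
move=> Di _ B mB; rewrite setTI; apply: sub_gen_smallest.
by exists i => //; exists B.
Qed.

Lemma measurable_to_cyl d (T : measurableType d) (D : set I) (phi : T -> cylType D) :
  (forall i, D i -> measurable_fun setT (fun x => phi x i)) -> measurable_fun setT phi.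
Proof.
move=> mphi; apply: (@measurability _ _ _ (cylType D) setT phi (cyl D)) => //.
by move=> _ [_ [i Di [A mA <-]] <-]; exact: mphi.
Qed.

Definition cbox n (i : 'I_n -> I) (A : 'I_n -> set (\bar R)) : set (I -> \bar R) :=
  [set e | forall k, A k (e (i k))].

Definition cboxes (D : set I) : set (set (I -> \bar R)) :=
  [set B | exists n (i : 'I_n -> I) (A : 'I_n -> set (\bar R)),
     [/\ forall k, D (i k), forall k, measurable (A k) & B = cbox i A]].

Lemma measurable_cbox (D : set I) : cboxes D `<=` <<s cyl D>>.
Proof.
move=> _ [n [i [A [Di mA ->]]]].
have -> : cbox i A = \bigcap_(k in [set: 'I_n]) (fun e : I -> \bar R => e (i k)) @^-1` A k.
  by apply/seteqP; split=> [e he k _|e he k]; exact: he.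
apply: (@fin_bigcap_measurable _ (g_sigma_algebraType (cyl D)) 'I_n [set: 'I_n]) => // k _.
by apply: sub_gen_smallest; exists (i k) => //; exists (A k).
Qed.

Lemma cboxes_gen (D : set I) : <<s cboxes D>> = <<s cyl D>>.
Proof.
apply/seteqP; split.
  by apply: smallest_sub; [exact: smallest_sigma_algebra|exact: measurable_cbox].
apply: smallest_sub; first exact: smallest_sigma_algebra.
move=> _ [i Di [A mA <-]]; apply: sub_gen_smallest.
exists 1, (fun=> i), (fun=> A); split=> //.
by apply/seteqP; split=> e /=; [move=> eA k|move/(_ ord0)].
Qed.

Lemma cboxes_setI (D : set I) : setI_closed (cboxes D).
Proof.
move=> _ _ [n [i [A [Di mA ->]]]] [m [j [B [Dj mB ->]]]].
exists (n + m), (fun k => match fintype.split k with inl a => i a | inr b => j b end),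
  (fun k => match fintype.split k with inl a => A a | inr b => B b end).
split=> [k|k|]; try by case: fintype.split.
apply/seteqP; split=> [e [h1 h2] k|e h]; first by case: fintype.split.
split=> k.
  have := h (lshift m k); case: split_ordP => [? /lshift_inj <- //|? /eqP].
  by rewrite eq_lrshift.
have := h (rshift n k); case: split_ordP => [? /eqP|? /rshift_inj <- //].
by rewrite eq_rlshift.
Qed.

Lemma cyl_law_eq d1 (T1 : measurableType d1) (P1 : probability T1 R)
  d2 (T2 : measurableType d2) (P2 : probability T2 R) (D : set I)
  (phi1 : T1 -> I -> \bar R) (phi2 : T2 -> I -> \bar R) :
  (forall i, D i -> measurable_fun setT (fun x => phi1 x i)) ->
  (forall i, D i -> measurable_fun setT (fun x => phi2 x i)) ->
  (forall n (i : 'I_n -> I) (A : 'I_n -> set (\bar R)),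
    (forall k, D (i k)) -> (forall k, measurable (A k)) ->
    P1 (phi1 @^-1` cbox i A) = P2 (phi2 @^-1` cbox i A)) ->
  forall B, <<s cyl D>> B -> P1 (phi1 @^-1` B) = P2 (phi2 @^-1` B).
Proof.
move=> m1 m2 fdd B; rewrite -cboxes_gen.
have mp1 : measurable_fun setT (phi1 : T1 -> cylType D) by exact: measurable_to_cyl.
have mp2 : measurable_fun setT (phi2 : T2 -> cylType D) by exact: measurable_to_cyl.
have M1 S : <<s cyl D>> S -> measurable (phi1 @^-1` S).
  by move=> mS; rewrite -[X in measurable X]setTI; exact: mp1.
have M2 S : <<s cyl D>> S -> measurable (phi2 @^-1` S).
  by move=> mS; rewrite -[X in measurable X]setTI; exact: mp2.
apply: (@dynkin_induction _ (g_sigma_algebraType (cboxes D))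
  (cboxes D) (fun B => P1 (phi1 @^-1` B) = P2 (phi2 @^-1` B))) => //.
- exact: cboxes_setI.
- by rewrite !preimage_setT; transitivity (1%E : \bar R); [|symmetry]; exact: probability_setT.
- by move=> _ [n [i [A [Di mA ->]]]]; exact: fdd.
- move=> S; rewrite /measurable /= cboxes_gen => mS eS.
  have h1 := probability_setC P1 (M1 _ mS).
  have h2 := probability_setC P2 (M2 _ mS).
  by move: (etrans h1 (etrans (congr1 (fun x => (1 - x)%E) eS) (esym h2))).
- move=> F mF tF eF; rewrite !preimage_bigcup.
  have mF' n : <<s cyl D>> (F n) by have := mF n; rewrite /measurable /= cboxes_gen.
  have tF' T (f : T -> I -> \bar R) : trivIset setT (fun n => f @^-1` F n).
    by move=> i j _ _ [x xij]; apply: tF => //; exists (f x).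
  have h1 := @measure_semi_bigcup _ _ _ P1 _ (fun n => M1 _ (mF' n)) (tF' _ phi1)
    (bigcup_measurable (fun n _ => M1 _ (mF' n))).
  have h2 := @measure_semi_bigcup _ _ _ P2 _ (fun n => M2 _ (mF' n)) (tF' _ phi2)
    (bigcup_measurable (fun n _ => M2 _ (mF' n))).
  by rewrite h1 h2; apply: eq_eseriesr => n _; exact: eF.
Qed.

End cylinders.

Arguments cyl R {I} D.
Arguments cylType R {I} D.

(** * Laws of finitely additive random set functions *)

Section additive_law.
Context (R : realType) dZ (Z : measurableType dZ).
Context d1 (T1 : measurableType d1) (P1 : probability T1 R).
Context d2 (T2 : measurableType d2) (P2 : probability T2 R).
Context (C : set (set Z)).
Context (th1 : T1 -> set Z -> \bar R) (th2 : T2 -> set Z -> \bar R).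
Hypotheses (C0 : C set0) (CM : C `<=` measurable)
  (CI : forall A B, C A -> measurable B -> C (A `&` B)).

(** The union itself is required to lie in [C]. This allows [C] to consist of the measurable subsets
    of two disjoint regions, a class that is not stable under unions. *)
Definition fin_additive (th : set Z -> \bar R) := forall (J : finType) (D : J -> set Z) A,
  (forall j, C (D j)) -> trivIset setT D -> C A -> A = \bigcup_j D j ->
  th A = (\sum_j th (D j))%E.

Hypotheses (add1 : forall w, fin_additive (th1 w)) (add2 : forall w, fin_additive (th2 w)).
Hypotheses (m1 : forall A, C A -> measurable_fun setT (th1 ^~ A))
  (m2 : forall A, C A -> measurable_fun setT (th2 ^~ A)).
Hypothesis fdd : forall n (D : 'I_n -> set Z) (A : 'I_n -> set (\bar R)),
  (forall k, C (D k)) -> trivIset setT D -> (forall k, measurable (A k)) ->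
  P1 [set w | forall k, A k (th1 w (D k))] = P2 [set w | forall k, A k (th2 w (D k))].

Let fdd_fin (J : finType) (D : J -> set Z) (A : J -> set (\bar R)) :
  (forall k, C (D k)) -> trivIset setT D -> (forall k, measurable (A k)) ->
  P1 [set w | forall k, A k (th1 w (D k))] = P2 [set w | forall k, A k (th2 w (D k))].
Proof.
move=> CD tD mA; have := @fdd _ (D \o enum_val) (A \o enum_val : 'I_#|J| -> _).
have E T (th : T -> set Z -> \bar R) : [set w | forall k, A k (th w (D k))] =
    [set w | forall k : 'I_#|J|, (A \o enum_val) k (th w ((D \o enum_val) k))].
  by apply/seteqP; split=> w h k /=; [exact: h|rewrite -(enum_rankK k); exact: h].
rewrite -!E; apply=> [k||k]; [exact: CD| |exact: mA].
by apply/trivIsetP => i j _ _ ij; move/trivIsetP: tD; apply=> //; apply: contra_neq ij => /enum_val_inj.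
Qed.

(* Atoms of the partition generated by the E k, indexed by nonempty sets of
   indices so that they stay in C. *)
Let atom n (E : 'I_n -> set Z) (s : {set 'I_n}) : set Z :=
  [set z | s != finset.set0 /\ forall k, E k z <-> k \in s].

Let C_atom n (E : 'I_n -> set Z) s : (forall k, C (E k)) -> C (atom E s).
Proof.
move=> CE; have [s0|[k ks]] := set_0Vmem s.
  by rewrite (_ : atom E s = set0) //; apply/seteqP; split=> // z []; rewrite s0 eqxx.
rewrite (_ : atom E s = E k `&`
    \bigcap_(j in [set: 'I_n]) (if j \in s then E j else ~` E j)).
  apply: CI => //; apply: fin_bigcap_measurable => // j _.
  by case: ifP => _; [exact: CM|apply: measurableC; exact: CM].
apply/seteqP; split=> [z [_ h]|z [Ek h]].
  by split=> [|j _]; [exact/h|case: ifPn => js /=; [exact/h|move/h; apply/negP]].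
split=> [|j]; first by apply/set0Pn; exists k.
by have := h j I; case: ifPn.
Qed.

Let trivIset_atom n (E : 'I_n -> set Z) : trivIset setT (atom E).
Proof.
move=> s t _ _ [z [[_ hs] [_ ht]]]; apply/finset.setP => k.
by apply/idP/idP => [/hs /ht|/ht /hs].
Qed.

Let additive_atoms (th : set Z -> \bar R) n (E : 'I_n -> set Z) k :
  fin_additive th -> (forall k, C (E k)) ->
  th (E k) = (\sum_(s : {set 'I_n} | k \in s) th (atom E s))%E.
Proof.
move=> hadd CE.
have th0 : th set0 = 0%E.
  (* Additivity over an empty family of sets. *)
  have := @hadd void (fun v => match v with end) set0.
  by rewrite big_pred0 => [->//|[]]; apply/seteqP; split=> // z [[]].
(* Atoms that miss [E k] are replaced by the empty set, so that the decomposition is indexed by all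
   [s]. *)
rewrite (hadd _ (fun s : {set 'I_n} => if k \in s then atom E s else set0)) //; last 3 first.
- by move=> s; case: ifP => // _; exact: C_atom.
- move=> s t _ _; case: ifP => ks; case: ifP => kt; rewrite ?set0I ?setI0; try by case.
  exact: trivIset_atom.
- apply/seteqP; split=> [z Ez|z [s _]]; last by case: ifPn => [ks [_ h]|//]; exact/h.
  pose s := [set j | `[< E j z >]]%SET.
  have hs j : E j z <-> j \in s by rewrite inE; split=> /asboolP.
  exists s => //; rewrite ifT; last exact/hs.
  by split=> //; apply/set0Pn; exists k; exact/hs.
rewrite (bigID (fun s : {set 'I_n} => k \in s)) /= [X in (_ + X)%E]big1 ?adde0.
  by apply: eq_bigr => s ->.
by move=> s /negbTE ->.
Qed.

(** Values on possibly overlapping members of [C] are sums of values on the atoms that they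
    generate; the atoms are disjoint, so [fdd] determines their joint law. *)
Lemma additive_law_eq B : <<s cyl R C>> B -> P1 (th1 @^-1` B) = P2 (th2 @^-1` B).
Proof.
apply: cyl_law_eq => // n E A CE mA.
pose J := {set 'I_n}.
pose S : set (J -> \bar R) := [set e | forall k, A k (\sum_(s : J | k \in s) e s)%E].
have mS : <<s cyl R [set: J]>> S.
  have -> : S = \bigcap_(k in [set: 'I_n])
      (fun e : cylType R [set: J] => (\sum_(s : J | k \in s) e s)%E) @^-1` A k.
    by apply/seteqP; split=> [e he k _|e he k]; exact: he.
  apply: (@fin_bigcap_measurable _ (cylType R [set: J]) 'I_n [set: 'I_n]) => // k _.
  rewrite -[X in measurable X]setTI.
  suff : measurable_fun setT (fun e : cylType R [set: J] => (\sum_(s : J | k \in s) e s)%E) by exact.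
  rewrite (_ : (fun _ => _) = fun e : cylType R [set: J] =>
      (\sum_(s <- enum [pred s : J | k \in s]) e s)%E); last first.
    by apply/funext => e; rewrite big_enum.
  by apply: emeasurable_sum => s; exact: measurable_cyl_eval.
have key T (th : T -> set Z -> \bar R) : (forall w, fin_additive (th w)) ->
    th @^-1` cbox E A = (fun w s => th w (atom E s)) @^-1` S.
  move=> hadd; apply/seteqP; split=> w /= h k; have := h k; rewrite /S.
    by rewrite (additive_atoms k (hadd w) CE).
  by rewrite -(additive_atoms k (hadd w) CE).
rewrite !key //.
apply: (@cyl_law_eq _ _ _ _ _ _ _ _ [set: J]) mS => [s _|s _|m j A' _ mA'].
- by apply: m1; exact: C_atom.
- by apply: m2; exact: C_atom.
(* Several conditions of the box may bear on the same atom; they are merged by intersection, so that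
   every atom carries exactly one. *)
pose A'' (s : J) : set (\bar R) := \bigcap_(l in [set l | j l = s]) A' l.
have E' T (th : T -> set Z -> \bar R) :
    (fun w s => th w (atom E s)) @^-1` cbox j A' = [set w | forall s, A'' s (th w (atom E s))].
  apply/seteqP; split=> w /= h; first by move=> s l /= <-; exact: h.
  by move=> l; exact: h.
rewrite !E'; apply: fdd_fin => [s||s]; [exact: C_atom|exact: trivIset_atom|].
by apply: fin_bigcap_measurable => [|l _]; [exact: finite_finset|exact: mA'].
Qed.

End additive_law.

(** * Compound Poisson processes *)

Section marked_integral.
Import HBNNSimple.
Context (R : realType) dY (Y : measurableType dY).
Local Notation Z := (Y * posR R)%type.
Local Open Scope ereal_scope.

Lemma measurable_pos_val : measurable_fun setT (@pos_val R : posR R -> R).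
Proof. by move=> _ B mB; exists B. Qed.

Lemma pos_val_gt0 (r : posR R) : (0 < pos_val r)%R.
Proof. exact: (svalP r). Qed.

Context (g : posR R -> R) (mg : measurable_fun setT g) (g0 : forall r, (0 <= g r)%R).

Let mEg : measurable_fun setT (EFin \o g). Proof. exact/measurable_EFinP. Qed.

Definition mark_level n (x : R) : set (posR R) := nnsfun_approx measurableT mEg n @^-1` [set x].

Definition mark_values n : seq R :=
  finmap.enum_fset (fset_set (range (nnsfun_approx measurableT mEg n))).

Definition marked_sum n (e : set Z -> \bar R) (B : set Y) : \bar R :=
  \sum_(x <- mark_values n) x%:E * e (B `*` mark_level n x).

(* The integral of g over B as a limit of values on rectangles: this makes sense for
   an arbitrary set function e, and is measurable for the cylinder sigma-algebra. *)
Definition marked (e : set Z -> \bar R) (B : set Y) : \bar R :=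
  limn_esup (fun n => marked_sum n e B).

Lemma measurable_mark_level n x : measurable (mark_level n x).
Proof. exact: measurable_sfunP. Qed.

Lemma mark_values_ge0 n x : x \in mark_values n -> (0 <= x)%R.
Proof.
rewrite /mark_values; have [f0 _] : finite_set (range (nnsfun_approx measurableT mEg n)) /\ True by split.
rewrite in_fset_set // inE => -[r _ <-]; exact: fun_ge0.
Qed.

Let approxE n r : nnsfun_approx measurableT mEg n r =
  (\sum_(x <- mark_values n) x * \1_(mark_level n x) r)%R.
Proof. by rewrite [LHS]fimfunE fsbig_finite. Qed.

Let cvg_approx r : (fun n => (nnsfun_approx measurableT mEg n r)%:E) @ \oo --> (g r)%:E.
Proof.
by have := @cvg_nnsfun_approx _ _ R setT measurableT _ mEg (fun x _ => g0 x) r Logic.I.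
Qed.

Let nd_approx r n m : (n <= m)%N ->
  (nnsfun_approx measurableT mEg n r <= nnsfun_approx measurableT mEg m r)%R.
Proof. by move=> nm; have /lefP := nd_nnsfun_approx measurableT mEg nm; apply. Qed.

Section fixed_measure.
Context (m : {measure set Z -> \bar R}) (B : set Y).
Hypothesis mB : measurable B.

Lemma marked_sumE n : marked_sum n m B =
  \int[m]_z (nnsfun_approx measurableT mEg n z.2 * \1_B z.1)%:E.
Proof.
have mS x : measurable (B `*` mark_level n x).
  by apply: measurableX => //; exact: measurable_mark_level.
(* The test [x \in mark_values n] makes the term of every [x] nonnegative, also outside the list, as
   the exchange of sum and integral requires. *)
transitivity (\int[m]_z (\sum_(x <- mark_values n)
    (if x \in mark_values n then x%:E * (\1_(B `*` mark_level n x) z)%:E else 0))).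
  rewrite ge0_integral_sum //; last 2 first.
  - move=> x; case: (x \in mark_values n); last exact: measurable_cst.
    apply: measurable_funeM.
    by apply/measurable_EFinP; exact: measurable_indic.
  - move=> x z _; case: ifP => // /mark_values_ge0 x0.
    by apply: mule_ge0; rewrite lee_fin // indicE.
  apply: eq_big_seq => x xs; rewrite xs.
  rewrite ge0_integralZl_EFin //.
  - by rewrite integral_indic // setIT.
  - by apply/measurable_EFinP; exact: measurable_indic.
  - exact: mark_values_ge0 xs.
apply: eq_integral => z _; rewrite approxE mulr_suml -sumEFin.
apply: eq_big_seq => x xs; rewrite xs -EFinM; congr (_%:E).
rewrite -mulrA; congr (_ * _)%R; rewrite !indicE in_setX.
by case: (_ \in B); case: (_ \in mark_level _ _); rewrite /= ?mulr0 ?mul0r ?mul1r.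
Qed.

Let integrand n z := (nnsfun_approx measurableT mEg n z.2 * \1_B z.1)%:E.

Let m_integrand n : measurable_fun setT (integrand n).
Proof.
apply/measurable_EFinP; apply: measurable_funM.
  by apply: measurableT_comp => //; exact: measurable_snd.
by apply: measurableT_comp.
Qed.

Lemma cvg_marked_sum : (fun n => marked_sum n m B) @ \oo -->
  \int[m]_z (g z.2 * \1_B z.1)%:E.
Proof.
have h := @cvg_monotone_convergence _ _ _ m setT measurableT integrand m_integrand.
have /h{}h n z : setT z -> 0 <= integrand n z.
  by move=> _; rewrite lee_fin mulr_ge0.
rewrite (_ : (fun n => _) = fun n => \int[m]_z integrand n z); last first.
  by apply/funext => n; exact: marked_sumE.
rewrite (_ : (\int[m]_z _) = \int[m]_z limn (integrand ^~ z)).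
  apply: h => z _ n k nk; rewrite lee_fin ler_wpM2r ?indicE //.
  exact: nd_approx.
apply: eq_integral => z _; apply/esym/cvg_lim => //.
rewrite EFinM (_ : (fun n => _) = fun n =>
    (nnsfun_approx measurableT mEg n z.2)%:E * (\1_B z.1)%:E); last exact/funext.
by apply: cvgeMr => //; exact: cvg_approx.
Qed.

Lemma markedE : marked m B = \int[m]_z (g z.2 * \1_B z.1)%:E.
Proof. by rewrite /marked (cvg_limn_einf_sup cvg_marked_sum).2. Qed.

End fixed_measure.

(** When [l] is a product on rectangles over [B], a marked sum is [c] times the integral of a simple
    function below [g]. The bound is uniform in [n], as needed when Fatou's lemma is applied to
    expectations. *)
Lemma marked_sum_integral n B (nu : {measure set (posR R) -> \bar R}) (l : set Z -> \bar R)
  (c : R) : (0 <= c)%R ->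
  (forall A, measurable A -> l (B `*` A) = c%:E * nu A) ->
  marked_sum n l B <= c%:E * \int[nu]_r (g r)%:E.
Proof.
move=> c0 lE.
have -> : marked_sum n l B = c%:E * \int[nu]_r (nnsfun_approx measurableT mEg n r)%:E.
  rewrite integralT_nnsfun sintegralE.
  rewrite ge0_mule_fsumr; last first.
    by move=> x; exact: nnsfun_mulemu_ge0.
  have fin : finite_set (range (nnsfun_approx measurableT mEg n)) by [].
  rewrite (fsbig_finite _ _ fin) /=.
  rewrite /marked_sum.
  apply: eq_bigr => x _; rewrite lE; last exact: measurable_mark_level.
  by rewrite muleCA.
apply: lee_pmul; rewrite ?lee_fin //.
  by apply: integral_ge0 => r _; rewrite lee_fin.
apply: ge0_le_integral => //.
- by move=> r _; rewrite lee_fin; exact: fun_ge0.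
- by apply/measurable_EFinP.
move=> r _; have cr := @cvg_approx r; rewrite -(cvg_lim _ cr) //.
apply: lime_ge; first exact: cvgP cr.
by exists n => // k /= nk; rewrite lee_fin; exact: nd_approx.
Qed.

Lemma measurable_marked d (T : measurableType d) (e : T -> set Z -> \bar R) B :
  (forall A, measurable A -> measurable_fun setT (fun t => e t (B t `*` A))) ->
  measurable_fun setT (fun t => marked (e t) (B t)).
Proof.
move=> me; apply: measurable_fun_limn_esup => n; apply: emeasurable_sum => x.
by apply: measurable_funeM; apply: me; exact: measurable_mark_level.
Qed.

Lemma marked_sum_ge0 n e B : (forall A, 0 <= e A) -> 0 <= marked_sum n e B.
Proof.
move=> e0; rewrite /marked_sum big_seq; apply: sume_ge0 => x /mark_values_ge0 x0.
by apply: mule_ge0; rewrite ?lee_fin.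
Qed.

End marked_integral.

(** * Poisson distributed values: law and expectation *)

Section poisson_variables.
Context (R : realType) d (T : measurableType d) (Pr : probability T R).
Context dZ (Z : measurableType dZ) (lambda : set Z -> \bar R).
Context (eta : T -> {measure set Z -> \bar R}).
Hypothesis poi : poisson_process Pr lambda eta.
Let pp := poisson_point_process poi.
Local Open Scope ereal_scope.

Definition poisson_weight (l : R) k : R := (l ^+ k / k`!%:R * expR (- l))%R.

Lemma poisson_weight_ge0 l k : (0 <= l)%R -> (0 <= poisson_weight l k)%R.
Proof. by move=> l0; rewrite !mulr_ge0 ?invr_ge0 ?exprn_ge0 ?expR_ge0. Qed.

Lemma sum_poisson_weight l : (0 <= l)%R -> \sum_(k <oo) (poisson_weight l k)%:E = 1.
Proof.
move=> l0; apply/cvg_lim => //.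
rewrite (_ : (fun n => _) = EFin \o (fun n => series (exp_coeff l) n * expR (- l))%R); last first.
  apply/funext => n; rewrite /= seriesEnat /= sumEFin; congr EFin.
  by rewrite mulr_suml; apply: eq_bigr.
apply: cvg_EFin; first by near=> n.
rewrite (_ : fine \o _ = fun n => (series (exp_coeff l) n * expR (- l))%R); last exact/funext.
rewrite -(expRxMexpNx_1 l); apply: cvgM; last exact: cvg_cst.
exact: is_cvg_series_exp_coeff.
Unshelve. all: end_near. Qed.

Lemma meta B : measurable B -> measurable_fun setT (fun w => eta w B).
Proof. exact: pp_measurable. Qed.

Lemma measurable_eta_eq B (x : \bar R) : measurable B -> measurable [set w | eta w B = x].
Proof.
move=> mB; rewrite -[X in measurable X]setTI.
exact: (meta mB measurableT (emeasurable_set1 x)).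
Qed.

Let levels B k := [set w | eta w B = (k%:R)%:E].

Let tlevels B : trivIset setT (levels B).
Proof.
by move=> i j _ _ [w []]; rewrite /levels /= => -> /eqP; rewrite eqe eqr_nat => /eqP.
Qed.

Section finite_intensity.
Context (B : set Z) (mB : measurable B) (fB : lambda B < +oo).
Let l := fine (lambda B).
Hypothesis lam0 : 0 <= lambda B.
Let l0 : (0 <= l)%R. Proof. exact: fine_ge0. Qed.

Let Pr_level k : Pr (levels B k) = (poisson_weight l k)%:E.
Proof. exact: (poisson_fin poi). Qed.

Let Pr_levels : Pr (\bigcup_k levels B k) = 1.
Proof.
rewrite -(sum_poisson_weight l0) (@measure_semi_bigcup _ _ _ Pr (levels B)) //.
- by apply: eq_eseriesr => k _; exact: Pr_level.
- by move=> k; exact: measurable_eta_eq.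
- by apply: bigcup_measurable => k _; exact: measurable_eta_eq.
Qed.

(** The Poisson weights sum to one, so the finite values already exhaust the probability. *)
Lemma eta_fin_ae : {ae Pr, forall w, exists k, eta w B = (k%:R)%:E}.
Proof.
have mU : measurable (\bigcup_k levels B k).
  by apply: bigcup_measurable => k _; exact: measurable_eta_eq.
exists (~` \bigcup_k levels B k); split.
- exact: measurableC.
- by have h := probability_setC Pr mU; rewrite h Pr_levels subee.
- by move=> w /= nw [k _ hk]; apply: nw; exists k.
Qed.

Lemma eta_finite_law A : measurable A -> Pr [set w | A (eta w B)] =
  \sum_(k <oo) (if ((k%:R)%:E : \bar R) \in A then (poisson_weight l k)%:E else 0).
Proof.
move=> mA.
have mS : measurable [set w | A (eta w B)].
  by rewrite -[X in measurable X]setTI; exact: meta.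
have mL k : measurable (levels B k `&` [set w | A (eta w B)]).
  by apply: measurableI => //; exact: measurable_eta_eq.
transitivity (Pr (\bigcup_k (levels B k `&` [set w | A (eta w B)]))).
  rewrite -setI_bigcupl.
  have [N [mN N0 sN]] := eta_fin_ae.
  have mU : measurable (\bigcup_k levels B k).
    by apply: bigcup_measurable => k _; exact: measurable_eta_eq.
  apply/eqP; rewrite eq_le; apply/andP; split; last first.
    by apply: le_measure; rewrite ?inE //; exact: measurableI.
  have <- : Pr ((\bigcup_k levels B k `&` [set w | A (eta w B)]) `|` N) =
      Pr (\bigcup_k levels B k `&` [set w | A (eta w B)]).
    by apply: measureU0 => //; exact: measurableI.
  apply: le_measure; rewrite ?inE //; first by apply: measurableU => //; exact: measurableI.
  move=> w Aw; have [wN|wN] := pselect (N w); first by right.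
  left; split=> //; apply: contrapT => h; apply: wN; apply: sN => -[k hk]; apply: h.
  by exists k.
rewrite (@measure_semi_bigcup _ _ _ Pr) //.
- apply: eq_eseriesr => k _; case: ifPn => kA.
    rewrite (_ : _ `&` _ = levels B k); first exact: Pr_level.
    by apply/seteqP; split=> [w []//|w hw]; split=> //=; rewrite hw; exact: set_mem.
  rewrite (_ : _ `&` _ = set0); first exact: measure0.
  by apply/seteqP; split=> // w []; rewrite /levels /= => ->; move/negP: kA => kA /mem_set.
- by apply: trivIset_setIr; exact: tlevels.
- exact: bigcup_measurable.
Qed.

Lemma expectation_eta_fin : \int[Pr]_w eta w B = lambda B.
Proof.
have fl : (lambda B) = l%:E.
  by rewrite /l fineK // ge0_fin_numE.
transitivity (\int[Pr]_w (\sum_(k <oo) (k%:R)%:E * (\1_(levels B k) w)%:E)).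
  apply: ge0_ae_eq_integral => //.
  - exact: meta.
  - apply: ge0_emeasurable_sum => [k x _ _|k _].
      by apply: mule_ge0; rewrite lee_fin ?indicE.
    by apply: measurable_funeM; apply/measurable_EFinP/measurable_indic; exact: measurable_eta_eq.
  - by move=> w _; apply: nneseries_ge0 => k _ _; apply: mule_ge0; rewrite lee_fin ?indicE.
  apply: filterS eta_fin_ae => w [k hk] _.
  have p0 j : true -> (0 : \bar R) <= (j%:R)%:E * (\1_(levels B j) w)%:E.
    by move=> _; apply: mule_ge0; rewrite lee_fin ?indicE.
  rewrite (@nneseriesD1 _ _ k xpredT p0 isT) indicE mem_set // mule1 hk eseries0 ?adde0 //.
  move=> j _ jk; rewrite indicE memNset ?mule0 // /levels /= hk => /eqP.
  by rewrite eqe eqr_nat eq_sym (negbTE jk).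
rewrite integral_nneseries //; last first.
  by move=> k; apply: measurable_funeM; apply/measurable_EFinP/measurable_indic; exact: measurable_eta_eq.
transitivity (\sum_(k <oo) (k%:R * poisson_weight l k)%:E).
  apply: eq_eseriesr => k _; rewrite ge0_integralZl_EFin //; last first.
    by apply/measurable_EFinP/measurable_indic; exact: measurable_eta_eq.
  rewrite integral_indic //; last exact: measurable_eta_eq.
  rewrite setIT EFinM; congr (_ * _); exact: Pr_level.
(* The term [k = 0] vanishes, and [k] times the weight of [k] is [l] times the weight of [k - 1];
   after a shift of the index the series is [l] times the total mass. *)
rewrite nneseries_recl //; last first.
  by move=> k _; rewrite lee_fin mulr_ge0 // poisson_weight_ge0.
rewrite mul0r add0e -(@nneseries_addn _ _ 1%N); last first.
  by move=> k; rewrite lee_fin mulr_ge0 // poisson_weight_ge0.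
rewrite fl -[RHS]mule1 -(sum_poisson_weight l0) -nneseriesZl; last first.
  by move=> k _; rewrite lee_fin poisson_weight_ge0.
apply: eq_eseriesr => k _; rewrite -EFinM addn1; congr (_%:E).
rewrite /poisson_weight factS natrM exprS; field.
by rewrite pnatr_eq0 -lt0n fact_gt0 gt_eqF // ltr_wpDr.
Qed.

End finite_intensity.
End poisson_variables.

(** * Finiteness and measurability of the compound Poisson process *)

Section compound_poisson_process.
Context (R : realType) dY (Y : measurableType dY).
Context (rho0 : {sigma_finite_measure set Y -> \bar R}).
Context (nu : {measure set (posR R) -> \bar R}).
Hypothesis nu_levy : (\int[nu]_r (Num.min (pos_val r) 1)%:E < +oo)%E.
Context d (T : measurableType d) (Pr : probability T R).
Local Notation Z := (Y * posR R)%type.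
Context (eta : T -> {measure set Z -> \bar R}).
Hypothesis poi : poisson_process Pr (rho0 \x nu)%E eta.
Local Notation lam := (rho0 \x nu)%E.
Local Open Scope ereal_scope.
Let pp := poisson_point_process poi.

Lemma intensity_rect B A : measurable B -> lam (B `*` A) = rho0 B * nu A.
Proof.
move=> mB; rewrite /product_measure1 /=.
rewrite (eq_integral (fun x => (\1_B x)%:E * nu A)); last first.
  by move=> x _; rewrite indicE; have [xB|xB] /= := boolP (x \in B);
    [rewrite in_xsectionX // mul1e|rewrite mul0e notin_xsectionX].
by rewrite ge0_integralZr ?integral_indic ?setIT //; exact: measurableT_comp.
Qed.

Lemma intensity_ge0 C : 0 <= lam C.
Proof. exact: integral_ge0. Qed.

Definition mark_tail n : set (posR R) := [set r | (n.+1%:R^-1 <= pos_val r)%R].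

Lemma measurable_mark_tail n : measurable (mark_tail n).
Proof.
rewrite (_ : mark_tail n = setT `&` (@pos_val R) @^-1` `[(n.+1%:R^-1)%R, +oo[%classic).
  exact: measurable_pos_val.
by apply/seteqP; split=> r /=; rewrite in_itv /= andbT; [|case].
Qed.

Let gmin (r : posR R) : R := Num.min (pos_val r) 1%R.

Let mgmin : measurable_fun setT gmin.
Proof.
apply: measurable_minr; first exact: measurable_pos_val.
exact: measurable_cst.
Qed.

Let gmin0 r : (0 <= gmin r)%R.
Proof. by rewrite le_min ler01 ltW // pos_val_gt0. Qed.

(** Markov's inequality: [min(r, 1)] is at least [1 / (n + 1)] on the tail, and its integral is
    finite. *)
Lemma nu_tail n : nu (mark_tail n) < +oo.
Proof.
have n0 : (0 < n.+1%:R^-1 :> R)%R by rewrite invr_gt0.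
have : (n.+1%:R^-1)%:E * nu (mark_tail n) <= \int[nu]_r (gmin r)%:E.
  rewrite -(setIT (mark_tail n)) -integral_indic //; last exact: measurable_mark_tail.
  rewrite -ge0_integralZl_EFin //; last first.
    by apply/measurable_EFinP/measurable_indic; exact: measurable_mark_tail.
  apply: ge0_le_integral => //.
  - by apply: measurable_funeM; apply/measurable_EFinP/measurable_indic; exact: measurable_mark_tail.
  - exact/measurable_EFinP.
  move=> r _; rewrite -EFinM lee_fin indicE; case: (boolP (r \in _)) => [/set_mem hr|_].
    by rewrite mulr1 le_min hr /= invf_le1 // ler1n.
  by rewrite mulr0.
move=> /le_lt_trans /(_ nu_levy) h; rewrite ltey; apply: contraTneq h => ->.
by rewrite gt0_muley ?lte_fin // ltxx.
Qed.

Definition base_cover : nat -> set Y := projT1 (cid2 (sigma_finiteT rho0)).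

Lemma base_coverT : \bigcup_k base_cover k = setT.
Proof. by rewrite /base_cover; case: cid2. Qed.

Lemma measurable_base_cover k : measurable (base_cover k).
Proof. by rewrite /base_cover; case: cid2 => F _ h /=; have [] := h k. Qed.

Lemma base_cover_fin k : rho0 (base_cover k) < +oo.
Proof. by rewrite /base_cover; case: cid2 => F _ h /=; have [] := h k. Qed.

(** Since [nu] may have infinite mass near 0, finite intensity is ensured by keeping the marks away
    from 0 as well as by a base set of finite measure. *)
Definition cover (j : nat) : set Z :=
  if @unpickle (nat * nat)%type j is Some km then base_cover km.1 `*` mark_tail km.2
  else set0.

Lemma measurable_cover j : measurable (cover j).
Proof.
rewrite /cover; case: unpickle => [[k m]|] //.
by apply: measurableX; [exact: measurable_base_cover|exact: measurable_mark_tail].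
Qed.

Lemma coverT : \bigcup_j cover j = setT.
Proof.
apply/seteqP; split=> // -[y r] _.
have : (\bigcup_k base_cover k) y by rewrite base_coverT.
move=> [k _ yk]; have [m rm] : exists m, (m.+1%:R^-1 < pos_val r)%R.
  have /= [m _ hm] := near_infty_natSinv_lt (PosNum (pos_val_gt0 r)).
  by exists m; apply: hm => /=.
exists (pickle (k, m)) => //; rewrite /cover pickleK; split=> //=.
exact: ltW.
Qed.

Lemma cover_fin j : lam (cover j) < +oo.
Proof.
rewrite /cover; case: unpickle => [[k m]|].
  rewrite intensity_rect; last exact: measurable_base_cover.
  by apply: lte_mul_pinfty => //=; rewrite ?ge0_fin_numE ?base_cover_fin ?nu_tail.
by rewrite (_ : lam set0 = 0) // /product_measure1 integral0_eq // => x _; rewrite /= xsection0.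
Qed.

Lemma eta_fin C : measurable C -> lam C < +oo -> {ae Pr, forall w, exists k, eta w C = (k%:R)%:E}.
Proof. by move=> mC fC; apply: (eta_fin_ae poi) => //; exact: intensity_ge0. Qed.

Lemma expectation_eta_le C : measurable C -> \int[Pr]_w eta w C <= lam C.
Proof.
move=> mC; have [fC|] := ltP (lam C) +oo; last by rewrite leye_eq => /eqP ->; rewrite leey.
by rewrite (expectation_eta_fin poi mC fC) // intensity_ge0.
Qed.

(** The masses decrease to 0 by continuity from above, starting from a finite value; being integers,
    they eventually equal 0. *)
Lemma eta_fin_tail w B : measurable B -> eta w (B `*` mark_tail 0) < +oo ->
  exists n : nat, eta w (B `*` [set r | (n%:R <= pos_val r)%R]) = 0.
Proof.
move=> mB fB; pose F n : set Z := B `*` [set r | (n.+1%:R <= pos_val r)%R].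
have mt n : measurable [set r : posR R | (n%:R <= pos_val r)%R].
  rewrite (_ : [set _ | _] = setT `&` (@pos_val R) @^-1` `[(n%:R)%R, +oo[%classic).
    exact: measurable_pos_val.
  by apply/seteqP; split=> r /=; rewrite in_itv /= andbT; [|case].
have mF n : measurable (F n) by exact: measurableX.
have F0 : F 0%N = B `*` mark_tail 0 by rewrite /F /mark_tail invr1.
have capF : \bigcap_n F n = set0.
  apply/seteqP; split=> // -[y r] h.
  have [n] := ltr_add_invr (ltr01 : (0 < 1 :> R)%R).
  have := h (Num.Def.trunc (pos_val r)) Logic.I; rewrite /F => -[_ /=].
  by rewrite leNgt truncnS_gt.
have := @nonincreasing_cvg_mu _ _ _ (eta w) F.
rewrite F0 capF measure0 => /(_ fB mF measurable0) h.
have /fine_cvgP[_ /cvgrPdist_lt /(_ _ ltr01) [n _ /(_ n (leqnn n)) /=]] :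
    (eta w \o F) x @[x --> \oo] --> 0%:E.
  apply: h => i j ij; apply/subsetPset => -[y r] [/= By hr]; split=> //=.
  by rewrite (le_trans _ hr) // ler_nat.
rewrite sub0r normrN => hn; exists n.+1.
have fn : eta w (F n) < +oo.
  apply: le_lt_trans fB; apply: le_measure; rewrite ?inE //; first by apply: measurableX => //; exact: measurable_mark_tail.
  by rewrite -F0 => -[y r] [/= By hr]; split=> //=; rewrite (le_trans _ hr) // ler_nat.
have [[k hk]|hk] := pp_nat pp w (mF n); last by rewrite hk ltxx in fn.
move: hn; rewrite -/(F n) hk /= ger0_norm // -[1%R]/(1%:R) ltr_nat ltnS leqn0.
by move=> /eqP ->.
Qed.

Local Notation xi := (compound_poisson eta).

Lemma compound_integral B w : xi B w = \int[eta w]_(z in B `*` setT) (pos_val z.2)%:E.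
Proof.
rewrite [RHS]integral_mkcond; apply: eq_integral => -[y r] _ /=.
rewrite /patch indicE; have -> : ((y, r) \in B `*` setT) = (y \in B) by rewrite in_setX in_setT andbT.
by case: ifP; rewrite ?mulr1 ?mulr0.
Qed.

Let mpos2 (D : set Z) : measurable_fun D (fun z : Z => (pos_val z.2)%:E).
Proof.
apply: measurable_funTS; apply/measurable_EFinP.
exact: (measurableT_comp (@measurable_pos_val R) measurable_snd).
Qed.

Lemma compound_ge0 B w : 0 <= xi B w.
Proof.
by apply: integral_ge0 => z _; rewrite lee_fin mulr_ge0 ?indicE // ltW // pos_val_gt0.
Qed.

Lemma compound_bigcup F w : (forall n, measurable (F n)) -> trivIset setT F ->
  xi (\bigcup_n F n) w = \sum_(n <oo) xi (F n) w.
Proof.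
move=> mF tF; rewrite compound_integral setX_bigcupl ge0_integral_bigcup //.
- by apply: eq_eseriesr => n _; rewrite compound_integral.
- by move=> n; exact: measurableX.
- by move=> z _; rewrite lee_fin ltW // pos_val_gt0.
- move=> i j _ _ [[y r] [[/= Fi _] [/= Fj _]]].
  exact: (tF i j Logic.I Logic.I (ex_intro _ y (conj Fi Fj))).
Qed.

Lemma compoundU A B w : measurable A -> measurable B -> [disjoint A & B] ->
  xi (A `|` B) w = xi A w + xi B w.
Proof.
move=> mA mB AB; rewrite !compound_integral.
have -> : (A `|` B) `*` setT = A `*` [set: posR R] `|` B `*` setT.
  by apply/seteqP; split=> [[y r] [/= [?|?] _]|[y r] [[/= ? _]|[/= ? _]]];
    [left|right|split=> //; left|split=> //; right].
rewrite ge0_integral_setU //.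
- exact: measurableX.
- exact: measurableX.
- by move=> z _; rewrite lee_fin ltW // pos_val_gt0.
- apply/disj_setPS => -[y r] [[/= Ay _] [/= By _]].
  by move/disj_setPS: AB => /(_ y); apply.
Qed.

Lemma compoundE B w : measurable B ->
  xi B w = marked (@measurable_pos_val R) (eta w) B.
Proof. by move=> mB; rewrite markedE // => r; rewrite ltW // pos_val_gt0. Qed.

Lemma measurable_compound B : measurable B -> measurable_fun setT (xi B).
Proof.
move=> mB; rewrite (_ : xi B = fun w => marked (@measurable_pos_val R) (eta w) B); last first.
  by apply/funext => w; exact: compoundE.
apply: (@measurable_marked R dY Y _ (@measurable_pos_val R) _ T (fun w C => eta w C) (fun=> B)).
by move=> A mA; apply: pp_measurable => //; exact: measurableX.
Qed.

(** The integral of [min(r, 1)] has finite expectation, hence is almost surely finite. The marks at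
    least 1 almost surely have finite total count, hence stay below some [n], and then
    [r <= (n + 1) * min(r, 1)] outside a set of [eta w]-measure 0. *)
Lemma compound_fin B : measurable B -> rho0 B < +oo -> {ae Pr, forall w, xi B w < +oo}.
Proof.
move=> mB fB.
pose I w := \int[eta w]_z (gmin z.2 * \1_B z.1)%:E.
have cI w := @cvg_marked_sum R dY Y gmin mgmin gmin0 (eta w) B mB.
have I0 w : 0 <= I w by apply: integral_ge0 => z _; rewrite lee_fin mulr_ge0 ?indicE.
have mms n : measurable_fun setT (fun w => marked_sum mgmin n (eta w) B).
  apply: emeasurable_sum => x; apply: measurable_funeM; apply: pp_measurable => //.
  by apply: measurableX => //; exact: measurable_mark_level.
have ms0 n w : 0 <= marked_sum mgmin n (eta w) B by exact: marked_sum_ge0.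
have IE : I = fun w => limn_einf (fun n => marked_sum mgmin n (eta w) B).
  by apply/funext => w; rewrite (cvg_limn_einf_sup (cI w)).1.
have mI : measurable_fun setT I.
  rewrite (_ : I = fun w => marked mgmin (eta w) B); last by apply/funext => w; rewrite markedE.
  apply: (@measurable_marked R dY Y _ mgmin _ T (fun w C => eta w C) (fun=> B)).
  by move=> A mA; apply: pp_measurable => //; exact: measurableX.
have EI : \int[Pr]_w I w < +oo.
  (* Expectation and integral against [eta w] are exchanged through the marked sums: these are
     finite sums of values of [eta], whose expectations are bounded by the intensity. *)
  rewrite IE; apply: (le_lt_trans (fatou Pr measurableT mms (fun n w _ => ms0 n w))).
  pose c := fine (rho0 B).
  have cE : rho0 B = c%:E by rewrite fineK // ge0_fin_numE.
  apply: (@le_lt_trans _ _ (c%:E * \int[nu]_r (gmin r)%:E)); last first.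
    by apply: lte_mul_pinfty => //; rewrite lee_fin fine_ge0.
  rewrite limn_einf_lim; apply: lime_le; first exact: is_cvg_einfs.
  near=> n; apply: (@le_trans _ _ (\int[Pr]_w marked_sum mgmin n (eta w) B)).
    by apply: ereal_inf_lbound; exists n => //=.
  have c0 : (0 <= c)%R by exact: fine_ge0.
  have lE A : measurable A -> lam (B `*` A) = c%:E * nu A.
    by move=> mA; rewrite intensity_rect // cE.
  apply: (le_trans _ (marked_sum_integral mgmin gmin0 n c0 lE)).
  rewrite (_ : \int[Pr]_w _ = \int[Pr]_w
      (\sum_(x <- mark_values mgmin n) (`|x|%R)%:E * eta w (B `*` mark_level mgmin n x))); last first.
    apply: eq_integral => w _; apply: eq_big_seq => x /mark_values_ge0 x0.
    by rewrite ger0_norm.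
  have mBl x : measurable (B `*` mark_level mgmin n x).
    by apply: measurableX => //; exact: measurable_mark_level.
  rewrite ge0_integral_sum //; last first.
    by move=> x; apply: measurable_funeM; exact: pp_measurable.
  rewrite /marked_sum big_seq [leRHS]big_seq; apply: lee_sum => x /mark_values_ge0 x0.
  rewrite ge0_integralZl //; last exact: pp_measurable.
  apply: lee_pmul => //; rewrite ?lee_fin //; first exact: integral_ge0.
    by rewrite ger0_norm.
  exact: expectation_eta_le.
have fI : {ae Pr, forall w, I w < +oo}.
  have : Pr.-integrable setT I.
    by apply/integrableP; split=> //; under eq_integral do rewrite gee0_abs //.
  move=> /(integrable_ae measurableT); apply: filterS => w /(_ Logic.I).
  by rewrite ge0_fin_numE.
have tail : {ae Pr, forall w, exists k, eta w (B `*` mark_tail 0) = (k%:R)%:E}.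
  apply: eta_fin; first by apply: measurableX => //; exact: measurable_mark_tail.
  rewrite intensity_rect //; apply: lte_mul_pinfty => //; last exact: nu_tail.
  by rewrite ge0_fin_numE.
apply: filterS2 fI tail => w Iw [k hk].
have [n hn] : exists n : nat, eta w (B `*` [set r | (n%:R <= pos_val r)%R]) = 0.
  by apply: eta_fin_tail => //; rewrite hk ltry.
apply: (@le_lt_trans _ _ (n.+1%:R%:E * I w)); last first.
  by apply: lte_mul_pinfty => //; rewrite lee_fin.
have mg2 : measurable_fun setT (fun z : Z => (gmin z.2 * \1_B z.1)%:E).
  apply/measurable_EFinP; apply: measurable_funM; last by apply: measurableT_comp.
  exact: (measurableT_comp mgmin measurable_snd).
have g2 (z : Z) : 0 <= (gmin z.2 * \1_B z.1)%:E by rewrite lee_fin mulr_ge0 ?indicE.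
rewrite /I -ge0_integralZl //.
apply: ae_ge0_le_integral => //.
- by move=> z _; rewrite lee_fin mulr_ge0 ?indicE // ltW // pos_val_gt0.
- apply/measurable_EFinP; apply: measurable_funM; last by apply: measurableT_comp.
  exact: (measurableT_comp (@measurable_pos_val R) measurable_snd).
- by move=> z _; apply: mule_ge0; [rewrite lee_fin|exact: g2].
- exact: (measurable_funeM _ mg2).
exists (B `*` [set r | (n%:R <= pos_val r)%R]); split=> //.
  apply: measurableX => //.
  rewrite (_ : [set _ | _] = setT `&` (@pos_val R) @^-1` `[(n%:R)%R, +oo[%classic).
    exact: measurable_pos_val.
  by apply/seteqP; split=> r /=; rewrite in_itv /= andbT; [|case].
move=> [y r] /= h; apply: contrapT => nBr; apply: h => _.
rewrite -EFinM lee_fin mulrA indicE; case: (boolP (y \in B)) => [/set_mem By|_]; last by rewrite !mulr0.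
rewrite !mulr1 /gmin.
have rn : (pos_val r < n%:R)%R by rewrite ltNge; apply/negP => ?; apply: nBr.
have r0 := pos_val_gt0 r.
have [r1|r1] := leP (pos_val r) 1%R.
  by apply: ler_peMl; [exact: ltW|rewrite ler1n].
by rewrite mulr1 (le_trans (ltW rn)) // ler_nat.
Unshelve. all: end_near. Qed.

End compound_poisson_process.

(** * Independence and invariance in law *)

Section law_transfer.
Context (R : realType) dS (S : measurableType dS).
Context d1 (T1 : measurableType d1) (P1 : {measure set T1 -> \bar R}).
Context d2 (T2 : measurableType d2) (P2 : {measure set T2 -> \bar R}).
Context (phi1 : T1 -> S) (phi2 : T2 -> S).
Hypotheses (m1 : measurable_fun setT phi1) (m2 : measurable_fun setT phi2).
Hypothesis law : forall A, measurable A -> P1 (phi1 @^-1` A) = P2 (phi2 @^-1` A).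
Local Open Scope ereal_scope.

Lemma ge0_law_integral (h : S -> \bar R) : measurable_fun setT h -> (forall x, 0 <= h x) ->
  \int[P1]_x h (phi1 x) = \int[P2]_x h (phi2 x).
Proof.
move=> mh h0.
have e1 := ge0_integral_pushforward m1 P1 measurableT mh (fun y _ => h0 y).
have e2 := ge0_integral_pushforward m2 P2 measurableT mh (fun y _ => h0 y).
rewrite !preimage_setT in e1 e2; rewrite -[LHS]e1 -[RHS]e2.
by apply: eq_measure_integral => A mA _; exact: law.
Qed.

Lemma law_integral (h : S -> \bar R) : measurable_fun setT h ->
  \int[P1]_x h (phi1 x) = \int[P2]_x h (phi2 x).
Proof.
move=> mh; rewrite (integralE P1 setT (h \o phi1)) (integralE P2 setT (h \o phi2)).
have hp := ge0_law_integral (measurable_funepos mh) (fun x => funepos_ge0 h x).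
have hn := ge0_law_integral (measurable_funeneg mh) (fun x => funeneg_ge0 h x).
have Ep U (phi : U -> S) : (h \o phi)^\+ = h^\+ \o phi by apply/funext => x; rewrite /= !funeposE.
have En U (phi : U -> S) : (h \o phi)^\- = h^\- \o phi by apply/funext => x; rewrite /= !funenegE.
by rewrite (Ep _ phi1) (Ep _ phi2) (En _ phi1) (En _ phi2) /= hp hn.
Qed.

End law_transfer.

Section independence.
Context (R : realType) d (T : measurableType d) (P : probability T R).
Context d1 (S1 : measurableType d1) d2 (S2 : measurableType d2).
Context (phi1 : T -> S1) (phi2 : T -> S2).
Hypotheses (m1 : measurable_fun setT phi1) (m2 : measurable_fun setT phi2).
Hypothesis indep : forall A B, measurable A -> measurable B ->
  P ((phi1 @^-1` A) `&` (phi2 @^-1` B)) = (P (phi1 @^-1` A) * P (phi2 @^-1` B))%E.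
Local Open Scope ereal_scope.

(** Rectangles are the hypothesis [indep] and the rest is Dynkin induction; integrals of products
    can then be computed on [T * T] by Fubini's theorem. *)
Let pair_law (X : set (S1 * S2)) : measurable X ->
  P ((fun x => (phi1 x, phi2 x)) @^-1` X) =
  (P \x P) ((fun x : T * T => (phi1 x.1, phi2 x.2)) @^-1` X).
Proof.
have mp1 : measurable_fun setT (fun x => (phi1 x, phi2 x)) by exact: measurable_fun_pair.
have mp2 : measurable_fun setT (fun x : T * T => (phi1 x.1, phi2 x.2)).
  by apply: measurable_fun_pair; exact: measurableT_comp.
rewrite measurable_prod_measurableType => XX; move: X XX.
apply: (@dynkin_induction _ (S1 * S2)%type).
- exact: measurable_prod_measurableType.
- move=> _ _ [A mA [B mB <-]] [A' mA' [B' mB' <-]].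
  exists (A `&` A'); first exact: measurableI.
  by exists (B `&` B'); [exact: measurableI|rewrite setXI].
- rewrite !preimage_setT; transitivity (1 : \bar R); [|symmetry]; exact: probability_setT.
- move=> _ [A mA [B mB <-]].
  have h := @product_measure1E _ _ _ _ _ P P _ _ (m1 measurableT mA) (m2 measurableT mB).
  rewrite !setTI in h; transitivity (P (phi1 @^-1` A) * P (phi2 @^-1` B)); first exact: indep.
  by rewrite -[LHS]h.
- move=> X mX eX.
  have h1 := probability_setC P (mp1 measurableT X mX).
  have h2 := probability_setC (P \x P) (mp2 measurableT X mX).
  rewrite !setTI in h1 h2.
  exact: (etrans h1 (etrans (congr1 (fun x => (1 - x)%E) eX) (esym h2))).
- move=> F mF tF eF; rewrite !preimage_bigcup.
  have tF' U (f : U -> S1 * S2) : trivIset setT (fun n => f @^-1` F n).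
    by move=> i j _ _ [x xij]; apply: tF => //; exists (f x).
  have M1 n := mp1 measurableT _ (mF n); have M2 n := mp2 measurableT _ (mF n).
  have S1' n := setTI ((fun x => (phi1 x, phi2 x)) @^-1` F n).
  have S2' n := setTI ((fun x : T * T => (phi1 x.1, phi2 x.2)) @^-1` F n).
  have h1 := @measure_semi_bigcup _ _ _ P _ (fun n => eq_ind _ measurable (M1 n) _ (S1' n)) (tF' _ _)
    (bigcup_measurable (fun n _ => eq_ind _ measurable (M1 n) _ (S1' n))).
  have h2 := @measure_semi_bigcup _ _ _ (P \x P) _ (fun n => eq_ind _ measurable (M2 n) _ (S2' n)) (tF' _ _)
    (bigcup_measurable (fun n _ => eq_ind _ measurable (M2 n) _ (S2' n))).
  by rewrite h1 h2; apply: eq_eseriesr => n _; exact: eF.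
Qed.

Let mp1 : measurable_fun setT (fun x => (phi1 x, phi2 x)).
Proof. exact: measurable_fun_pair. Qed.

Let mp2 : measurable_fun setT (fun x : T * T => (phi1 x.1, phi2 x.2)).
Proof. by apply: measurable_fun_pair; exact: measurableT_comp. Qed.

Lemma indep_ge0_integralM (f : S1 -> \bar R) (g : S2 -> \bar R) :
  measurable_fun setT f -> measurable_fun setT g ->
  (forall x, 0 <= f x) -> (forall x, 0 <= g x) ->
  \int[P]_x (f (phi1 x) * g (phi2 x)) = \int[P]_x f (phi1 x) * \int[P]_x g (phi2 x).
Proof.
move=> mf mg f0 g0.
pose h (z : S1 * S2) := f z.1 * g z.2.
have mh : measurable_fun setT h by apply: emeasurable_funM; exact: measurableT_comp.
rewrite (ge0_law_integral mp1 mp2 pair_law mh); last by move=> z; exact: mule_ge0.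
rewrite fubini_tonelli1 //; last 2 first.
- exact: (measurableT_comp mh mp2).
- by move=> z; exact: mule_ge0.
rewrite /fubini_F /h /=.
under eq_integral => x _.
  rewrite ge0_integralZl //; last exact: measurableT_comp.
  over.
rewrite ge0_integralZr //; first exact: measurableT_comp.
exact: integral_ge0.
Qed.

Lemma indep_RintegralM (f : S1 -> R) (g : S2 -> R) :
  measurable_fun setT f -> measurable_fun setT g ->
  P.-integrable setT (EFin \o f \o phi1) -> P.-integrable setT (EFin \o g \o phi2) ->
  (\int[P]_x (f (phi1 x) * g (phi2 x)) = \int[P]_x f (phi1 x) * \int[P]_x g (phi2 x))%R.
Proof.
move=> mf mg if_ ig.
pose h (z : S1 * S2) := (f z.1 * g z.2)%:E.
have mh : measurable_fun setT h.
  by apply/measurable_EFinP; apply: measurable_funM; exact: measurableT_comp.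
have ih : (P \x P).-integrable setT (fun x : T * T => h (phi1 x.1, phi2 x.2)).
  apply/integrableP; split; first exact: (measurableT_comp mh mp2).
  have mabs : measurable_fun setT (abse \o h) by exact: measurableT_comp.
  rewrite -(ge0_law_integral mp1 mp2 pair_law mabs); last by move=> z; exact: abse_ge0.
  rewrite /= /h; under eq_integral do rewrite normrM EFinM.
  rewrite (@indep_ge0_integralM (fun x => `|f x|%:E) (fun x => `|g x|%:E)) //.
  - have /integrableP[_ +] := if_; have /integrableP[_ +] := ig => hg hf.
    by apply: lte_mul_pinfty => //; [exact: integral_ge0|rewrite ge0_fin_numE //; exact: integral_ge0].
  - by apply/measurable_EFinP; exact: measurableT_comp.
  - by apply/measurable_EFinP; exact: measurableT_comp.
have fg : \int[P]_x (g (phi2 x))%:E \is a fin_num by exact: integrable_fin_num ig.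
have key : \int[P]_x h (phi1 x, phi2 x) =
    \int[P]_x ((f (phi1 x))%:E * (\int[P]_x g (phi2 x))%R%:E).
  rewrite (law_integral mp1 mp2 pair_law mh) -(integral12_prod_meas1 ih).
  apply: eq_integral => x _; rewrite /fubini_F /h /=.
  under eq_integral do rewrite EFinM.
  rewrite integralZl //; congr (_ * _).
  by rewrite /Rintegral fineK.
rewrite -(RintegralZr _ measurableT if_) /Rintegral; congr fine.
by rewrite -[LHS]/(\int[P]_x h (phi1 x, phi2 x)) key; apply: eq_integral.
Qed.

End independence.

(** Generators depend on one coordinate in [D], and this dependence survives complements and unions.
    It permits replacing xi by a functional of [eta] that is only known to agree with it on
    measurable sets. *)
Lemma cyl_determined (R : realType) (I : Type) (D : set I) (A : set (I -> \bar R)) :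
  <<s cyl R D>> A -> forall e e', (forall i, D i -> e i = e' i) -> A e -> A e'.
Proof.
move=> CA; suff : [set A : set (I -> \bar R) |
    forall e e', (forall i, D i -> e i = e' i) -> A e -> A e'] A by [].
move: A CA; apply: smallest_sub.
  split=> //=.
  - move=> A hA e e' ee' [_ nA]; split=> // /(hA e' e) h; apply: nA; apply: h.
    by move=> i Di; rewrite ee'.
  - by move=> F hF e e' ee' [n _ Fe]; exists n => //; apply: hF Fe.
by move=> _ [i Di [A mA <-]] e e' ee' /=; rewrite ee'.
Qed.

(** * Modification, invariance and independence of the Poisson process *)

Section poisson_laws.
Context (R : realType) dY (Y : measurableType dY).
Context (rho0 : {sigma_finite_measure set Y -> \bar R}).
Context (nu : {measure set (posR R) -> \bar R}).
Hypothesis nu_levy : (\int[nu]_r (Num.min (pos_val r) 1)%:E < +oo)%E.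
Context d (T : measurableType d) (Pr : probability T R).
Local Notation Z := (Y * posR R)%type.
Context (eta : T -> {measure set Z -> \bar R}).
Hypothesis poi : poisson_process Pr (rho0 \x nu)%E eta.
Local Notation lam := (rho0 \x nu)%E.
Local Open Scope ereal_scope.
Let pp := poisson_point_process poi.

Let cov := cover rho0.
Let mcov j : measurable (cov j) := measurable_cover rho0 (R := R) j.

Definition good_event : set T := \bigcap_j [set w | eta w (cov j) < +oo].

Lemma measurable_good : measurable good_event.
Proof.
apply: bigcap_measurableType => j _.
rewrite (_ : [set w | _] = ~` [set w | eta w (cov j) = +oo]).
  by apply: measurableC; exact: (measurable_eta_eq poi).
apply/seteqP; split=> w /=; first by move=> + h; rewrite h ltxx.
by move=> /eqP; rewrite lt_neqAle leey andbT.
Qed.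

Lemma good_ae : {ae Pr, forall w, good_event w}.
Proof.
have : {ae Pr, forall w, forall j, eta w (cov j) < +oo}.
  apply: ae_foralln => j.
  have := eta_fin poi (mcov j) (cover_fin rho0 nu_levy j).
  by apply: filterS => w [k ->]; rewrite ltry.
by apply: filterS => w h j _; exact: h.
Qed.

(* Almost surely equal to eta, and finite on every set of the cover for every w. *)
Definition eta0 (w : T) : {measure set Z -> \bar R} :=
  if w \in good_event then eta w else mzero.

Lemma eta0E w C : eta0 w C = if w \in good_event then eta w C else 0.
Proof. by rewrite /eta0; case: ifP. Qed.

Lemma eta0_ae : {ae Pr, forall w, eta0 w = eta w}.
Proof. by apply: filterS good_ae => w gw; rewrite /eta0 ifT //; exact/mem_set. Qed.

Lemma measurable_eta0 C : measurable C -> measurable_fun setT (fun w => eta0 w C).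
Proof.
move=> mC; under eq_fun do rewrite eta0E.
apply: measurable_fun_ifT => //; last exact: pp_measurable.
apply: (measurable_fun_bool true); rewrite setTI.
rewrite (_ : _ @^-1` _ = good_event); first exact: measurable_good.
by apply/seteqP; split=> w /=; [exact: set_mem|exact: mem_set].
Qed.

(** In the Dynkin argument the complement of a set is handled by subtraction, which uses a finite
    measure for every [w]; hence [eta0] in place of [eta], and the cutting along the disjoint pieces
    [V j] of the cover. *)
Lemma measurable_eta0_section dM (M : measurableType dM) (D : set (M * Z)) :
  measurable D -> measurable_fun setT (fun x : M * T => eta0 x.2 (xsection D x.1)).
Proof.
move=> mD; pose V := seqDU cov.
have mV j : measurable (V j).
  by apply: measurableD => //; exact: bigsetU_measurable.
have VT : \bigcup_j V j = setT by rewrite -seqDU_bigcup_eq; exact: coverT.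
have fV w j : eta0 w (V j) < +oo.
  rewrite eta0E; case: ifPn => // /set_mem gw.
  by apply: le_lt_trans (gw j Logic.I); apply: le_measure; rewrite ?inE //; exact: subDsetl.
have mxs (D' : set (M * Z)) (x : M) : measurable D' -> measurable (xsection D' x :> set Z) by exact: measurable_xsection.
have -> : (fun x : M * T => eta0 x.2 (xsection D x.1)) =
    fun x => \sum_(j <oo) eta0 x.2 (xsection D x.1 `&` V j).
  apply/funext => -[a w] /=.
  rewrite -[in LHS](setIT (xsection D a)) -VT setI_bigcupr.
  apply: measure_semi_bigcup.
  - by move=> j; apply: measurableI => //; exact: mxs.
  - exact/trivIset_setIl/trivIset_seqDU.
  - by apply: bigcup_measurable => j _; apply: measurableI => //; exact: mxs.
apply: ge0_emeasurable_sum => // j _.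
pose Q (D : set (M * Z)) := measurable_fun setT (fun x : M * T => eta0 x.2 (xsection D x.1 `&` V j)).
have m2 C : measurable C -> measurable_fun setT (fun x : M * T => eta0 x.2 C).
  by move=> mC; exact: (measurableT_comp (measurable_eta0 mC) measurable_snd).
move: (mD); rewrite [X in X D -> _]measurable_prod_measurableType; move: D {mD}.
apply: (@dynkin_induction _ (M * Z)%type _ Q).
- exact: measurable_prod_measurableType.
- move=> _ _ [A mA [B mB <-]] [A' mA' [B' mB' <-]].
  exists (A `&` A'); first exact: measurableI.
  by exists (B `&` B'); [exact: measurableI|rewrite setXI].
- rewrite /Q (_ : (fun x : M * T => _) = fun x => eta0 x.2 (V j)); first exact: m2.
  by apply/funext => x; rewrite (_ : xsection _ _ = setT) ?setTI // /xsection;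
     apply/seteqP; split=> // z _ /=; rewrite in_setT.
- move=> _ [A mA [B mB <-]]; rewrite /Q.
  rewrite (_ : (fun x : M * T => _) = fun x => (\1_A x.1)%:E * eta0 x.2 (B `&` V j)).
    apply: emeasurable_funM; last by apply: m2; exact: measurableI.
    by apply/measurable_EFinP; apply: measurableT_comp.
  apply/funext => x; rewrite indicE; have [xA|xA] /= := boolP (x.1 \in A).
    by rewrite in_xsectionX // mul1e.
  by rewrite notin_xsectionX // set0I measure0 mul0e.
- move=> S mS QS; rewrite /Q.
  rewrite (_ : (fun x : M * T => _) = fun x => eta0 x.2 (V j) - eta0 x.2 (xsection S x.1 `&` V j)).
    by apply: emeasurable_funB => //; exact: m2.
  apply/funext => x; rewrite [X in _ - eta0 _ X]setIC -(measureD (mV j) (mxs _ _ mS) (fV _ _)).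
  congr (eta0 _ _); rewrite setDE setIC; congr (_ `&` _).
  by apply/seteqP; split=> z; [move=> /xsectionP h /xsectionP|move=> h; apply/xsectionP => h'; apply: h; apply/xsectionP].
- move=> F mF tF QF; rewrite /Q.
  rewrite (_ : (fun x : M * T => _) = fun x => \sum_(n <oo) eta0 x.2 (xsection (F n) x.1 `&` V j)).
    by apply: ge0_emeasurable_sum => // n _; exact: QF.
  apply/funext => x; rewrite xsection_bigcup setI_bigcupl.
  apply: measure_semi_bigcup.
  - by move=> n; apply: measurableI => //; exact: mxs.
  - by apply: trivIset_setIr; exact: trivIset_xsection.
  - by apply: bigcup_measurable => n _; apply: measurableI => //; exact: mxs.
Qed.

Lemma measurable_marked_section dM (M : measurableType dM) (D : set (M * Y)) :
  measurable D -> measurable_fun setT (fun x : M * T =>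
    marked (@measurable_pos_val R) (eta0 x.2) (xsection D x.1)).
Proof.
move=> mD; apply: (@measurable_marked R dY Y _ (@measurable_pos_val R) _ (M * T)%type
  (fun x C => eta0 x.2 C) (fun x => xsection D x.1)) => A mA.
pose D' : set (M * Z) := [set x | D (x.1, x.2.1) /\ A x.2.2].
have mD' : measurable D'.
  rewrite (_ : D' = ((fun x : M * Z => (x.1, x.2.1)) @^-1` D) `&` ((fun x : M * Z => x.2.2) @^-1` A)).
    apply: measurableI; rewrite -[X in measurable X]setTI.
      have m : measurable_fun setT (fun x : M * Z => (x.1, x.2.1)).
        by apply: measurable_fun_pair => //; exact: (measurableT_comp measurable_fst measurable_snd).
      exact: m.
    exact: (measurableT_comp measurable_snd measurable_snd).
  by [].
rewrite (_ : (fun x : M * T => _) = fun x => eta0 x.2 (xsection D' x.1)).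
  exact: measurable_eta0_section.
apply/funext => x; congr (eta0 _ _); apply/seteqP; split=> -[y r].
  by move=> [/= /xsectionP yD Ar]; apply/xsectionP.
by move=> /xsectionP[/= yD Ar]; split=> //=; apply/xsectionP.
Qed.

Let eta_additive w : fin_additive measurable (eta w).
Proof.
move=> J D A mD tD mA ->; rewrite (@measure_fin_bigcup _ _ _ (eta w) J setT D) //; last exact: finite_finset.
have -> : [set: J] = [set` enum J] by apply/seteqP; split=> // j _ /=; rewrite mem_enum.
by rewrite -fsbig_seq ?enum_uniq // big_enum; apply: eq_bigl.
Qed.

(** For finite intensity the law is given by the Poisson weights. For infinite intensity both values
    are almost surely [+oo], so each probability is the indicator of [A] at [+oo]. *)
Lemma eta_law_eq B B' : measurable B -> measurable B' -> lam B = lam B' ->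
  forall A, measurable A -> Pr [set w | A (eta w B)] = Pr [set w | A (eta w B')].
Proof.
move=> mB mB' BB' A mA; have [fB|] := ltP (lam B) +oo.
  rewrite (eta_finite_law poi mB fB (intensity_ge0 _ _ _)) //.
  by rewrite (eta_finite_law poi mB' _ (intensity_ge0 _ _ _)) -?BB'.
rewrite leye_eq => /eqP lB.
have H C : measurable C -> lam C = +oo -> Pr [set w | A (eta w C)] = (\1_A +oo%E)%:E.
  move=> mC lC; have h := poisson_infty poi mC lC.
  have mS : measurable [set w | A (eta w C)].
    by rewrite -[X in measurable X]setTI; exact: (pp_measurable pp mC).
  have mI : measurable [set w | eta w C = +oo] by exact: (measurable_eta_eq poi).
  rewrite indicE; case: (boolP (_ \in A)) => [/set_mem A1|/negP A1].
    apply/eqP; rewrite eq_le; apply/andP; split; first exact: probability_le1.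
    by rewrite -h; apply: le_measure; rewrite ?inE // => w /= ->.
  have /eqP : Pr (~` [set w | eta w C = +oo]) = 0.
    by have hC := probability_setC Pr mI; rewrite hC h subee.
  rewrite -measure_le0 => N0; apply/eqP; rewrite eq_le measure_ge0 andbT.
  apply: le_trans N0; apply: le_measure; rewrite ?inE //; first exact: measurableC.
  by move=> w /= Aw ew; apply: A1; apply/mem_set; rewrite -ew.
by rewrite !H // -BB'.
Qed.

Lemma eta_joint_law n (D : 'I_n -> set Z) (A : 'I_n -> set (\bar R)) :
  (forall k, measurable (D k)) -> trivIset setT D -> (forall k, measurable (A k)) ->
  Pr [set w | forall k, A k (eta w (D k))] = \prod_(k < n) Pr [set w | A k (eta w (D k))].
Proof.
move=> mD tD mA; rewrite -(poisson_independent poi mD tD mA); congr (Pr _).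
by apply/seteqP; split=> w h k; [move=> _; exact: h|exact: (h k Logic.I)].
Qed.

(* The process is carried to one with the same intensity, hence the same law. *)
Lemma eta_image_law (tau : set Z -> set Z) :
  (forall C, measurable C -> measurable (tau C)) ->
  (forall C, measurable C -> lam (tau C) = lam C) ->
  tau set0 = set0 -> (forall A B, tau (A `&` B) = tau A `&` tau B) ->
  (forall (J : finType) (F : J -> set Z), tau (\bigcup_j F j) = \bigcup_j tau (F j)) ->
  forall S, <<s cyl R (@measurable _ Z)>> S ->
  Pr ((fun w C => eta w C) @^-1` S) = Pr ((fun w C => eta w (tau C)) @^-1` S).
Proof.
move=> mtau ltau tau0 tauI tauU.
have ttau (J : Type) (F : J -> set Z) : trivIset setT F -> trivIset setT (tau \o F).
  move=> tF i j _ _ [z [zi zj]]; have : tau (F i `&` F j) z by rewrite tauI.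
  case: (pselect (exists x, (F i `&` F j) x)) => [[x xij] _|nx]; first by apply: tF => //; exists x.
  by rewrite (_ : F i `&` F j = set0) ?tau0 //; apply/seteqP; split=> // x xij; case: nx; exists x.
apply: (@additive_law_eq R _ Z _ T Pr _ T Pr measurable (fun w C => eta w C) (fun w C => eta w (tau C))) => //.
- by move=> A B; exact: measurableI.
- move=> w J D A mD tD mA AE; move: (mA); rewrite AE /= => mB. rewrite tauU.
  apply: (@eta_additive w J (tau \o D)) => //; first by move=> j; exact: mtau.
    exact: ttau.
  by rewrite -tauU; exact: mtau.
- by move=> A mA; exact: pp_measurable.
- by move=> A mA; apply: (pp_measurable pp); exact: mtau.
move=> n D A mD tD mA; rewrite eta_joint_law //.
have h := @eta_joint_law n (tau \o D) A (fun k => mtau _ (mD k)) (ttau _ _ tD) mA.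
rewrite [RHS]h; apply: eq_bigr => k _ /=; apply: eta_law_eq => //; first exact: mtau.
by rewrite ltau.
Qed.

Definition base_sets (B : set Y) : set (set Y) := [set C | measurable C /\ C `<=` B].

Local Notation xi := (fun w B => compound_poisson eta B w).

(** [eta] is compared with [th], which follows one copy of the process inside [Z1] and an
    independent copy inside [Z2]. Both have the same law on the class [CC] of sets contained in one
    of the regions, and under [Pr \x Pr] the two events become the sides of a rectangle. *)
Lemma compound_indep (B1 B2 : set Y) : measurable B1 -> measurable B2 -> B1 `&` B2 = set0 ->
  forall A1 A2, <<s cyl R (base_sets B1)>> A1 -> <<s cyl R (base_sets B2)>> A2 ->
  Pr ((xi @^-1` A1) `&` (xi @^-1` A2)) = Pr (xi @^-1` A1) * Pr (xi @^-1` A2).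
Proof.
move=> mB1 mB2 B12 A1 A2 mA1 mA2.
pose Z1 : set Z := B1 `*` setT; pose Z2 : set Z := B2 `*` setT.
have Z12 C : C `<=` Z1 -> C `&` Z2 = set0.
  move=> CZ; apply/seteqP; split=> // -[y r] [/CZ [/= y1 _] [/= y2 _]].
  by have : (B1 `&` B2) y by []; rewrite B12.
have Z21 C : C `<=` Z2 -> C `&` Z1 = set0.
  move=> CZ; apply/seteqP; split=> // -[y r] [/CZ [/= y1 _] [/= y2 _]].
  by have : (B1 `&` B2) y by []; rewrite B12.
have mZ1 : measurable Z1 by exact: measurableX.
have mZ2 : measurable Z2 by exact: measurableX.
pose CC := [set C : set Z | measurable C /\ (C `<=` Z1 \/ C `<=` Z2)].
pose th (w : T * T) (C : set Z) := eta w.1 (C `&` Z1) + eta w.2 (C `&` Z2).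
have th1 w C : C `<=` Z1 -> th w C = eta w.1 C.
  by move=> CZ; rewrite /th Z12 // measure0 adde0 (setIidl CZ).
have th2 w C : C `<=` Z2 -> th w C = eta w.2 C.
  by move=> CZ; rewrite /th Z21 // measure0 add0e (setIidl CZ).
have mth (C : set Z) : measurable C -> measurable_fun setT (th ^~ C).
  move=> mC; apply: emeasurable_funD.
    exact: (measurableT_comp (pp_measurable pp (measurableI _ _ mC mZ1)) measurable_fst).
  exact: (measurableT_comp (pp_measurable pp (measurableI _ _ mC mZ2)) measurable_snd).
have law S : <<s cyl R CC>> S -> Pr ((fun w C => eta w C) @^-1` S) = (Pr \x Pr) (th @^-1` S).
  apply: (@additive_law_eq R _ Z _ T Pr _ (T * T)%type (Pr \x Pr) CC (fun w C => eta w C) th).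
  - by split=> //; left.
  - by move=> C [].
  - move=> A B [mA AZ] mB; split; first exact: measurableI.
    by case: AZ => AZ; [left|right] => z [/AZ].
  - by move=> w J D A CD tD [mA _]; apply: eta_additive => // j; case: (CD j).
  - move=> w J D A CD tD [mA _] AE; rewrite /th.
    have mDj j : measurable (D j) by case: (CD j).
    rewrite (@eta_additive w.1 J (fun j => D j `&` Z1)) //; last 4 first.
    + by move=> j; exact: measurableI.
    + exact: trivIset_setIr.
    + exact: measurableI.
    + by rewrite AE setI_bigcupl.
    rewrite (@eta_additive w.2 J (fun j => D j `&` Z2)) //; last 4 first.
    + by move=> j; exact: measurableI.
    + exact: trivIset_setIr.
    + exact: measurableI.
    + by rewrite AE setI_bigcupl.
    by rewrite big_split.
  - by move=> A [mA _]; exact: pp_measurable.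
  - by move=> A [mA _]; exact: mth.
  move=> n D A CD tD mA.
  have mDk k : measurable (D k) by case: (CD k).
  pose I1 := [pred k | `[< D k `<=` Z1 >]].
  (* Each set lies in one region, so its condition is assigned to one factor and replaced by [setT]
     in the other; the sides of the resulting rectangle are computed by [eta_joint_law]. *)
  have E : [set w | forall k, A k (th w (D k))] =
    [set w | forall k, (if I1 k then A k else setT) (eta w (D k))] `*`
    [set w | forall k, (if I1 k then setT else A k) (eta w (D k))].
    apply/seteqP; split=> [[w1 w2] h|[w1 w2] [/= h1 h2] k].
      split=> k /=; have := h k; rewrite /I1 /=; case: ifPn => // /asboolP kZ.
        by rewrite th1.
      by have [_ [//|k2]] := CD k; rewrite th2.
    have := h1 k; have := h2 k; rewrite /I1 /=; case: ifPn => /asboolP kZ.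
      by rewrite th1.
    by have [_ [//|k2]] := CD k; rewrite th2.
  have mA1' k : measurable (if I1 k then A k else setT) by case: ifP.
  have mA2' k : measurable (if I1 k then setT else A k) by case: ifP.
  have mS (A' : 'I_n -> set (\bar R)) : (forall k, measurable (A' k)) ->
      measurable [set w | forall k, A' k (eta w (D k))].
    move=> mA'; rewrite (_ : mkset _ = \bigcap_(k in [set: 'I_n]) [set w | A' k (eta w (D k))]).
      apply: fin_bigcap_measurable => // k _; rewrite -[X in measurable X]setTI.
      exact: (pp_measurable pp).
    by apply/seteqP; split=> w h k; [move=> _; exact: h|exact: (h k Logic.I)].
  rewrite E; have pm := @product_measure1E _ _ _ _ _ Pr Pr _ _ (mS _ mA1') (mS _ mA2').
  have e1 := eta_joint_law mDk tD mA1'; have e2 := eta_joint_law mDk tD mA2'.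
  rewrite [RHS]pm eta_joint_law //.
  apply: etrans (congr2 *%E (esym e1) (esym e2)).
  rewrite -big_split /=; apply: eq_bigr => k _.
  have PT : Pr [set w | setT (eta w (D k))] = 1.
    by rewrite (_ : mkset _ = setT); [exact: probability_setT|apply/seteqP].
  by case: ifP => _; rewrite PT ?mule1 ?mul1e.
(* xi as a functional of the values of a set function on rectangles: this carries the equality of
   laws of [eta] and [th] over to events about xi. *)
pose kap (e : set Z -> \bar R) (B : set Y) := marked (@measurable_pos_val R) e B.
have xiE w B : measurable B -> xi w B = kap (fun C => eta w C) B by exact: compoundE.
have mkap (B : set Y) (i : bool) : base_sets (if i then B1 else B2) B ->
    measurable_fun setT (fun e : cylType R CC => kap e B).
  move=> [mB BB]; apply: (@measurable_marked R dY Y _ (@measurable_pos_val R) _ (cylType R CC) (fun e => e) (fun=> B)).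
  move=> A mA; apply: measurable_cyl_eval; split; first exact: measurableX.
  by case: i BB => BB; [left|right] => -[y r] [/= /BB].
have mk1 : measurable_fun setT (kap : cylType R CC -> cylType R (base_sets B1)).
  by apply: measurable_to_cyl => B bB; exact: (mkap B true).
have mk2 : measurable_fun setT (kap : cylType R CC -> cylType R (base_sets B2)).
  by apply: measurable_to_cyl => B bB; exact: (mkap B false).
pose S := kap @^-1` A1 `&` kap @^-1` A2.
have mS : <<s cyl R CC>> S.
  apply: (@measurableI _ (cylType R CC)); rewrite -[X in measurable X]setTI;
    [exact: (mk1 measurableT A1)|exact: (mk2 measurableT A2)].
have det (i : bool) A : <<s cyl R (base_sets (if i then B1 else B2))>> A ->
    forall e e', (forall B, base_sets (if i then B1 else B2) B -> e B = e' B) -> A e <-> A e'.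
  by move=> mA e e' ee'; split; apply: (cyl_determined mA) => B bB; rewrite ee'.
have mkE (e e' : set Z -> \bar R) (B : set Y) : (forall A, e (B `*` A) = e' (B `*` A)) -> kap e B = kap e' B.
  by move=> ee'; congr limn_esup; apply/funext => n; apply: eq_bigr => x _; rewrite ee'.
have S1 : (fun w C => eta w C) @^-1` S = (xi @^-1` A1) `&` (xi @^-1` A2).
  have k1 w : A1 (kap (fun C => eta w C)) <-> A1 (xi w).
    by apply: (det true _ mA1) => B [mB _]; rewrite xiE.
  have k2 w : A2 (kap (fun C => eta w C)) <-> A2 (xi w).
    by apply: (det false _ mA2) => B [mB _]; rewrite xiE.
  by apply/seteqP; split=> w [h1 h2]; split; [exact/k1|exact/k2|exact/k1|exact/k2].
have S2 : th @^-1` S = (xi @^-1` A1) `*` (xi @^-1` A2).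
  have k1 w : A1 (kap (th w)) <-> A1 (xi w.1).
    apply: (det true _ mA1) => B [mB BB]; rewrite xiE //; apply: mkE => A.
    by rewrite th1 // => -[y r] [/= /BB].
  have k2 w : A2 (kap (th w)) <-> A2 (xi w.2).
    apply: (det false _ mA2) => B [mB BB]; rewrite xiE //; apply: mkE => A.
    by rewrite th2 // => -[y r] [/= /BB].
  by apply/seteqP; split=> w [h1 h2]; split; [exact/k1|exact/k2|exact/k1|exact/k2].
have mxi (B0 : set Y) A : <<s cyl R (base_sets B0)>> A -> measurable (xi @^-1` A).
  move=> mA; have h : measurable_fun setT (xi : T -> cylType R (base_sets B0)).
    by apply: measurable_to_cyl => B [mB _]; exact: (measurable_compound poi).
  by rewrite -[X in measurable X]setTI; exact: h.
have pm := @product_measure1E _ _ _ _ _ Pr Pr _ _ (mxi _ _ mA1) (mxi _ _ mA2).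
by rewrite -S1 law // S2 -[RHS]pm.
Qed.

End poisson_laws.

(** * Koopman operators *)

Section L2_multiplication.
Context d (T : measurableType d) (R : realType) (P : probability T R).
Local Notation toL2 := (toL2 P).
Local Notation L2p := (L2pred P).

(* L2mul u v is 0 when the product is not square integrable. *)
Definition L2mulable (u v : L2 P) :=
  (fun x => (repr u : L2fun P) x * (repr v : L2fun P) x) \in L2p.

Lemma L2mulableE f g : f \in L2p -> g \in L2p ->
  L2mulable (toL2 f) (toL2 g) <-> (fun x => f x * g x) \in L2p.
Proof.
move=> fL gL; have E : {ae P, forall x, (repr (toL2 f) : L2fun P) x * (repr (toL2 g) : L2fun P) x = f x * g x}.
  by apply: filterS2 (toL2_ae fL) (toL2_ae gL) => x -> ->.
rewrite /L2mulable; split=> h.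
  by apply: (L2pred_ae h _ E); apply: measurable_cmul; [exact: (L2pred_cmeas fL)|exact: (L2pred_cmeas gL)].
apply: (L2pred_ae h); last by apply: filterS E => x ->.
by apply: measurable_cmul; apply: L2pred_cmeas; exact: L2fun_pred.
Qed.

(** Both bracketings have the same pointwise representative; square integrability assumed for one of
    them gives it for the other, so no product falls back to 0. *)
Lemma L2mulA u v w : L2mulable u v -> L2mulable v w -> L2mulable u (L2mul v w) ->
  L2mul u (L2mul v w) = L2mul (L2mul u v) w /\ L2mulable (L2mul u v) w.
Proof.
elim/toL2W: u => f fL; elim/toL2W: v => g gL; elim/toL2W: w => h hL.
move=> /(L2mulableE fL gL) fg /(L2mulableE gL hL) gh.
rewrite (L2mul_toL2 gL hL gh) (L2mul_toL2 fL gL fg) => /(L2mulableE fL gh) fgh.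
have E : (fun x => f x * g x * h x) = (fun x => f x * (g x * h x)).
  by apply/funext => x; rewrite mulrA.
have fgh' : (fun x => f x * g x * h x) \in L2p by rewrite E.
split; first by rewrite (L2mul_toL2 fL gh fgh) (L2mul_toL2 fg hL fgh') E.
exact/(L2mulableE fg hL).
Qed.

End L2_multiplication.

Section koopman.
Context (R : realType) d (T : measurableType d) (P : probability T R).
Context dS (S : measurableType dS) (phi : T -> S) (mphi : measurable_fun setT phi).
Local Notation toL2 := (toL2 P).
Local Notation L2p := (L2pred P).
Local Notation dot := (L2dot P).

(** The transformation acts on the space [S] of values of [phi], not on [T], and only the law of
    [phi] is asked to be invariant. *)
Definition preserves_law (s : S -> S) := measurable_fun setT s /\
  forall A, measurable A -> P (phi @^-1` A) = P ((s \o phi) @^-1` A).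

Section fixed.
Context (s : S -> S) (ps : preserves_law s).
Let ms : measurable_fun setT (s \o phi). Proof. exact: measurableT_comp ps.1 mphi. Qed.

Lemma law_rL2 (F : S -> R) : measurable_fun setT F -> rL2 P (F \o phi) -> rL2 P (F \o (s \o phi)).
Proof.
move=> mF [_ h]; split; first exact: measurableT_comp.
have m2 : measurable_fun setT (fun x => (F x ^+ 2)%:E).
  by apply/measurable_EFinP; exact: measurable_funX.
rewrite -(ge0_law_integral mphi ms ps.2 m2) // => x.
by rewrite lee_fin sqr_ge0.
Qed.

Lemma law_L2pred (F : S -> R[i]) : cmeasurable measurable F -> F \o phi \in L2p ->
  F \o (s \o phi) \in L2p.
Proof.
move=> /cmeasurable_funP[m1 m2] /L2predP[r1 r2]; apply/L2predP.
by split; [exact: (law_rL2 m1)|exact: (law_rL2 m2)].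
Qed.

Lemma law_Rintegral (F : S -> R) : measurable_fun setT F ->
  (\int[P]_x F (s (phi x)) = \int[P]_x F (phi x))%R.
Proof.
move=> mF; rewrite /Rintegral; congr fine; symmetry.
exact: (law_integral mphi ms ps.2 (h := EFin \o F) (measurableT_comp _ mF)).
Qed.

(** Sets that are null for the law of [phi] are null for that of [s \o phi]; therefore composing
    with [s] respects almost sure equality of functions of [phi]. *)
Lemma law_ae (A : set S) : measurable A -> {ae P, forall x, A (phi x)} ->
  {ae P, forall x, A (s (phi x))}.
Proof.
move=> mA [N [mN N0 sub]].
have mnA : measurable (~` A) by exact: measurableC.
exists ((s \o phi) @^-1` (~` A)); split=> //.
  by rewrite -[X in measurable X]setTI; exact: ms.
apply/eqP; rewrite -(ps.2 _ mnA) eq_le measure_ge0 andbT -N0.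
apply: le_measure; rewrite ?inE //.
by rewrite -[X in measurable X]setTI; exact: mphi.
Qed.

Lemma measurable_ceq (F G : S -> R[i]) : cmeasurable measurable F -> cmeasurable measurable G ->
  measurable [set x | F x = G x].
Proof.
move=> /cmeasurable_funP[F1 F2] /cmeasurable_funP[G1 G2].
rewrite (_ : mkset _ =
  (setT `&` (fun x => complex.Re (F x) - complex.Re (G x)) @^-1` [set 0]) `&`
  (setT `&` (fun x => complex.Im (F x) - complex.Im (G x)) @^-1` [set 0])).
  by apply: measurableI; apply: measurable_funB.
apply/seteqP; split=> x /=; first by move=> ->; rewrite !subrr.
by move=> [[_ /subr0_eq h1] [_ /subr0_eq h2]]; exact: complex_ext.
Qed.

Hypothesis rep : forall u : L2 P, exists F : S -> R[i],
  [/\ cmeasurable measurable F, F \o phi \in L2p & u = toL2 (F \o phi)].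

(** The factorisation picked by [cid] is arbitrary; [koopE] shows that any other one gives the same
    class. *)
Definition koop (u : L2 P) : L2 P := toL2 (projT1 (cid (rep u)) \o (s \o phi)).

Lemma koopE F : cmeasurable measurable F -> F \o phi \in L2p ->
  koop (toL2 (F \o phi)) = toL2 (F \o (s \o phi)).
Proof.
move=> mF LF; rewrite /koop; case: cid => G [mG LG] /= /(toL2_eqP LF LG) FG.
apply/toL2_eqP; [exact: law_L2pred|exact: law_L2pred|].
apply: (law_ae (measurable_ceq mG mF)); by apply: filterS FG => x /= ->.
Qed.

Lemma koop_lin c u v : koop (c *: u + v) = c *: koop u + koop v.
Proof.
have [F [mF LF ->]] := rep u; have [G [mG LG ->]] := rep v.
have E : c *: (F \o phi) + (G \o phi) = (c *: F + G) \o phi by [].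
have mE : cmeasurable measurable (c *: F + G).
  rewrite (_ : measurable = <<s @measurable _ S>>); last first.
    by rewrite sigma_algebra_id //; exact: sigma_algebra_measurable.
  by apply: (@cmeasurable_lin S); rewrite sigma_algebra_id //; exact: sigma_algebra_measurable.
rewrite -toL2_linE // E koopE //; last by rewrite -E; exact: toL2_lin.
rewrite !koopE // -toL2_linE //; exact: law_L2pred.
Qed.

Lemma koop_dot u v : dot (koop u) (koop v) = dot u v.
Proof.
have [F [mF LF ->]] := rep u; have [G [mG LG ->]] := rep v.
rewrite (koopE mF LF) (koopE mG LG) (L2dotE LF LG) (L2dotE (law_L2pred mF LF) (law_L2pred mG LG)).
have /cmeasurable_funP[m1 m2] := measurable_cmul (measurable_conjc mF) mG.
congr (_ +i* _)%C; [exact: (law_Rintegral m1)|exact: (law_Rintegral m2)].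
Qed.

Lemma koop_mul u v : L2mulable u v ->
  koop (L2mul u v) = L2mul (koop u) (koop v) /\ L2mulable (koop u) (koop v).
Proof.
have [F [mF LF ->]] := rep u; have [G [mG LG ->]] := rep v.
move=> /(L2mulableE LF LG) FG; rewrite (L2mul_toL2 LF LG FG).
have mFG := measurable_cmul mF mG.
have LFG : (fun x => (F \o (s \o phi)) x * (G \o (s \o phi)) x) \in L2p by exact: (law_L2pred mFG).
have LF' := law_L2pred mF LF; have LG' := law_L2pred mG LG.
rewrite (koopE mFG FG) (koopE mF LF) (koopE mG LG) (L2mul_toL2 LF' LG' LFG).
by split=> //; apply/(L2mulableE LF' LG').
Qed.

End fixed.

Hypothesis rep : forall u : L2 P, exists F : S -> R[i],
  [/\ cmeasurable measurable F, F \o phi \in L2p & u = toL2 (F \o phi)].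

(** Composition operators are contravariant: the map [s'] of the inner operator is applied after
    [s]. *)
Lemma koop_comp (s s' t : S -> S) : preserves_law s -> preserves_law s' -> preserves_law t ->
  (forall e, s' (s e) = t e) -> forall u, koop s rep (koop s' rep u) = koop t rep u.
Proof.
move=> ps ps' pt sst u; have [F [mF LF ->]] := rep u.
rewrite (koopE ps' rep) // (koopE pt rep) //.
have mFs : cmeasurable measurable (F \o s').
  have /cmeasurable_funP[m1 m2] := mF; apply/cmeasurable_funP.
  by split; [exact: (measurableT_comp m1 ps'.1)|exact: (measurableT_comp m2 ps'.1)].
rewrite (koopE ps rep mFs); last exact: (law_L2pred ps').
by congr (Defs.toL2 _ _); apply/funext => x /=; rewrite sst.
Qed.

Lemma koop_id (s : S -> S) : preserves_law s -> (forall e, s e = e) -> forall u, koop s rep u = u.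
Proof.
move=> ps se u; have [F [mF LF ->]] := rep u; rewrite koopE //.
by congr (Defs.toL2 _ _); apply/funext => x /=; rewrite se.
Qed.

End koopman.

(** * Products of independent square integrable functions *)

Section independent_products.
Context (R : realType) d (T : measurableType d) (P : probability T R).
Context d1 (S1 : measurableType d1) d2 (S2 : measurableType d2).
Context (phi1 : T -> S1) (phi2 : T -> S2).
Hypotheses (m1 : measurable_fun setT phi1) (m2 : measurable_fun setT phi2).
Hypothesis indep : forall A B, measurable A -> measurable B ->
  P ((phi1 @^-1` A) `&` (phi2 @^-1` B)) = (P (phi1 @^-1` A) * P (phi2 @^-1` B))%E.
Local Notation toL2 := (toL2 P).
Local Notation L2p := (L2pred P).

Lemma indep_integrableM (f : S1 -> R) (g : S2 -> R) :
  measurable_fun setT f -> measurable_fun setT g ->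
  P.-integrable setT (EFin \o (f \o phi1)) -> P.-integrable setT (EFin \o (g \o phi2)) ->
  P.-integrable setT (fun x => (f (phi1 x) * g (phi2 x))%:E).
Proof.
move=> mf mg /integrableP[_ hf] /integrableP[_ hg]; apply/integrableP; split.
  by apply/measurable_EFinP; apply: measurable_funM; exact: measurableT_comp.
have := @indep_ge0_integralM _ _ _ _ _ _ _ _ _ _ m1 m2 indep (fun x => `|f x|%:E) (fun x => `|g x|%:E).
move=> h; under eq_integral do rewrite /= normrM EFinM.
rewrite h //.
- by apply: lte_mul_pinfty => //; [exact: integral_ge0|rewrite ge0_fin_numE //; exact: integral_ge0].
- by apply/measurable_EFinP; exact: measurableT_comp.
- by apply/measurable_EFinP; exact: measurableT_comp.
Qed.

(** Independence factors the expectation of [f ^+ 2 * g ^+ 2]; in general a product of two square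
    integrable functions is merely integrable. *)
Lemma indep_rL2M (f : S1 -> R) (g : S2 -> R) :
  measurable_fun setT f -> measurable_fun setT g ->
  rL2 P (f \o phi1) -> rL2 P (g \o phi2) -> rL2 P (fun x => f (phi1 x) * g (phi2 x)).
Proof.
move=> mf mg [_ hf] [_ hg]; split.
  by apply: measurable_funM; exact: measurableT_comp.
have := @indep_ge0_integralM _ _ _ _ _ _ _ _ _ _ m1 m2 indep
  (fun x => (f x ^+ 2)%:E) (fun x => (g x ^+ 2)%:E).
move=> h; under eq_integral do rewrite exprMn EFinM.
rewrite h.
- apply: lte_mul_pinfty => //; last rewrite ge0_fin_numE //.
  + by apply: integral_ge0 => x _; rewrite lee_fin sqr_ge0.
  + by apply: integral_ge0 => x _; rewrite lee_fin sqr_ge0.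
- by apply/measurable_EFinP; exact: measurable_funX.
- by apply/measurable_EFinP; exact: measurable_funX.
- by move=> x; rewrite lee_fin sqr_ge0.
- by move=> x; rewrite lee_fin sqr_ge0.
Qed.

Lemma indep_L2pred (F : S1 -> R[i]) (G : S2 -> R[i]) :
  cmeasurable measurable F -> cmeasurable measurable G ->
  F \o phi1 \in L2p -> G \o phi2 \in L2p -> (fun x => F (phi1 x) * G (phi2 x)) \in L2p.
Proof.
move=> /cmeasurable_funP[F1 F2] /cmeasurable_funP[G1 G2] /L2predP[r1 r2] /L2predP[s1 s2].
apply/L2predP; split.
- under eq_fun do rewrite cReM.
  by apply: rL2B; [exact: (indep_rL2M F1 G1)|exact: (indep_rL2M F2 G2)].
- under eq_fun do rewrite cImM.
  by apply: rL2D; [exact: (indep_rL2M F1 G2)|exact: (indep_rL2M F2 G1)].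
Qed.

Lemma indep_cintegralM (F : S1 -> R[i]) (G : S2 -> R[i]) :
  cmeasurable measurable F -> cmeasurable measurable G ->
  P.-integrable setT (EFin \o (fun x => complex.Re (F (phi1 x)))) ->
  P.-integrable setT (EFin \o (fun x => complex.Im (F (phi1 x)))) ->
  P.-integrable setT (EFin \o (fun x => complex.Re (G (phi2 x)))) ->
  P.-integrable setT (EFin \o (fun x => complex.Im (G (phi2 x)))) ->
  cintegral P (fun x => F (phi1 x) * G (phi2 x)) =
  cintegral P (F \o phi1) * cintegral P (G \o phi2).
Proof.
move=> /cmeasurable_funP[F1 F2] /cmeasurable_funP[G1 G2] f1 f2 g1 g2.
apply: complex_ext; rewrite ?cReM ?cImM /=.
- under eq_Rintegral do rewrite cReM.
  rewrite (RintegralB measurableT (indep_integrableM F1 G1 f1 g1) (indep_integrableM F2 G2 f2 g2)).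
  by rewrite (indep_RintegralM m1 m2 indep F1 G1) // (indep_RintegralM m1 m2 indep F2 G2).
- under eq_Rintegral do rewrite cImM.
  rewrite (RintegralD measurableT (indep_integrableM F1 G2 f1 g2) (indep_integrableM F2 G1 f2 g1)).
  by rewrite (indep_RintegralM m1 m2 indep F1 G2) // (indep_RintegralM m1 m2 indep F2 G1).
Qed.

(** After regrouping, the integrand is a function of [phi1] times a function of [phi2], each a
    product of two square integrable functions and hence integrable. *)
Lemma indep_L2dot (F F' : S1 -> R[i]) (G G' : S2 -> R[i]) :
  cmeasurable measurable F -> cmeasurable measurable G ->
  cmeasurable measurable F' -> cmeasurable measurable G' ->
  F \o phi1 \in L2p -> G \o phi2 \in L2p -> F' \o phi1 \in L2p -> G' \o phi2 \in L2p ->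
  L2dot P (L2mul (toL2 (F \o phi1)) (toL2 (G \o phi2)))
          (L2mul (toL2 (F' \o phi1)) (toL2 (G' \o phi2))) =
  L2dot P (toL2 (F \o phi1)) (toL2 (F' \o phi1)) * L2dot P (toL2 (G \o phi2)) (toL2 (G' \o phi2)).
Proof.
move=> mF mG mF' mG' LF LG LF' LG'.
have LFG := indep_L2pred mF mG LF LG; have LFG' := indep_L2pred mF' mG' LF' LG'.
rewrite (L2mul_toL2 LF LG LFG) (L2mul_toL2 LF' LG' LFG') (L2dotE LFG LFG') (L2dotE LF LF') (L2dotE LG LG').
have mFF := measurable_cmul (measurable_conjc mF) mF'.
have mGG := measurable_cmul (measurable_conjc mG) mG'.
have int (f g : T -> R[i]) : f \in L2p -> g \in L2p ->
    P.-integrable setT (EFin \o (fun x => complex.Re (conjc (f x) * g x))) /\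
    P.-integrable setT (EFin \o (fun x => complex.Im (conjc (f x) * g x))).
  move=> /L2predP[f1 f2] /L2predP[g1 g2]; split.
    have := integrableD measurableT (rL2_integrableM f1 g1) (rL2_integrableM f2 g2).
    by apply: eq_integrable => // x _ /=; rewrite cReM Re_conjc Im_conjc mulNr opprK.
  have := integrableB measurableT (rL2_integrableM f1 g2) (rL2_integrableM f2 g1).
  by apply: eq_integrable => // x _ /=; rewrite cImM Re_conjc Im_conjc mulNr.
have [i1 i2] := int _ _ LF LF'; have [j1 j2] := int _ _ LG LG'.
rewrite -(indep_cintegralM mFF mGG i1 i2 j1 j2).
congr cintegral; apply/funext => x /=; rewrite rmorphM /=; ring.
Qed.

End independent_products.

(** * Shifts of the Poisson process *)

Section action.
Context (R : realType) (d : nat) dY (Y : measurableType dY) (act : 'rV[R]_d -> Y -> Y).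
Hypotheses (act0 : forall y, act 0 y = y)
  (actD : forall a b y, act (a + b) y = act a (act b y))
  (act_measurable : sys_measurable (sys_prod (@borel 'rV[R]_d) (@measurable dY Y))
      (@measurable dY Y) (fun ay => act ay.1 ay.2)).
Local Notation rVb := (g_sigma_algebraType (@open 'rV[R]_d)).

Lemma measurable_act : measurable_fun setT (fun x : rVb * Y => act x.1 x.2).
Proof.
move=> _ B mB; rewrite setTI measurable_prod_measurableType.
exact: act_measurable.
Qed.

Lemma measurable_act_at c : measurable_fun setT (act c).
Proof.
have h : measurable_fun setT (fun y : Y => (c : rVb, y)) by exact: measurable_fun_pair.
exact: (measurableT_comp measurable_act h).
Qed.

Lemma actK c : cancel (act c) (act (- c)).
Proof. by move=> y; rewrite -actD addNr act0. Qed.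

Lemma actNK c : cancel (act (- c)) (act c).
Proof. by move=> y; rewrite -actD addrN act0. Qed.

Lemma translateE B c : translate act B c = act (- c) @^-1` B.
Proof.
apply/seteqP; split=> y /=; first by move=> [x Bx <-]; rewrite actK.
by move=> h; exists (act (- c) y) => //; rewrite actNK.
Qed.

Lemma measurable_translate B c : measurable B -> measurable (translate act B c).
Proof. by move=> mB; rewrite translateE -[X in measurable X]setTI; exact: measurable_act_at. Qed.

Lemma translateD B a b : translate act (translate act B a) b = translate act B (a + b).
Proof. by rewrite !translateE; apply/seteqP; split=> y /=; rewrite -actD opprD. Qed.

Lemma translate0 B : translate act B 0 = B.
Proof. by rewrite translateE; apply/seteqP; split=> y /=; rewrite oppr0 act0. Qed.

Lemma translate_setD A B c :
  translate act (A `\` B) c = translate act A c `\` translate act B c.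
Proof. by rewrite !translateE. Qed.

Lemma translateS A B c : A `<=` B -> translate act A c `<=` translate act B c.
Proof. by move=> AB; rewrite !translateE => y; exact: AB. Qed.

End action.

(** * The unitary group induced by translations *)

Section shift_group.
Context (R : realType) (d : nat) dY (Y : measurableType dY) (act : 'rV[R]_d -> Y -> Y).
Hypotheses (act0 : forall y, act 0 y = y)
  (actD : forall a b y, act (a + b) y = act a (act b y))
  (act_measurable : sys_measurable (sys_prod (@borel 'rV[R]_d) (@measurable dY Y))
      (@measurable dY Y) (fun ay => act ay.1 ay.2)).
Context (rho0 : {sigma_finite_measure set Y -> \bar R}).
Hypothesis rho0_invariant : forall a B, measurable B -> rho0 (translate act B a) = rho0 B.
Context (nu : {measure set (posR R) -> \bar R}).
Hypothesis nu_levy : (\int[nu]_r (Num.min (pos_val r) 1)%:E < +oo)%E.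
Context dO (T : measurableType dO) (Pr : probability T R).
Local Notation Z := (Y * posR R)%type.
Context (eta : T -> {measure set Z -> \bar R}).
Hypothesis poi : poisson_process Pr (rho0 \x nu)%E eta.
Local Notation lam := (rho0 \x nu)%E.
Local Notation xi := (compound_poisson eta).
Local Notation toL2 := (toL2 Pr).
Local Notation L2p := (L2pred Pr).
Let pp := poisson_point_process poi.

Definition ztr c (C : set Z) : set Z := (fun z => (act (- c) z.1, z.2)) @^-1` C.

Lemma measurable_ztr c C : measurable C -> measurable (ztr c C).
Proof.
move=> mC; rewrite -[X in measurable X]setTI.
have m : measurable_fun setT (fun z : Z => (act (- c) z.1, z.2)).
  apply: measurable_fun_pair => //.
  exact: (measurableT_comp (measurable_act_at act_measurable (- c)) measurable_fst).
exact: m.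
Qed.

Lemma ztr_rect c B A : ztr c (B `*` A) = translate act B c `*` A.
Proof. by rewrite (translateE act0 actD). Qed.

Lemma ztrD a b C : ztr a (ztr b C) = ztr (a + b) C.
Proof. by apply/seteqP; split=> -[y r] /=; rewrite /ztr /= -actD opprD addrC. Qed.

Lemma intensity_ztr c C : measurable C -> lam (ztr c C) = lam C.
Proof.
move=> mC.
(* The integrability condition makes [nu] sigma-finite through the tails [mark_tail n]; repackaged
   as [nu'], it gives measurability in [y] of the measures of sections. *)
have nu_sf : sigma_finite setT nu.
  exists (fun n => mark_tail n).
    apply/seteqP; split=> // r _; have r0 := pos_val_gt0 r.
    have [m rm] : exists m, m.+1%:R^-1 < pos_val r.
      have /= [m _ hm] := near_infty_natSinv_lt (PosNum r0).
      by exists m; apply: hm => /=.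
    by exists m => //; rewrite /mark_tail /= ltW.
  by move=> n; split; [exact: measurable_mark_tail|exact: (nu_tail nu_levy)].
pose nu' := HB.pack_for {sigma_finite_measure set (posR R) -> \bar R} (Measure.sort nu)
  (@isSFinite.Build _ _ _ (Measure.sort nu) (sfinite_measure_sigma_finite nu_sf))
  (@isSigmaFinite.Build _ _ _ (Measure.sort nu) nu_sf).
have mf : measurable_fun setT (fun y => nu (xsection C y)).
  exact: (measurable_fun_xsection nu' mC).
rewrite /product_measure1.
have mact := measurable_act_at act_measurable (- c).
have h := ge0_integral_pushforward mact rho0 measurableT mf (fun y _ => measure_ge0 nu _).
rewrite preimage_setT in h.
transitivity (\int[rho0]_y (nu (xsection C (act (- c) y))))%E.
  by apply: eq_integral => y _ /=; congr (nu _); apply/seteqP; split=> r /xsectionP hr; apply/xsectionP.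
rewrite -[LHS]h; apply: eq_measure_integral => A mA _.
by rewrite -[LHS]/(rho0 (act (- c) @^-1` A)) -(translateE act0 actD) rho0_invariant.
Qed.

Definition eta_map (w : T) : cylType R (@measurable _ Z) := fun C => eta w C.

Lemma measurable_eta_map : measurable_fun setT eta_map.
Proof. by apply: measurable_to_cyl => C mC; exact: pp_measurable. Qed.

Definition eshift c (e : cylType R (@measurable _ Z)) : cylType R (@measurable _ Z) :=
  fun C => e (ztr c C).

Lemma preserves_eshift c : preserves_law Pr eta_map (eshift c).
Proof.
split.
  apply: measurable_to_cyl => C mC; apply: measurable_cyl_eval; exact: measurable_ztr.
move=> S; apply: (eta_image_law poi (tau := ztr c)) => //.
- by move=> C; exact: measurable_ztr.
- by move=> C; exact: intensity_ztr.
Qed.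

Definition kap (e : set Z -> \bar R) (B : set Y) : \bar R := marked (@measurable_pos_val R) e B.

Lemma kap_eshift c e B : kap (eshift c e) B = kap e (translate act B c).
Proof.
by congr limn_esup; apply/funext => n; apply: eq_bigr => x _; rewrite /eshift ztr_rect.
Qed.

Lemma kapE w B : measurable B -> kap (eta_map w) B = xi B w.
Proof. by move=> mB; rewrite (compoundE eta w mB). Qed.

Definition kap_map (D : set Y) (e : cylType R (@measurable _ Z)) : cylType R (base_sets D) := kap e.

Lemma measurable_kap (D : set Y) : measurable_fun setT (kap_map D).
Proof.
apply: measurable_to_cyl => B [mB _].
apply: (@measurable_marked R dY Y _ (@measurable_pos_val R) _ (cylType R _) (fun e => e) (fun=> B)).
by move=> A mA; apply: measurable_cyl_eval; exact: measurableX.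
Qed.

Lemma xi_gen_measurable D : xi_gen eta D `<=` measurable.
Proof.
move=> _ [B [mB _] [A mA <-]]; rewrite -[X in measurable X]setTI.
exact: (measurable_compound poi mB).
Qed.

(** Agrees with xi on the measurable subsets of [D]; written as a functional on all set functions,
    it can be composed with [eshift] and commutes with translations for every set. *)
Definition xi_map (D : set Y) (w : T) : cylType R (base_sets D) := kap_map D (eta_map w).

Lemma measurable_xi_map D : measurable_fun setT (xi_map D).
Proof. exact: (measurableT_comp (@measurable_kap D) measurable_eta_map). Qed.

Lemma L2meas_xi_rep D u : u \in L2meas Pr (xi_gen eta D) ->
  exists F : cylType R (base_sets D) -> R[i],
    [/\ cmeasurable measurable F, F \o xi_map D \in L2p & u = toL2 (F \o xi_map D)].
Proof.
apply: L2meas_doob; [exact: xi_gen_measurable|exact: measurable_xi_map|].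
move=> _ [B bB [A mA <-]]; exists ((fun e : cylType R (base_sets D) => e B) @^-1` A).
  by rewrite -[X in measurable X]setTI; exact: measurable_cyl_eval.
by apply/seteqP; split=> w /=; rewrite /xi_map /kap_map kapE //; case: bB.
Qed.

Lemma L2meas_xi_map D (F : cylType R (base_sets D) -> R[i]) : cmeasurable measurable F ->
  F \o xi_map D \in L2p -> toL2 (F \o xi_map D) \in L2meas Pr (xi_gen eta D).
Proof.
move=> mF LF; apply: L2meas_toL2 => //.
have m : measurable_fun setT (xi_map D : g_sigma_algebraType (xi_gen eta D) -> _).
  apply: measurable_to_cyl => B bB _ A mA; rewrite setTI; apply: sub_gen_smallest.
  exists B => //; exists A => //; apply/seteqP; split=> w /=; rewrite /xi_map /kap_map kapE //; by case: bB.
have /cmeasurable_funP[m1 m2] := mF.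
have m1' := measurableT_comp m1 m; have m2' := measurableT_comp m2 m.
by split=> A mA; [have := m1' measurableT A mA|have := m2' measurableT A mA]; rewrite setTI.
Qed.

Hypothesis Omega_gen : @measurable dO T = complete_gen Pr (eta_gen eta).

(** [Omega_gen] is what makes every square integrable class a function of [eta], so that the shift
    is defined on all of L^2. *)
Lemma eta_rep (u : L2 Pr) : exists F : cylType R (@measurable _ Z) -> R[i],
  [/\ cmeasurable measurable F, F \o eta_map \in L2p & u = toL2 (F \o eta_map)].
Proof.
apply: (@L2meas_doob _ _ _ _ (eta_gen eta)).
- by move=> _ [C mC [A mA <-]]; rewrite -[X in measurable X]setTI; exact: (pp_measurable pp).
- exact: measurable_eta_map.
- move=> _ [C mC [A mA <-]]; exists ((fun e : cylType R (@measurable _ Z) => e C) @^-1` A) => //.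
  by rewrite -[X in measurable X]setTI; exact: measurable_cyl_eval.
- elim/toL2W: u => f fL; rewrite inE /=; exists (MkL2fun fL); first exact: toL2E.
  by rewrite -Omega_gen; exact: (L2pred_cmeas fL).
Qed.

Definition ush c (u : L2 Pr) : L2 Pr := koop (eshift c) eta_rep u.

Lemma ush_lin c k u v : ush c (k *: u + v) = k *: ush c u + ush c v.
Proof. exact: (koop_lin measurable_eta_map (preserves_eshift c)). Qed.

Lemma ush_dot c u v : L2dot Pr (ush c u) (ush c v) = L2dot Pr u v.
Proof. exact: (koop_dot measurable_eta_map (preserves_eshift c)). Qed.

Lemma ush_mul c u v : L2mulable u v ->
  ush c (L2mul u v) = L2mul (ush c u) (ush c v) /\ L2mulable (ush c u) (ush c v).
Proof. exact: (koop_mul measurable_eta_map (preserves_eshift c)). Qed.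

Lemma ushD a b u : ush a (ush b u) = ush (a + b) u.
Proof.
apply: (koop_comp measurable_eta_map); try exact: preserves_eshift.
by move=> e; apply/funext => C; rewrite /eshift ztrD.
Qed.

Lemma ush0 u : ush 0 u = u.
Proof.
apply: (koop_id measurable_eta_map); first exact: preserves_eshift.
move=> e; apply/funext => C; congr (e _); apply/seteqP.
by split=> -[y r]; rewrite /ztr /= oppr0 act0.
Qed.

Lemma ush_kap c D (F : cylType R (base_sets D) -> R[i]) : cmeasurable measurable F ->
  F \o xi_map D \in L2p ->
  ush c (toL2 (F \o xi_map D)) = toL2 (fun w => F (fun B => kap (eta_map w) (translate act B c))).
Proof.
move=> mF LF; have mFk : cmeasurable measurable (F \o kap_map D).
  have /cmeasurable_funP[m1 m2] := mF; apply/cmeasurable_funP.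
  by split; [exact: (measurableT_comp m1 (@measurable_kap D))|exact: (measurableT_comp m2 (@measurable_kap D))].
apply: (etrans (koopE measurable_eta_map (preserves_eshift c) eta_rep mFk LF)).
by congr (Defs.toL2 _ _); apply/funext => w /=; congr F; apply/funext => B; rewrite /kap_map kap_eshift.
Qed.

Lemma ush_L2meas c D u : u \in L2meas Pr (xi_gen eta D) ->
  ush c u \in L2meas Pr (xi_gen eta (translate act D c)).
Proof.
move=> /L2meas_xi_rep[F [mF LF ->]]; rewrite ush_kap //.
(* Pulls set functions on [D + c] back to [D], which exhibits the shifted class as a function of xi
   over the translated region. *)
pose tr : cylType R (base_sets (translate act D c)) -> cylType R (base_sets D) :=
  fun e B => e (translate act B c).
have mtr : measurable_fun setT tr.
  apply: measurable_to_cyl => B [mB BD]; apply: measurable_cyl_eval.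
  by split; [exact: measurable_translate|exact: translateS].
have mFt : cmeasurable measurable (F \o tr).
  have /cmeasurable_funP[m1 m2] := mF; apply/cmeasurable_funP.
  by split; [exact: (measurableT_comp m1 mtr)|exact: (measurableT_comp m2 mtr)].
apply: (L2meas_xi_map mFt).
have mFk : cmeasurable measurable (F \o kap_map D).
  have /cmeasurable_funP[m1 m2] := mF; apply/cmeasurable_funP.
  by split; [exact: (measurableT_comp m1 (@measurable_kap D))|exact: (measurableT_comp m2 (@measurable_kap D))].
have := law_L2pred measurable_eta_map (preserves_eshift c) mFk LF.
rewrite (_ : (F \o kap_map D) \o _ = (F \o tr) \o xi_map (translate act D c)) //.
by apply/funext => w /=; congr F; apply/funext => B; rewrite /kap_map kap_eshift.
Qed.

(* The cylinder sets over D1 and D2 form a pi-system generating the sigma-algebra of xi on D. *)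
Lemma xi_dense (D D1 D2 : set Y) (K : set (L2 Pr)) : measurable D1 -> D `<=` D1 `|` D2 ->
  closed_subspace (L2dot Pr) K ->
  (forall A1 A2, cboxes (base_sets D1) A1 -> cboxes (base_sets D2) A2 ->
    K (toL2 (cindic R ((xi_map D1 @^-1` A1) `&` (xi_map D2 @^-1` A2))))) ->
  forall u, u \in L2meas Pr (xi_gen eta D) -> K u.
Proof.
move=> mD1 DD clK hK u /(L2meas_rep (@xi_gen_measurable _))[f [mf fL ->]].
pose Pi := [set V | exists A1 A2, [/\ cboxes (base_sets D1) A1, cboxes (base_sets D2) A2 &
  V = (xi_map D1 @^-1` A1) `&` (xi_map D2 @^-1` A2)]].
have boxT (D' : set Y) : cboxes (base_sets D') (setT : set (cylType R (base_sets D'))).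
  exists 0%N, (fun=> set0), (fun=> setT); split=> //; first by case.
  by apply/seteqP; split=> // e _ [].
apply: (@L2_pi_dense _ T R Pr Pi K) => //.
- move=> _ _ [A1 [A2 [b1 b2 ->]]] [A1' [A2' [b1' b2' ->]]].
  exists (A1 `&` A1'), (A2 `&` A2'); split; try exact: cboxes_setI.
  by rewrite setIACA.
- move=> _ [A1 [A2 [b1 b2 ->]]]; apply: measurableI; rewrite -[X in measurable X]setTI.
    by apply: (@measurable_xi_map D1) => //; exact: measurable_cbox.
  by apply: (@measurable_xi_map D2) => //; exact: measurable_cbox.
- have := hK _ _ (boxT D1) (boxT D2); rewrite !preimage_setT setTI.
  rewrite (_ : cindic R setT = fun=> 1) //.
  by apply/funext => x; rewrite /cindic indicE in_setT.
- by move=> _ [A1 [A2 [b1 b2 ->]]]; exact: hK.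
apply: cmeasurable_sub mf; apply: smallest_sub; first exact: smallest_sigma_algebra.
move=> _ [B [mB BD] [A mA <-]].
have box1 (D' B' : set Y) (A' : set (\bar R)) : base_sets D' B' -> measurable A' ->
    exists2 A0, cboxes (base_sets D') A0 & xi B' @^-1` A' = xi_map D' @^-1` A0.
  move=> bB mA'; exists (cbox (fun _ : 'I_1 => B') (fun=> A')).
    by exists 1%N, (fun=> B'), (fun=> A').
  apply/seteqP; split=> w /=; rewrite /cbox /= /xi_map /kap_map.
    by move=> h _; rewrite kapE //; case: bB.
  by move=> /(_ ord0); rewrite kapE //; case: bB.
(* [B] need not lie in [D1] or in [D2]; it is split by [D1], and xi of the whole is the sum of two
   variables measurable for the pi-system. *)
have m1 : measurable_fun setT (xi (B `&` D1) : g_sigma_algebraType Pi -> \bar R).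
  move=> _ A' mA'; rewrite setTI; apply: sub_gen_smallest.
  have bB1 : base_sets D1 (B `&` D1) by split; [exact: measurableI|exact: subIsetr].
  have [A0 bA0 ->] := box1 D1 (B `&` D1) A' bB1 mA'.
  by exists A0, setT; split=> //; rewrite preimage_setT setIT.
have m2 : measurable_fun setT (xi (B `\` D1) : g_sigma_algebraType Pi -> \bar R).
  move=> _ A' mA'; rewrite setTI; apply: sub_gen_smallest.
  have bB2 : base_sets D2 (B `\` D1).
    by split; [exact: measurableD|move=> y [By nD1]; case: (DD _ (BD _ By))].
  have [A0 bA0 ->] := box1 D2 (B `\` D1) A' bB2 mA'.
  by exists setT, A0; split=> //; rewrite preimage_setT setTI.
have m12 := emeasurable_funD m1 m2.
have E : (fun w => xi (B `&` D1) w + xi (B `\` D1) w)%E = xi B.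
  apply/funext => w; rewrite -(compoundU eta w); last first.
  - by apply/eqP; rewrite setDE setIACA setICr setI0.
  - exact: measurableD.
  - exact: measurableI.
  by rewrite setUIDK.
have := m12 measurableT A mA; rewrite setTI.
by rewrite -E.
Qed.

End shift_group.

(** * Products of the fibres *)

Section cone_shift.
Context (R : realType) (d : nat) (P : set 'rV[R]_d).
Hypotheses (P_convex : convex_set P)
  (P_cone : forall (t : R) a, 0 <= t -> P a -> P (t *: a))
  (P_pointed : P `&` [set a | P (- a)] = [set 0]).
Context dY (Y : measurableType dY) (act : 'rV[R]_d -> Y -> Y).
Hypotheses (act0 : forall y, act 0 y = y)
  (actD : forall a b y, act (a + b) y = act a (act b y))
  (act_measurable : sys_measurable (sys_prod (@borel 'rV[R]_d) (@measurable dY Y))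
      (@measurable dY Y) (fun ay => act ay.1 ay.2)).
Context (rho0 : {sigma_finite_measure set Y -> \bar R}).
Hypothesis rho0_invariant : forall a B, measurable B -> rho0 (translate act B a) = rho0 B.
Context (X : set Y) (X_measurable : measurable X).
Hypothesis X_shift : forall a, P a -> translate act X a `<=` X.
Context (nu : {measure set (posR R) -> \bar R}).
Hypothesis nu_levy : (\int[nu]_r (Num.min (pos_val r) 1)%:E < +oo)%E.
Context dO (T : measurableType dO) (Pr : probability T R).
Local Notation Z := (Y * posR R)%type.
Context (eta : T -> {measure set Z -> \bar R}).
Hypothesis poi : poisson_process Pr (rho0 \x nu)%E eta.
Hypothesis Omega_gen : @measurable dO T = complete_gen Pr (eta_gen eta).
Local Notation xi := (compound_poisson eta).
Local Notation toL2 := (toL2 Pr).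
Local Notation dot := (L2dot Pr).
Local Notation N := (hnorm (L2dot Pr)).
Local Notation U := (ush act poi Omega_gen).
Local Notation L2xi D := (L2meas Pr (xi_gen eta D)).
Let ip := L2_inner_product Pr.
Let U_lin := ush_lin act0 actD act_measurable rho0_invariant nu_levy poi Omega_gen.
Let U_dot := ush_dot act0 actD act_measurable rho0_invariant nu_levy poi Omega_gen.
Let U_mul := ush_mul act0 actD act_measurable rho0_invariant nu_levy poi Omega_gen.
Let U_D := ushD act0 actD act_measurable rho0_invariant nu_levy poi Omega_gen.
Let U_0 := ush0 act0 actD act_measurable rho0_invariant nu_levy poi Omega_gen.
Let U_kap := @ush_kap _ _ _ _ _ act0 actD act_measurable _ rho0_invariant _ nu_levy _ _ _ _ poi Omega_gen.
Let U_meas := @ush_L2meas _ _ _ _ _ act0 actD act_measurable _ rho0_invariant _ nu_levy _ _ _ _ poi Omega_gen.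
Let trD := translateD act0 actD.
Let tr0 := translate0 act0 actD.
Let tr_setD := translate_setD act0 actD.
Let mtr := measurable_translate act0 actD act_measurable.
Let mxi_gen D : xi_gen eta D `<=` measurable := xi_gen_measurable poi (D := D).
Let mxi_map D : measurable_fun setT (xi_map eta D) := measurable_xi_map poi (D := D).

Lemma cone0 : P 0.
Proof. 
have h : (P `&` [set a | P (- a)]) 0 by rewrite P_pointed.
by case: h.
 Qed.

(** The sum is twice a midpoint, so convexity and stability under scaling suffice. *)
Lemma coneD a b : P a -> P b -> P (a + b).
Proof.
move=> Pa Pb.
have i0 : 0 <= (2^-1 : R) by rewrite invr_ge0.
have i1 : (2^-1 : R) <= 1 by rewrite invf_le1 // ler1n.
have /set_mem h := P_convex (Itv01 i0 i1) (mem_set Pa) (mem_set Pb).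
have -> : a + b = 2 *: conv (Itv01 i0 i1) (a : convex_lmodType 'rV[R]_d) b.
  have -> : conv (Itv01 i0 i1) (a : convex_lmodType 'rV[R]_d) b = 2^-1 *: a + (1 - 2^-1) *: b by [].
  rewrite (_ : 1 - 2^-1 = 2^-1 :> R); last first.
    by apply/eqP; rewrite subr_eq -[X in X == _](@mulfV R 2) // mulr2n mulrDl mul1r.
  by rewrite -scalerDr scalerA mulfV // scale1r.
by apply: P_cone => //; rewrite ler0n.
Qed.

Lemma measurable_translateX a : measurable (translate act X a).
Proof. exact: mtr. Qed.

Lemma cindic_L2meas D (A : set (cylType R (base_sets D))) : measurable A ->
  toL2 (cindic R (xi_map eta D @^-1` A)) \in L2xi D.
Proof.
move=> mA; have mf : cmeasurable measurable (cindic R A).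
  by apply/cmeasurable_funP; split; [exact: measurable_indic|exact: measurable_cst].
have mV : measurable (xi_map eta D @^-1` A).
  by rewrite -[X in measurable X]setTI; exact: (@mxi_map D).
have E : cindic R (xi_map eta D @^-1` A) = cindic R A \o xi_map eta D.
  apply/funext => w; rewrite /cindic /= !indicE; congr ((nat_of_bool _)%:R%:C)%C.
have LV := cindic_L2pred Pr mV; rewrite E in LV *.
exact: (L2meas_xi_map mf LV).
Qed.

Lemma hnorm_ush c u : N (U c u) = N u.
Proof. by rewrite /hnorm U_dot. Qed.

Lemma translate_layer a b c : translate act (translate act X a `\` translate act X b) c =
  translate act X (a + c) `\` translate act X (b + c).
Proof. by rewrite tr_setD !trD. Qed.

Lemma ush_is_shift : is_shift P act X eta (Pr := Pr) (fun c => U c).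
Proof.
move=> a b c Pa Pb Pc Pab; split.
  split; last by move=> u v _ _; exact: U_dot.
  - apply/seteqP; split=> v /=.
      by move=> [u uL <-]; rewrite /xi_gen2 -translate_layer; exact: U_meas.
    move=> vL; exists (U (- c) v); last by rewrite U_D addrN U_0.
    rewrite /= /xi_gen2.
    rewrite (_ : translate act X a `\` translate act X b =
      translate act (translate act X (a + c) `\` translate act X (b + c)) (- c)); first exact: U_meas.
    by rewrite translate_layer !addrK.
  - by move=> k u v _ _; exact: U_lin.
move=> n B f BD mf fL; set D := translate act X a `\` translate act X b.
have bB i : base_sets D (B i) by [].
pose F (e : cylType R (base_sets D)) := f [tuple e (B i) | i < n].
have mF : cmeasurable measurable F.
  have mt : measurable_fun setT (fun e : cylType R (base_sets D) => [tuple e (B i) | i < n]).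
    apply/measurable_fun_tnthP => i.
    rewrite (_ : _ \o _ = fun e : cylType R (base_sets D) => e (B i)); first exact: measurable_cyl_eval.
    by apply/funext => e /=; rewrite tnth_mktuple.
  have /cmeasurable_funP[f1 f2] := mf; apply/cmeasurable_funP.
  by split; [exact: (measurableT_comp f1 mt)|exact: (measurableT_comp f2 mt)].
have FE : (fun w => f [tuple xi (B i) w | i < n]) = F \o xi_map eta D.
  apply/funext => w /=; congr f; apply: eq_from_tnth => i; rewrite !tnth_mktuple.
  by rewrite /xi_map /kap_map kapE //; case: (BD i).
rewrite FE U_kap //; last by rewrite -FE.
congr (Defs.toL2 _ _); apply/funext => w /=; congr f; apply: eq_from_tnth => i.
by rewrite !tnth_mktuple kapE //; apply: mtr; case: (BD i).
Qed.

(** The vectors on which both operators agree form a closed subspace, and it contains the cylinder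
    indicators, where the tuple formula prescribes both values. Membership in [A] is carried along
    because [S c] is known to be linear and isometric on [A] only. *)
Lemma is_shift_unique S a b c u : is_shift P act X eta (Pr := Pr) S ->
  P a -> P b -> P c -> P (b - a) -> u \in L2meas Pr (xi_gen2 act X eta a b) -> S c u = U c u.
Proof.
move=> hS Pa Pb Pc Pab; set D := translate act X a `\` translate act X b.
have [[_ Slin Sdot] Stup] := hS a b c Pa Pb Pc Pab.
have [_ Utup] := ush_is_shift Pa Pb Pc Pab.
have mD : measurable D by apply: measurableD; exact: measurable_translateX.
pose A := [set u | u \in L2xi D].
have clA : closed_subspace dot A by exact: (L2meas_closed_subspace Pr (@mxi_gen D)).
suff KA : forall u, u \in L2xi D -> (A u /\ S c u = U c u) by move=> /KA[].
apply: (xi_dense poi mD (D2 := D)); first by rewrite setUid.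
- split.
  + split; first exact: (cs_0 clA).
    have A0 := cs_0 clA.
    have s0 : S c 0 = 0.
      by have := Slin 1 0 0 A0 A0; rewrite !scale1r addr0 => /eqP; rewrite eq_sym -subr_eq0 addrK => /eqP.
    have u0 : U c 0 = 0.
      by have := U_lin c 1 0 0; rewrite !scale1r addr0 => /eqP; rewrite eq_sym -subr_eq0 addrK => /eqP.
    by rewrite s0 u0.
  + move=> k v w [vA Sv] [wA Sw]; split; first exact: (cs_lin clA).
    by rewrite Slin // U_lin Sv Sw.
  + move=> v hv; have vA : A v.
      by apply: (cs_closed clA) => e /hv[w [wA _] we]; exists w.
    split=> //; apply/eqP; rewrite -subr_eq0; apply/eqP/(hnorm0_eq0 ip).
    apply/eqP; rewrite eq_le (hnorm_ge0 dot) andbT; apply/ler_addgt0Pr => e e0; rewrite add0r.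
    have [w [wA Sw] we] := hv (e / 2) (divr_gt0 e0 (ltr0Sn R 1)).
    have vwA : A (-1 *: w + v) by exact: (cs_lin clA).
    have E1 : N (S c v - U c w) = N (v - w).
      rewrite -Sw (_ : S c v - S c w = S c (-1 *: w + v)); last by rewrite Slin // scaleN1r addrC.
      by rewrite /hnorm Sdot // scaleN1r addrC.
    have E2 : N (U c w - U c v) = N (v - w).
      rewrite (_ : U c w - U c v = U c (-1 *: v + w)); last by rewrite U_lin scaleN1r addrC.
      by rewrite hnorm_ush scaleN1r addrC (hnormBC ip).
    apply: le_trans (hnorm_dist ip (U c w) _ _) _; rewrite E1 E2.
    by apply: ltW; rewrite [ltRHS](splitr e) ltrD.
- move=> A1 A2 b1 b2.
  have [n [B [C [bB mC E]]]] := cboxes_setI b1 b2.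
  have V12 : xi_map eta D @^-1` A1 `&` xi_map eta D @^-1` A2 =
      [set w | forall k, C k (xi (B k) w)].
    rewrite -preimage_setI E; apply/seteqP; split=> w h k; have := h k;
    by rewrite /xi_map /kap_map kapE //; case: (bB k).
  pose W : set (n.-tuple (\bar R)) := [set t | forall k, C k (tnth t k)].
  have mW : measurable W.
    rewrite (_ : W = \bigcap_(k in [set: 'I_n]) (fun t => tnth t k) @^-1` C k).
      apply: fin_bigcap_measurable => // k _; rewrite -[X in measurable X]setTI.
      exact: measurable_tnth.
    by apply/seteqP; split=> t h k; [move=> _; exact: h|exact: (h k Logic.I)].
  have mV : measurable [set w | forall k, C k (xi (B k) w)].
    rewrite -V12; apply: measurableI; rewrite -[X in measurable X]setTI.
      by apply: (@mxi_map D) => //; exact: measurable_cbox.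
    by apply: (@mxi_map D) => //; exact: measurable_cbox.
  have fE : cindic R [set w | forall k, C k (xi (B k) w)] =
      fun w => cindic R W [tuple xi (B i) w | i < n].
    apply/funext => w; rewrite /cindic !indicE; congr ((nat_of_bool _)%:R%:C)%C.
    apply/idP/idP => /set_mem h; apply/mem_set => k; have := h k; by rewrite tnth_mktuple.
  have fL := cindic_L2pred Pr mV.
  have mf : cmeasurable measurable (cindic R W).
    apply/cmeasurable_funP; split; first exact: measurable_indic.
    exact: measurable_cst.
  split.
    rewrite -preimage_setI; apply: cindic_L2meas; apply: measurable_cbox.
    exact: cboxes_setI.
  have BD k : measurable (B k) /\ B k `<=` D := bB k.
  rewrite V12 fE in fL *.
  by rewrite (Stup n B _ BD mf fL) (Utup n B _ BD mf fL).
Qed.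

Lemma xi_map_preimage D (A : set (cylType R (base_sets D))) : measurable A ->
  (fun w B => xi B w) @^-1` A = xi_map eta D @^-1` A.
Proof.
move=> mA; have E w B : base_sets D B -> xi B w = xi_map eta D w B.
  by move=> [mB _]; rewrite /xi_map /kap_map kapE.
by apply/seteqP; split=> w /=; apply: (cyl_determined mA) => B bB; rewrite E.
Qed.

(** * Products of functions over disjoint regions *)

Section layers.
Context (D1 D2 D : set Y).
Hypotheses (mD1 : measurable D1) (mD2 : measurable D2) (D12 : D1 `&` D2 = set0).

Let indep (A B : set _) : measurable A -> measurable B ->
  Pr ((xi_map eta D1 @^-1` A) `&` (xi_map eta D2 @^-1` B)) =
  (Pr (xi_map eta D1 @^-1` A) * Pr (xi_map eta D2 @^-1` B))%E.
Proof.
move=> mA mB; rewrite -(@xi_map_preimage D1 _ mA) -(@xi_map_preimage D2 _ mB).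
exact: (compound_indep poi mD1 mD2 D12 mA mB).
Qed.

Lemma layers_mulable u v : u \in L2xi D1 -> v \in L2xi D2 -> L2mulable u v.
Proof.
move=> /(L2meas_xi_rep poi)[F [mF LF ->]] /(L2meas_xi_rep poi)[G [mG LG ->]].
apply/(L2mulableE LF LG).
exact: (indep_L2pred (@mxi_map D1) (@mxi_map D2) indep mF mG LF LG).
Qed.

Lemma layers_dot u v u' v' : u \in L2xi D1 -> v \in L2xi D2 -> u' \in L2xi D1 -> v' \in L2xi D2 ->
  dot (L2mul u v) (L2mul u' v') = dot u u' * dot v v'.
Proof.
move=> /(L2meas_xi_rep poi)[F [mF LF ->]] /(L2meas_xi_rep poi)[G [mG LG ->]].
move=> /(L2meas_xi_rep poi)[F' [mF' LF' ->]] /(L2meas_xi_rep poi)[G' [mG' LG' ->]].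
exact: (indep_L2dot (@mxi_map D1) (@mxi_map D2) indep).
Qed.

Lemma layers_meas u v : D1 `<=` D -> D2 `<=` D -> u \in L2xi D1 -> v \in L2xi D2 ->
  L2mul u v \in L2xi D.
Proof.
move=> D1D D2D uL vL; have := layers_mulable uL vL; move: uL vL.
move=> /(L2meas_rep (@mxi_gen D1))[f [mf fL ->]] /(L2meas_rep (@mxi_gen D2))[g [mg gL ->]].
move=> /(L2mulableE fL gL) fg; rewrite (L2mul_toL2 fL gL fg); apply: L2meas_toL2 => //.
have sub D' : D' `<=` D -> <<s xi_gen eta D'>> `<=` <<s xi_gen eta D>>.
  move=> D'D; apply: smallest_sub; first exact: smallest_sigma_algebra.
  move=> _ [B [mB BD] [A mA <-]]; apply: sub_gen_smallest.
  by exists B; [split=> // y /BD /D'D|exists A].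
have mf' := cmeasurable_sub (sub _ D1D) mf; have mg' := cmeasurable_sub (sub _ D2D) mg.
exact: (@measurable_cmul _ (g_sigma_algebraType (xi_gen eta D)) R f g mf' mg').
Qed.

(** The indicator of an intersection of cylinder events over [D1] and [D2] is a product of two
    indicators, and such indicators generate everything by [xi_dense]. *)
Lemma layers_total : D `<=` D1 `|` D2 -> D1 `<=` D -> D2 `<=` D ->
  htotal (@L2sub_dot _ _ _ Pr (xi_gen eta D))
    [set w | exists u v, [/\ u \in L2xi D1, v \in L2xi D2 & val w = L2mul u v]].
Proof.
move=> DD D1D D2D; have ipD := L2sub_inner_product Pr (xi_gen eta D).
apply: (htotal_closed_subspace ipD).
  have z1 : 0 \in L2xi D1 by exact: rpred0.
  have z2 : 0 \in L2xi D2 by exact: rpred0.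
  by exists (MkL2sub (layers_meas D1D D2D z1 z2)), 0, 0; split.
move=> K clK SK; have clD := L2meas_closed_subspace Pr (@mxi_gen D).
(* [xi_dense] speaks of subspaces of the whole L^2, so [K] is replaced by its image there, which
   remains closed because L^2 over [D] is closed. *)
pose K' := [set u | exists2 w : L2sub Pr (xi_gen eta D), K w & val w = u].
have clK' : closed_subspace dot K'.
  split.
  - by exists 0; [exact: (cs_0 clK)|].
  - by move=> c _ _ [u Ku <-] [v Kv <-]; exists (c *: u + v); [exact: (cs_lin clK)|].
  - move=> u hu; have uD : u \in L2xi D.
      apply: (cs_closed clD) => e /hu[_ [w Kw <-] uw]; exists (val w) => //; exact: valP.
    exists (MkL2sub uD) => //; apply: (cs_closed clK) => e /hu[_ [w Kw <-] uw].
    by exists w => //; rewrite (hnorm_L2sub (G := xi_gen eta D)).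
suff K'all u : u \in L2xi D -> K' u.
  by move=> w; have [w' Kw' /val_inj <-] := K'all _ (valP w).
apply: (xi_dense poi mD1 DD clK') => A1 A2 b1 b2.
have mA1 := measurable_cbox b1; have mA2 := measurable_cbox b2.
have c1 := @cindic_L2meas D1 _ mA1; have c2 := @cindic_L2meas D2 _ mA2.
have mV1 : measurable (xi_map eta D1 @^-1` A1).
  by rewrite -[X in measurable X]setTI; exact: (@mxi_map D1).
have mV2 : measurable (xi_map eta D2 @^-1` A2).
  by rewrite -[X in measurable X]setTI; exact: (@mxi_map D2).
have fL := cindic_L2pred Pr mV1; have gL := cindic_L2pred Pr mV2.
exists (MkL2sub (layers_meas D1D D2D c1 c2)); first by apply: SK; exists (toL2 (cindic R (xi_map eta D1 @^-1` A1))), (toL2 (cindic R (xi_map eta D2 @^-1` A2))).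
have /(L2mulableE fL gL) fg := layers_mulable c1 c2.
rewrite /= (L2mul_toL2 fL gL fg); congr (Defs.toL2 _ _); apply/funext => w.
by rewrite /cindic indicI /= rmorphM.
Qed.

End layers.

Local Notation Fib a := (L2meas Pr (xi_gen1 act X eta a)).

Lemma shift_is_shift : is_shift P act X eta (Defs.shift P act X eta (Pr := Pr)).
Proof. by apply: xgetPex; exists (fun c => U c); exact: ush_is_shift. Qed.

(** As [X + 0 = X], the fibre over [b] is L^2 over the layer from [0] to [b], to which uniqueness of
    the shift applies. *)
Lemma shiftE a b v : P a -> P b -> v \in Fib b -> Defs.shift P act X eta a v = U a v.
Proof.
move=> Pa Pb vb; apply: (is_shift_unique shift_is_shift cone0 Pb Pa).
  by rewrite subr0.
by rewrite /xi_gen2 tr0.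
Qed.

Lemma translateX_le a b : P a -> P b -> translate act X (a + b) `<=` translate act X a.
Proof.
move=> Pa Pb; rewrite addrC -trD; apply: (translateS act0 actD); exact: X_shift.
Qed.

Section fibres.
Context (a b : 'rV[R]_d) (Pa : P a) (Pb : P b).
Let D1 := X `\` translate act X a.
Let D2 := translate act X a `\` translate act X (a + b).
Let D := X `\` translate act X (a + b).

Let mD1 : measurable D1. Proof. by apply: measurableD => //; exact: mtr. Qed.
Let mD2 : measurable D2. Proof. by apply: measurableD; exact: mtr. Qed.
Let D12 : D1 `&` D2 = set0.
Proof. by apply/seteqP; split=> // y [[_ h] [h' _]]. Qed.
Let D1D : D1 `<=` D.
Proof. by move=> y [Xy ny]; split=> // /(translateX_le Pa Pb). Qed.
Let D2D : D2 `<=` D.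
Proof. by move=> y [/(X_shift Pa) Xy ny]. Qed.
Let DD : D `<=` D1 `|` D2.
Proof. by move=> y [Xy ny]; have [ya|ya] := pselect (translate act X a y); [right|left]. Qed.
Let D2E : D2 = translate act (X `\` translate act X b) a.
Proof. by rewrite tr_setD trD addrC. Qed.

Lemma ush_fibre v : v \in Fib b -> U a v \in L2xi D2.
Proof. by move=> vb; rewrite D2E; exact: U_meas. Qed.

Lemma fibre_mulable u v : u \in Fib a -> v \in Fib b -> L2mulable u (U a v).
Proof. by move=> ua /ush_fibre vb; exact: (layers_mulable mD1 mD2 D12 ua vb). Qed.

Lemma fibre_mul u v : u \in Fib a -> v \in Fib b -> L2mul u (U a v) \in Fib (a + b).
Proof. by move=> ua /ush_fibre vb; exact: (layers_meas mD1 mD2 D12 D1D D2D ua vb). Qed.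

Lemma fibre_dot u v u' v' : u \in Fib a -> v \in Fib b -> u' \in Fib a -> v' \in Fib b ->
  dot (L2mul u (U a v)) (L2mul u' (U a v')) = dot u u' * dot v v'.
Proof.
move=> ua /ush_fibre vb ua' /ush_fibre vb'.
by rewrite (layers_dot mD1 mD2 D12 ua vb ua' vb') U_dot.
Qed.

Lemma fibre_total e : e = a + b -> htotal (@L2sub_dot _ _ _ Pr (xi_gen1 act X eta e))
  [set w | exists u v, [/\ u \in Fib a, v \in Fib b & val w = L2mul u (U a v)]].
Proof.
move=> -> w eps eps0.
have [n [c [s [hs ws]]]] := layers_total mD1 mD2 D12 DD D1D D2D w eps0.
exists n, c, s; split=> // i; have [u [v [uL vL wE]]] := hs i.
(* The second layer is the translate by [a] of the layer of [b], so the inverse shift carries [v]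
   into the fibre over [b]. *)
exists u, (U (- a) v); split=> //; last by rewrite U_D addrN U_0.
have := U_meas (- a) vL; congr (_ \in L2meas Pr (xi_gen eta _)).
by rewrite D2E trD addrN tr0.
Qed.

End fibres.

(** [U a] is multiplicative and [U a (U b w) = U (a + b) w], which reduces the identity to
    associativity of the pointwise product; the three [L2mulable] facts ensure that no product is a
    default value. *)
Lemma fibre_mulA a b c u v w : P a -> P b -> P c -> u \in Fib a -> v \in Fib b -> w \in Fib c ->
  L2mul u (U a (L2mul v (U b w))) = L2mul (L2mul u (U a v)) (U (a + b) w).
Proof.
move=> Pa Pb Pc ua vb wc.
have [e1 m1] := U_mul a (fibre_mulable vb wc).
have m2 := fibre_mulable ua vb.
have m3 := fibre_mulable ua (fibre_mul Pb Pc vb wc).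
rewrite e1 in m3 *; rewrite U_D in m1 m3 *.
by have [] := L2mulA m2 m1 m3.
Qed.

Local Notation E := (cpp_fibre P act X Pr eta).
Local Notation mul := (cpp_mul P act X Pr eta).

Let PV (a : P) : P (val a). Proof. exact: set_mem (valP a). Qed.
Let EV (a : P) (u : E a) : (val u : L2 Pr) \in Fib (val a). Proof. exact: valP. Qed.

(** No default value is taken: the cone is stable under addition, the product lies in the fibre over
    the sum, and the chosen shift coincides with [U] on the fibres. *)
Lemma cpp_mul_val x y : val (tag (mul x y)) = val (tag x) + val (tag y) /\
  val (tagged (mul x y)) = L2mul (val (tagged x)) (U (val (tag x)) (val (tagged y))).
Proof.
case: x y => [a u] [b v]; rewrite /cpp_mul /=.
have Pab : val a + val b \in P by apply/mem_set/coneD.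
have cE : val (insubd a (val a + val b) : P) = val a + val b by rewrite insubdK.
split=> //; rewrite (shiftE (PV a) (PV b) (EV v)) insubdK //.
by rewrite cE; exact: (fibre_mul (PV a) (PV b) (EV u) (EV v)).
Qed.

Lemma cpp_ext (x y : {a : P & E a}) : val (tag x) = val (tag y) ->
  (val (tagged x) : L2 Pr) = val (tagged y) -> x = y.
Proof.
case: x y => [a u] [b v] /= /val_inj ab; subst b => uv.
by congr existT; exact: val_inj.
Qed.

Lemma cpp_mulA : associative mul.
Proof.
move=> x y z; have [t1 v1] := cpp_mul_val y z; have [t2 v2] := cpp_mul_val x y.
have [t3 v3] := cpp_mul_val x (mul y z); have [t4 v4] := cpp_mul_val (mul x y) z.
apply: cpp_ext; first by rewrite t3 t4 t1 t2 addrA.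
rewrite v3 v4 v1 v2 t2.
exact: (fibre_mulA (PV _) (PV _) (PV _) (EV _) (EV _) (EV _)).
Qed.

Lemma cpp_hilbert (a : P) : hilbert (cpp_dot P act X Pr eta (a := a)).
Proof. exact: (L2sub_hilbert Pr (@mxi_gen _)). Qed.

(** The elementary tensors and the products, both indexed by pairs, have the same inner products by
    independence and are both total, so [unitary_extension] applies to any model of the tensor
    product. *)
Lemma cpp_mul_unitary (a b c : P) : val c = val a + val b ->
  forall (V : lmodType R[i]) (dotV : V -> V -> R[i]) (tens : E a -> E b -> V),
  hilbert_tensor (cpp_dot P act X Pr eta (a := a)) (cpp_dot P act X Pr eta (a := b)) dotV tens ->
  exists2 W : V -> E c, unitary_on dotV (cpp_dot P act X Pr eta (a := c)) setT setT W &
    forall u v, mul (Tagged E u) (Tagged E v) = Tagged E (W (tens u v)).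
Proof.
move=> cab V dotV tens [hV _ _ tdot ttot].
pose m (p : E a * E b) : L2 Pr := L2mul (val p.1) (U (val a) (val p.2)).
have mL p : m p \in L2meas Pr (xi_gen1 act X eta (val c)).
  by rewrite cab; exact: (fibre_mul (PV a) (PV b) (EV _) (EV _)).
pose mc p : E c := MkL2sub (mL p).
have [|||W uW Wt] := @unitary_extension R V (E c) dotV (cpp_dot P act X Pr eta (a := c))
    (E a * E b)%type (fun p => tens p.1 p.2) mc hV (cpp_hilbert c).
- by move=> p q; rewrite tdot; exact: (fibre_dot (EV _) (EV _) (EV _) (EV _)).
- rewrite [X in htotal _ X](_ : _ = [set tens u v | u in setT & v in setT]) //.
  apply/seteqP; split=> [_ [[u v] _ <-]|_ [u _ [v _ <-]]]; first by exists u => //; exists v.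
  by exists (u, v).
- move=> w eps eps0.
  have [n [k [s [hs ws]]]] := fibre_total (PV a) (PV b) cab w eps0.
  exists n, k, s; split=> // i; have [u [v [ua vb sE]]] := hs i.
  by exists (MkL2sub ua, MkL2sub vb) => //; apply: val_inj; rewrite sE.
exists W => // u v; have [tE vE] := cpp_mul_val (Tagged E u) (Tagged E v).
apply: cpp_ext; first by rewrite tE cab.
by rewrite vE /= (Wt (u, v)).
Qed.

Lemma cpp_nonzero (a : P) : exists u : E a, u != 0.
Proof.
pose D := X `\` translate act X (val a).
(* The constant function 1, written as an indicator; its class vanishes only if the whole space is
   null. *)
have m1 := @cindic_L2meas D setT measurableT.
have L1 := cindic_L2pred Pr (measurableT : measurable (setT : set T)).
exists (MkL2sub m1); apply/eqP => /(congr1 val) /=.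
rewrite preimage_setT -(toL20 Pr) => /(toL2_eqP L1 (L2pred0 Pr))[B [mB B0 sub]].
have BT : B = setT.
  apply/seteqP; split=> // w _; apply: sub => /= /(congr1 (@complex.Re R)) /=.
  by rewrite indicE in_setT => /eqP; rewrite oner_eq0.
have := probability_setT Pr; rewrite -BT B0 => /esym/eqP.
by rewrite onee_eq0.
Qed.

Lemma cpp_proj_measurable :
  sys_measurable (cpp_sigma P act X Pr eta) (borel_cone P) (fun x => tag x).
Proof.
move=> B mB; exists (B `*` setT); last by rewrite setTI; apply/seteqP; split=> x /=; [case|split].
apply: sub_gen_smallest; exists B => //; exists setT => //.
by rewrite -(setD0 setT); apply: sigma_algebraCD; exact: sigma_algebra0.
Qed.

End cone_shift.

(** * Set systems and countable approximation *)

(* [g_sigma_algebraType] needs a pointed type. *)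
Definition based (T : Type) (x0 : T) : Type := T.
HB.instance Definition _ (T : Type) (x0 : T) := gen_eqMixin (based x0).
HB.instance Definition _ (T : Type) (x0 : T) := gen_choiceMixin (based x0).
HB.instance Definition _ (T : Type) (x0 : T) := isPointed.Build (based x0) x0.

Definition sys_type (T : Type) (x0 : T) (S : set (set T)) : Type :=
  g_sigma_algebraType (S : set (set (based x0))).
HB.instance Definition _ (T : Type) (x0 : T) (S : set (set T)) :=
  Measurable.copy (sys_type x0 S) (g_sigma_algebraType (S : set (set (based x0)))).

Section set_system_lemmas.
Context (T U : Type).

Lemma sys_type_measurable (x0 : T) (S : set (set T)) : sigma_algebra setT S ->
  @measurable _ (sys_type x0 S) = S.
Proof. exact: sigma_algebra_id. Qed.

Lemma sigma_algebra_preimage_sys (f : T -> U) (S : set (set U)) : sigma_algebra setT S ->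
  sigma_algebra setT (preimage_set_system setT f S).
Proof.
move=> [S0 SC SU]; split.
- by exists set0 => //; rewrite preimage_set0 setI0.
- move=> _ [B SB <-]; exists (setT `\` B); first exact: SC.
  by rewrite !setTI setTD preimage_setC setTD.
- move=> F hF; have hF' n : exists B, S B /\ f @^-1` B = F n.
    by have [B SB <-] := hF n; exists B; rewrite setTI.
  have [B hB] := choice hF'.
  exists (\bigcup_n B n); first by apply: SU => n; have [] := hB n.
  by rewrite setTI preimage_bigcup; apply: eq_bigcupr => n _; have [] := hB n.
Qed.

Lemma sys_measurable_gen (S : set (set T)) (G : set (set U)) (f : T -> U) :
  sigma_algebra setT S -> (forall B, G B -> S (f @^-1` B)) -> sys_measurable S <<s G>> f.
Proof.
move=> [S0 SC SU] Gf B.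
suff : <<s G>> `<=` [set B | S (f @^-1` B)] by apply.
apply: smallest_sub => //; split=> /= [|A mA|F mF].
- by rewrite preimage_set0.
- by rewrite setTD preimage_setC -setTD; exact: SC.
- by rewrite preimage_bigcup; exact: SU.
Qed.

End set_system_lemmas.

Lemma sys_measurable_comp (T U W : Type) (S : set (set T)) (S' : set (set U)) (S'' : set (set W))
  (f : T -> U) (g : U -> W) : sys_measurable S S' f -> sys_measurable S' S'' g ->
  sys_measurable S S'' (g \o f).
Proof. by move=> mf mg B /mg /mf. Qed.

Lemma sigma_algebraI (T : Type) (S : set (set T)) A B : sigma_algebra setT S ->
  S A -> S B -> S (A `&` B).
Proof.
move=> [S0 SC SU] SA SB; rewrite -[A `&` B]setCK setCI.
have -> : ~` A `|` ~` B = \bigcup_n (if n is 0%N then ~` A else ~` B).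
  apply/seteqP; split=> x; first by case=> h; [exists 0%N|exists 1%N].
  by case=> -[|n] _ h; [left|right].
by rewrite -setTD; apply: (SC); apply: SU => -[|n]; rewrite -setTD; exact: SC.
Qed.

Lemma sys_measurable_pair (T U W : Type) (S : set (set T)) (S1 : set (set U)) (S2 : set (set W))
  (f : T -> U) (g : T -> W) : sigma_algebra setT S ->
  sys_measurable S S1 f -> sys_measurable S S2 g ->
  sys_measurable S (sys_prod S1 S2) (fun x => (f x, g x)).
Proof.
move=> sS mf mg; apply: sys_measurable_gen => // _ [A SA [B SB <-]].
by apply: (@sigma_algebraI _ S (f @^-1` A) (g @^-1` B) sS); [exact: mf|exact: mg].
Qed.

(** * Countable bases of rectangles *)

Section ball_spaces.
Context (R : realType).

(** Covers both the balls of R^d and those of [hnorm], the latter living on a module that carries no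
    topology. *)
Record ball_axioms (T : Type) (b : T -> R -> set T) : Prop := {
  bs_center : forall x e, 0 < e -> b x e x;
  bs_sym : forall x y e, b x e y -> b y e x;
  bs_triangle : forall x y z e f, b x e y -> b y f z -> b x (e + f) z;
  bs_mono : forall x e f, e <= f -> b x e `<=` b x f }.

Definition ball_dense (T : Type) (b : T -> R -> set T) (q : nat -> T) :=
  forall x e, 0 < e -> exists n, b x e (q n).

Context (T1 T2 : Type) (b1 : T1 -> R -> set T1) (b2 : T2 -> R -> set T2).
Context (q1 : nat -> T1) (q2 : nat -> T2).
Hypotheses (ax1 : ball_axioms b1) (ax2 : ball_axioms b2).
Hypotheses (dense1 : ball_dense b1 q1) (dense2 : ball_dense b2 q2).

Definition basic_rect (x : nat * nat * nat) : set (T1 * T2) :=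
  b1 (q1 x.1.1) x.2.+1%:R^-1 `*` b2 (q2 x.1.2) x.2.+1%:R^-1.

Definition rect_open (U : set (T1 * T2)) := forall x y, U (x, y) ->
  exists2 e : R, 0 < e & b1 x e `*` b2 y e `<=` U.

Lemma basic_rectP U x y : rect_open U -> U (x, y) ->
  exists2 i, basic_rect i (x, y) & basic_rect i `<=` U.
Proof.
move=> oU /oU[e e0 eU].
have e2 : 0 < e / 2 by rewrite divr_gt0.
have /= [k _ hk] := near_infty_natSinv_lt (PosNum e2).
have {hk} /= ke := hk k (leqnn k).
have k0 : 0 < k.+1%:R^-1 :> R by rewrite invr_gt0 ltr0n.
have [n xn] := dense1 x k0; have [m ym] := dense2 y k0.
exists (n, m, k); first by split; [exact: (bs_sym ax1)|exact: (bs_sym ax2)].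
have ke' : k.+1%:R^-1 + k.+1%:R^-1 <= e by rewrite ltW // (splitr e) ltrD.
move=> [x' y'] [/= xx' yy']; apply: eU; split=> /=.
  by apply: (bs_mono ax1 ke'); exact: (bs_triangle ax1 xn).
by apply: (bs_mono ax2 ke'); exact: (bs_triangle ax2 ym).
Qed.

(** By density, a set open for rectangles is a countable union of basic ones, so it already belongs
    to the product sigma-algebra. Used for the measurability of addition and for the Borel sets of
    the Polish space. *)
Lemma rect_measurable (S1 : set (set T1)) (S2 : set (set T2)) U :
  (forall n e, S1 (b1 (q1 n) e)) -> (forall n e, S2 (b2 (q2 n) e)) ->
  rect_open U -> sys_prod S1 S2 U.
Proof.
move=> m1 m2 oU.
have [_ _ SU] := smallest_sigma_algebra setT [set A `*` B | A in S1 & B in S2].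
rewrite (_ : U = \bigcup_i (if unpickle i is Some x then
    if pselect (basic_rect x `<=` U) then basic_rect x else set0 else set0)).
  apply: SU => i; case: unpickle => [x|]; last first.
    by case: (smallest_sigma_algebra setT [set A `*` B | A in S1 & B in S2]).
  case: (pselect _) => ? /=; last by case: (smallest_sigma_algebra setT [set A `*` B | A in S1 & B in S2]).
  apply: sub_gen_smallest; exists (b1 (q1 x.1.1) x.2.+1%:R^-1) => //.
  by exists (b2 (q2 x.1.2) x.2.+1%:R^-1).
apply/seteqP; split=> [[x y] Uxy|[x y] [i _]].
  have [i ixy iU] := basic_rectP oU Uxy.
  by exists (pickle i) => //; rewrite pickleK; case: pselect.
by case: unpickle => // z; case: pselect => // zU /zU.
Qed.

End ball_spaces.

(** * Measurable dependence of square integrable classes on a parameter *)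

Section parameters.
Context (R : realType) dM (M : measurableType dM) d (T : measurableType d) (P : probability T R).
Local Notation toL2 := (toL2 P).
Local Notation L2p := (L2pred P).
Local Notation dot := (L2dot P).

Lemma measurable_param_Rintegral (f : M * T -> R) : measurable_fun setT f ->
  measurable_fun setT (fun a => \int[P]_w f (a, w))%R.
Proof.
move=> mf; have mEf : measurable_fun setT (EFin \o f) by exact/measurable_EFinP.
have mp := @measurable_fun_fubini_tonelli_F _ _ _ _ _ P _ (measurable_funepos mEf) (fun x => funepos_ge0 _ x).
have mn := @measurable_fun_fubini_tonelli_F _ _ _ _ _ P _ (measurable_funeneg mEf) (fun x => funeneg_ge0 _ x).
apply: (measurableT_comp (fine_measurable measurableT)).
have := emeasurable_funB mp mn; congr (measurable_fun setT _).
apply/funext => a; rewrite integralE /fubini_F; congr (_ - _)%E; apply: eq_integral => w _.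
- by rewrite !funeposE.
- by rewrite !funenegE.
Qed.

Context (h : nat -> L2 P).
Hypothesis h_dense : forall v (e : R), 0 < e -> exists n, hnorm dot (v - h n) < e.

Lemma measurable_param_L2 (F : M * T -> R[i]) : cmeasurable measurable F ->
  (forall a, (fun w => F (a, w)) \in L2p) ->
  sys_measurable measurable (hborel dot) (fun a => toL2 (fun w => F (a, w))).
Proof.
move=> /cmeasurable_funP[F1 F2] LF; apply: (hmeas_weak (L2_inner_product P) h_dense) => n.
elim/toL2W: (h n) => g gL; under eq_fun do rewrite (Re_L2dot gL (LF _)).
have /cmeasurable_funP[g1 g2] := L2pred_cmeas gL.
apply: measurable_funD.
  apply: (@measurable_param_Rintegral (fun z => complex.Re (g z.2) * complex.Re (F z))).
  by apply: measurable_funM => //; exact: (measurableT_comp g1).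
apply: (@measurable_param_Rintegral (fun z => complex.Im (g z.2) * complex.Im (F z))).
by apply: measurable_funM => //; exact: (measurableT_comp g2).
Qed.

End parameters.

(** * Events known up to null sets *)

Section almost_everywhere_generated.
Context (R : realType) d (T : measurableType d) (P : probability T R).
Local Notation toL2 := (toL2 P).
Local Notation L2p := (L2pred P).

(** Stable under almost sure modification by construction, which suits functions built from [eta0],
    equal to values of xi only outside a null set. *)
Definition ae_gen (G : set (set T)) : set (set T) :=
  [set B | measurable B /\ exists2 A, <<s G>> A & {ae P, forall x, B x <-> A x}].

Lemma sigma_algebra_ae_gen G : sigma_algebra setT (ae_gen G).
Proof.
split.
- by split=> //; exists set0; [exact: sigma_algebra0|exact: aeW].
- move=> B [mB [A GA BA]]; rewrite setTD; split; first exact: measurableC.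
  exists (setT `\` A); first exact: sigma_algebraCD.
  by apply: filterS BA => x h; rewrite setTD; split=> nx /h.
- move=> F hF; split; first by apply: bigcup_measurable => n _; have [] := hF n.
  have hF' n : exists A, <<s G>> A /\ {ae P, forall x, F n x <-> A x}.
    by have [_ [A GA FA]] := hF n; exists A.
  have [A hA] := choice hF'; exists (\bigcup_n A n).
    by apply: sigma_algebra_bigcup => n; have [] := hA n.
  have : {ae P, forall x n, F n x <-> A n x} by apply: ae_foralln => n; have [] := hA n.
  apply: filterS => x h; split=> -[n _ nx]; exists n => //; exact/h.
Qed.

Lemma ae_gen_sub G : G `<=` measurable -> <<s G>> `<=` ae_gen G.
Proof.
move=> Gm A GA; split; first exact: (smallest_sub_measurable Gm).
by exists A => //; exact: aeW.
Qed.

Lemma ae_gen_ae G dU (U : measurableType dU) (f g : T -> U) : measurable_fun setT g ->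
  sys_measurable (ae_gen G) measurable f -> {ae P, forall x, f x = g x} ->
  sys_measurable (ae_gen G) measurable g.
Proof.
move=> mg mf fg B mB; have [_ [A GA fA]] := mf B mB; split.
  by rewrite -[X in measurable X]setTI; exact: mg.
by exists A => //; apply: filterS2 fA fg => x /= h <-.
Qed.

Lemma L2meas_ae_gen G f : G `<=` measurable -> f \in L2p -> cmeasurable (ae_gen G) f ->
  toL2 f \in L2meas P G.
Proof.
move=> Gm fL [f1 f2].
have rep (k : T -> R) : sys_measurable (ae_gen G) measurable k ->
    exists2 F : T -> R, measurable_fun (setT : set (g_sigma_algebraType G)) F & {ae P, forall x, k x = F x}.
  move=> mk; apply: (@doob_dynkin_real _ T _ P _ (g_sigma_algebraType G) id k) => q.
  have [_ [A GA kA]] := mk `]-oo, (ratr q : R)[%classic (measurable_itv _).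
  by exists A => //; apply: filterS kA => x; rewrite /= in_itv /=.
have [F1 mF1 fF1] := rep _ f1; have [F2 mF2 fF2] := rep _ f2.
pose F x : R[i] := (F1 x +i* F2 x)%C.
have fF : {ae P, forall x, f x = F x}.
  by apply: filterS2 fF1 fF2 => x h1 h2; apply: complex_ext.
have GF : cmeasurable <<s G>> F.
  by split=> A mA; [have := mF1 measurableT A mA|have := mF2 measurableT A mA]; rewrite setTI.
have FL : F \in L2p.
  by apply: (L2pred_ae fL) fF; apply: cmeasurable_sub GF; exact: smallest_sub_measurable.
by have /(toL2_eqP fL FL) -> := fF; exact: L2meas_toL2.
Qed.

End almost_everywhere_generated.

Lemma sigma_algebra_countable (T : Type) (S : set (set T)) (I : countType) (D : set I) (F : I -> set T) :
  sigma_algebra setT S -> (forall i, S (F i)) -> S (\bigcup_(i in D) F i).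
Proof.
move=> [S0 SC SU] SF.
rewrite (_ : \bigcup_(i in D) F i = \bigcup_n (if unpickle n is Some i then
    (if `[< D i >] then F i else set0) else set0)).
  by apply: SU => n; case: unpickle => // i; case: ifP.
apply/seteqP; split=> x.
  by move=> [i Di Fx]; exists (pickle i) => //; rewrite pickleK ifT //; exact/asboolP.
by move=> [n _]; case: unpickle => // i; case: ifPn => // /asboolP Di Fx; exists i.
Qed.

Lemma ereal_rat_measurable (R : realType) (T : Type) (S : set (set T)) (f : T -> \bar R) :
  sigma_algebra setT S -> (forall q : rat, S [set x | (f x < (ratr q)%:E)%E]) ->
  sys_measurable S measurable f.
Proof.
move=> sS hf; have E : @measurable _ (\bar R) = <<s @ErealGenInftyO.G R>> := ErealGenInftyO.measurableE R.
rewrite E; apply: sys_measurable_gen => // _ [r ->].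
rewrite (_ : _ @^-1` _ = \bigcup_(q in [set q : rat | ratr q <= r]) [set x | (f x < (ratr q)%:E)%E]).
  exact: sigma_algebra_countable.
apply/seteqP; split=> x /=; rewrite in_itv /=; last first.
  by move=> [q /= qr fq]; rewrite (lt_le_trans fq) // lee_fin.
case fx : (f x) => [s| |] //; rewrite ?lte_fin => h.
  have [q] := rat_in_itvoo h; rewrite in_itv /= => /andP[sq qr]; exists q; first exact: ltW.
  by rewrite /= fx lte_fin.
have r1 : r - 1 < r by rewrite gtrBl.
have [q] := rat_in_itvoo r1; rewrite in_itv /= => /andP[_ qr]; exists q; first exact: ltW.
by rewrite /= fx ltNyr.
Qed.

Lemma real_rat_measurable (R : realType) (T : Type) (S : set (set T)) (f : T -> R) :
  sigma_algebra setT S -> (forall q : rat, S [set x | f x < ratr q]) ->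
  sys_measurable S measurable f.
Proof.
move=> sS hf B mB.
have h := @ereal_rat_measurable R T S (EFin \o f) sS (fun q => hf q).
have mE : measurable (EFin @` B) by exact: measurable_image_EFin.
have := h _ mE; congr S; apply/seteqP; split=> x /=; last by move=> Bx; exists (f x).
by move=> [y By [<-]].
Qed.

(** * Recovery of a random additive set function from countably many values *)

Section additive_families.
Context (R : realType) d (T : measurableType d) (P : probability T R).
Context dS (S : measurableType dS) (GS : nat -> set S).
Hypothesis GSE : @measurable _ S = <<s range GS>>.
Context (mu : T -> set S -> \bar R).
Hypotheses (mmu : forall C, measurable C -> measurable_fun setT (mu ^~ C))
  (mu_bigcup : forall w F, (forall n, measurable (F n)) -> trivIset setT F ->
    mu w (\bigcup_n F n) = (\sum_(n <oo) mu w (F n))%E)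
  (mu_ge0 : forall w C, (0 <= mu w C)%E)
  (muU : forall w A B, measurable A -> measurable B -> A `&` B = set0 ->
    mu w (A `|` B) = (mu w A + mu w B)%E).
Context (cov : nat -> set S).
Hypotheses (mcov : forall k, measurable (cov k)) (covT : \bigcup_k cov k = setT)
  (cov_fin : forall k, {ae P, forall w, (mu w (cov k) < +oo)%E}).
Context (H : set (set T)).
Hypothesis Hcap : forall s k, sys_measurable (ae_gen P H) measurable
  (fun w => mu w (capseq GS s `&` cov k)).

Lemma measurable_capseqS s : measurable (capseq GS s).
Proof. by rewrite GSE; exact: measurable_capseq. Qed.

(** Dynkin induction inside each [cov k]. The complement step subtracts values that are finite only
    almost surely, so the conclusion is reached in [ae_gen] and not in [<<s H>>]. *)
Lemma ae_gen_additive C : measurable C -> sys_measurable (ae_gen P H) measurable (mu ^~ C).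
Proof.
pose M := sys_type (point : T) (ae_gen P H).
have ME : @measurable _ M = ae_gen P H by apply: sys_type_measurable; exact: sigma_algebra_ae_gen.
have toM (f : T -> \bar R) : sys_measurable (ae_gen P H) measurable f -> measurable_fun (setT : set M) f.
  by move=> mf _ B mB; rewrite setTI ME; exact: mf.
have ofM (f : T -> \bar R) : measurable_fun (setT : set M) f -> sys_measurable (ae_gen P H) measurable f.
  by move=> mf B mB; have := mf measurableT B mB; rewrite setTI ME.
have gen : @measurable _ S = <<s range (capseq GS)>>.
  rewrite GSE; apply/seteqP; split.
    apply: smallest_sub; first exact: smallest_sigma_algebra.
    move=> _ [n _ <-]; apply: sub_gen_smallest; exists [:: n] => //.
    apply/seteqP; split=> x; first by apply; rewrite inE.
    by move=> h i; rewrite inE => /eqP ->.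
  apply: smallest_sub; first exact: smallest_sigma_algebra.
  by move=> _ [s _ <-]; exact: measurable_capseq.
have key k B : measurable B -> measurable_fun (setT : set M) (fun w => mu w (B `&` cov k)).
  rewrite [X in X B -> _]gen; move: B; apply: (@dynkin_induction _ S (range (capseq GS)) (fun B => measurable_fun (setT : set M) (fun w => mu w (B `&` cov k)))).
  - exact: gen.
  - by move=> _ _ [s _ <-] [t _ <-]; exists (s ++ t) => //; exact: capseq_cat.
  - have := toM _ (Hcap [::] k); congr (measurable_fun setT _); apply/funext => w.
    by congr (mu w (_ `&` _)); apply/seteqP; split=> // x _ i.
  - by move=> _ [s _ <-]; exact: toM.
  - move=> A mA QA; have QT : measurable_fun (setT : set M) (fun w => mu w (cov k)).
      have := toM _ (Hcap [::] k); congr (measurable_fun setT _); apply/funext => w.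
      by congr (mu w _); apply/seteqP; split=> [x []//|x hx]; split.
    have mAc : measurable (~` A `&` cov k) by apply: measurableI => //; exact: measurableC.
    have mAk : measurable (A `&` cov k) by exact: measurableI.
    apply: toM; apply: ae_gen_ae (ofM _ (emeasurable_funB QT QA)) _; first exact: mmu.
    apply: filterS (cov_fin k) => w fw.
    have e : mu w (cov k) = (mu w (~` A `&` cov k) + mu w (A `&` cov k))%E.
      rewrite -muU //; last by rewrite setIACA setICl set0I.
      by congr (mu w _); rewrite -setIUl setUCl setTI.
    have fA : mu w (A `&` cov k) \is a fin_num.
      rewrite ge0_fin_numE //; apply: le_lt_trans fw; rewrite e.
      by rewrite leeDr.
    by rewrite e addeK.
  - move=> F mF tF QF.
    rewrite (_ : (fun w => _) = fun w => (\sum_(n <oo) mu w (F n `&` cov k))%E).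
      by apply: ge0_emeasurable_sum => // n _; exact: QF.
    apply/funext => w; rewrite setI_bigcupl mu_bigcup //.
      by move=> n; exact: measurableI.
    exact: trivIset_setIr.
move=> mC; apply: ofM; pose V := seqDU cov.
have mV j : measurable (V j) by apply: measurableD => //; exact: bigsetU_measurable.
(* The extra intersection with [cov n] changes nothing, as [V n] lies inside it, but it puts each
   term in the form treated by [key]. *)
rewrite (_ : (fun w => _) = fun w => (\sum_(n <oo) mu w ((C `&` V n) `&` cov n))%E).
  by apply: ge0_emeasurable_sum => // n _; apply: key; exact: measurableI.
apply/funext => w; rewrite -[in LHS](setIT C) -covT seqDU_bigcup_eq setI_bigcupr mu_bigcup.
- apply: eq_eseriesr => n _; congr (mu w _); rewrite -setIA; congr (_ `&` _).
  by rewrite (setIidl (@subDsetl _ _ _)).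
- by move=> n; exact: measurableI.
- exact/trivIset_setIl/trivIset_seqDU.
Qed.

End additive_families.

Lemma countably_generated_marked (R : realType) dY (Y : measurableType dY) (G : nat -> set Y) :
  @measurable _ Y = <<s range G>> ->
  exists GZ : nat -> set (Y * posR R), @measurable _ (Y * posR R)%type = <<s range GZ>>.
Proof.
move=> GE; pose Z := (Y * posR R)%type.
pose lev (q : rat) : set (posR R) := [set r | pos_val r < ratr q].
have mlev q : measurable (lev q).
  have := @measurable_pos_val R measurableT `]-oo, (ratr q : R)[%classic (measurable_itv _).
  by rewrite setTI; congr measurable; apply/seteqP; split=> r; rewrite /= in_itv.
pose GZ n : set Z := match @unpickle (nat + rat)%type n with
  | Some (inl i) => G i `*` setT | Some (inr q) => setT `*` lev q | None => set0 end.
exists GZ; have sG : sigma_algebra setT <<s range GZ>> by exact: smallest_sigma_algebra.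
apply/seteqP; split; last first.
  apply: smallest_sub; first exact: sigma_algebra_measurable.
  move=> _ [n _ <-]; rewrite /GZ; case: unpickle => [[i|q]|] //; apply: measurableX => //.
  by rewrite GE; apply: sub_gen_smallest; exists i.
have m1 : sys_measurable <<s range GZ>> (@measurable _ Y) (fun z : Z => z.1).
  rewrite GE; apply: sys_measurable_gen => // _ [i _ <-]; apply: sub_gen_smallest.
  exists (pickle (inl i : nat + rat)) => //; rewrite /GZ pickleK.
  by apply/seteqP; split=> z //=; case.
have m2 : sys_measurable <<s range GZ>> (@measurable _ R) (fun z : Z => pos_val z.2).
  apply: real_rat_measurable => // q; apply: sub_gen_smallest.
  exists (pickle (inr q : nat + rat)) => //; rewrite /GZ pickleK.
  by apply/seteqP; split=> z //=; case.
rewrite measurable_prod_measurableType; apply: smallest_sub => // _ [A mA [B mB <-]].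
have [B' mB' BE] := mB.
have h2 : <<s range GZ>> (snd @^-1` B).
  by rewrite (_ : _ @^-1` B = (fun z : Z => pos_val z.2) @^-1` B'); [exact: m2|rewrite -BE setTI].
exact: (sigma_algebraI sG (m1 A mA) h2).
Qed.

(** * Rational step functions over level sets *)

Section level_sets.
Context (R : realType).

Definition levset (T : Type) (f : seq nat * nat -> T -> \bar R) (n : nat) : set T :=
  if @unpickle (seq nat * nat * rat)%type n is Some x then
    [set w | (f x.1 w < (ratr x.2)%:E)%E] else set0.

Definition qlev (T : Type) (f : seq nat * nat -> T -> \bar R) n : T -> R[i] :=
  qsimple_enum R (levset f) n.

(** A value of [qlev] depends only on the values of [f] at the point, even across different spaces;
    this links the versions on [T], on the parameter space times [T], and on the space of set
    functions. *)
Lemma qlev_ext (T T' : Type) (f : seq nat * nat -> T -> \bar R) (g : seq nat * nat -> T' -> \bar R)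
  n w w' : (forall i, f i w = g i w') -> qlev f n w = qlev g n w'.
Proof.
move=> fg; apply: eq_bigr => y _; congr (_ * _); rewrite /cindic !indicE.
have E i : levset f i w <-> levset g i w'.
  by rewrite /levset; case: unpickle => // x; rewrite /= fg.
congr ((nat_of_bool _)%:R%:C)%C; apply/idP/idP => /set_mem h; apply/mem_set => i iy;
  by apply/E; exact: h.
Qed.

Lemma measurable_levset d (T : measurableType d) (f : seq nat * nat -> T -> \bar R) n :
  (forall i, measurable_fun setT (f i)) -> measurable (levset f n).
Proof.
move=> mf; rewrite /levset; case: unpickle => // x.
have := mf x.1 measurableT `]-oo, (ratr x.2 : R)%:E[%classic (emeasurable_itv _).
by rewrite setTI; congr measurable; apply/seteqP; split=> w; rewrite /= in_itv.
Qed.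

Lemma levset_sys (T : Type) (f : seq nat * nat -> T -> \bar R) i :
  sys_measurable <<s range (levset f)>> measurable (f i).
Proof.
apply: ereal_rat_measurable; first exact: smallest_sigma_algebra.
move=> q; apply: sub_gen_smallest; exists (pickle (i, q)) => //.
by rewrite /levset pickleK.
Qed.

Lemma measurable_qlev d (T : measurableType d) (f : seq nat * nat -> T -> \bar R) n :
  (forall i, measurable_fun setT (f i)) -> cmeasurable measurable (qlev f n).
Proof.
move=> mf; apply: (cmeasurable_sub _ (@measurable_qsimple d T R (levset f) _)).
by apply: smallest_sub_measurable => _ [k _ <-]; exact: measurable_levset.
Qed.

Lemma qlev_bound n : exists M : R, forall (T : Type) (f : seq nat * nat -> T -> \bar R) w,
  `|complex.Re (qlev f n w)| <= M /\ `|complex.Im (qlev f n w)| <= M.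
Proof. by exists (qbound R (odflt [::] (unpickle n))) => T f w; exact: qsimple_bound. Qed.

Lemma qlev_L2pred d (T : measurableType d) (P : probability T R)
  (f : seq nat * nat -> T -> \bar R) n :
  (forall i, measurable_fun setT (f i)) -> qlev f n \in L2pred P.
Proof.
move=> mf; have [M hM] := qlev_bound n.
by apply: (@bounded_L2pred _ _ _ P _ M); [exact: measurable_qlev|move=> x; case: (hM _ f x)..].
Qed.

Context d (T : measurableType d) (P : probability T R).
Context dS (S : measurableType dS) (GS : nat -> set S).
Hypothesis GSE : @measurable _ S = <<s range GS>>.
Context (mu : T -> set S -> \bar R).
Hypotheses (mmu : forall C, measurable C -> measurable_fun setT (mu ^~ C))
  (mu_bigcup : forall w F, (forall n, measurable (F n)) -> trivIset setT F ->
    mu w (\bigcup_n F n) = (\sum_(n <oo) mu w (F n))%E)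
  (mu_ge0 : forall w C, (0 <= mu w C)%E)
  (muU : forall w A B, measurable A -> measurable B -> A `&` B = set0 ->
    mu w (A `|` B) = (mu w A + mu w B)%E).
Context (cov : nat -> set S).
Hypotheses (mcov : forall k, measurable (cov k)) (covT : \bigcup_k cov k = setT)
  (cov_fin : forall k, {ae P, forall w, (mu w (cov k) < +oo)%E}).
Context (f : seq nat * nat -> T -> \bar R).
Hypotheses (mf : forall i, measurable_fun setT (f i))
  (fmu : forall i, {ae P, forall w, f i w = mu w (capseq GS i.1 `&` cov i.2)}).

Let mlev : range (levset f) `<=` measurable.
Proof. by move=> _ [n _ <-]; exact: measurable_levset. Qed.

(** Up to null sets, [ae_gen_additive] puts the events of [H] into the sigma-algebra of the
    countably many level sets, over which rational step functions are dense. *)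
Lemma qlev_dense (H : set (set T)) u :
  (forall B, H B -> exists C A, [/\ measurable C, measurable A & B = [set w | A (mu w C)]]) ->
  u \in L2meas P H ->
  forall e : R, 0 < e -> exists n, hnorm (L2dot P) (u - toL2 P (qlev f n)) < e.
Proof.
move=> HE uH; have Hm : H `<=` measurable.
  by move=> B /HE[C [A [mC mA ->]]]; rewrite -[X in measurable X]setTI; exact: mmu.
have sub : <<s H>> `<=` ae_gen P (range (levset f)).
  apply: smallest_sub; first exact: sigma_algebra_ae_gen.
  move=> B /HE[C [A [mC mA ->]]].
  apply: (ae_gen_additive GSE mmu mu_bigcup mu_ge0 muU mcov covT cov_fin _ mC mA) => s k.
  apply: (ae_gen_ae _ _ (fmu (s, k))).
    by apply: mmu; apply: measurableI => //; exact: (measurable_capseqS GSE).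
  by move=> B' mB'; apply: (ae_gen_sub P mlev); exact: levset_sys.
have [g [mg gL ug]] := L2meas_rep Hm uH.
have uL : u \in L2meas P (range (levset f)).
  by rewrite ug; apply: L2meas_ae_gen => //; exact: cmeasurable_sub mg.
have [g' [mg' gL' ->]] := L2meas_rep mlev uL.
have mV n : measurable (levset f n) by exact: measurable_levset.
exact: (qsimple_dense mV).
Qed.

End level_sets.

(** * Measurable dependence on the parameter *)

Section shift_measurability.
Context (R : realType) (d : nat) (P : set 'rV[R]_d).
Hypotheses (P_convex : convex_set P)
  (P_cone : forall (t : R) a, 0 <= t -> P a -> P (t *: a))
  (P_pointed : P `&` [set a | P (- a)] = [set 0]).
Context dY (Y : measurableType dY) (act : 'rV[R]_d -> Y -> Y).
Hypotheses (act0 : forall y, act 0 y = y)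
  (actD : forall a b y, act (a + b) y = act a (act b y))
  (act_measurable : sys_measurable (sys_prod (@borel 'rV[R]_d) (@measurable dY Y))
      (@measurable dY Y) (fun ay => act ay.1 ay.2)).
Context (rho0 : {sigma_finite_measure set Y -> \bar R}).
Hypothesis rho0_invariant : forall a B, measurable B -> rho0 (translate act B a) = rho0 B.
Context (X : set Y) (X_measurable : measurable X).
Hypothesis X_shift : forall a, P a -> translate act X a `<=` X.
Context (nu : {measure set (posR R) -> \bar R}).
Hypothesis nu_levy : (\int[nu]_r (Num.min (pos_val r) 1)%:E < +oo)%E.
Context dO (T : measurableType dO) (Pr : probability T R).
Local Notation Z := (Y * posR R)%type.
Context (eta : T -> {measure set Z -> \bar R}).
Hypothesis poi : poisson_process Pr (rho0 \x nu)%E eta.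
Hypothesis Omega_gen : @measurable dO T = complete_gen Pr (eta_gen eta).
Context (G : nat -> set Y).
Hypothesis GE : @measurable dY Y = <<s range G>>.
Local Notation xi := (compound_poisson eta).
Local Notation toL2 := (toL2 Pr).
Local Notation L2p := (L2pred Pr).
Local Notation dot := (L2dot Pr).
Local Notation N := (hnorm (L2dot Pr)).
Local Notation U := (ush act poi Omega_gen).
Let ip := L2_inner_product Pr.
Let U_lin := ush_lin act0 actD act_measurable rho0_invariant nu_levy poi Omega_gen.
Let U_dot := ush_dot act0 actD act_measurable rho0_invariant nu_levy poi Omega_gen.
Let mtr := measurable_translate act0 actD act_measurable.
Let mxi_gen D : xi_gen eta D `<=` measurable := xi_gen_measurable poi (D := D).

Local Notation rVb := (g_sigma_algebraType (@open 'rV[R]_d)).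
Local Notation L2b := (sys_type (0 : L2 Pr) (hopen dot)).
Local Notation hmeas f := (sys_measurable measurable (hborel dot) f).
Local Notation e0_ := (eta0 rho0 eta).
Let pp := poisson_point_process poi.

Definition mark_gen : nat -> set Z := projT1 (cid (countably_generated_marked R GE)).

Lemma mark_genE : @measurable _ Z = <<s range mark_gen>>.
Proof. by rewrite /mark_gen; case: cid. Qed.

Definition cell (i : seq nat * nat) : set Z := capseq mark_gen i.1 `&` cover rho0 i.2.

Lemma measurable_cell i : measurable (cell i).
Proof.
apply: measurableI; first exact: (measurable_capseqS mark_genE).
exact: measurable_cover.
Qed.

Definition base_fun (i : seq nat * nat) (x : rVb * T) : \bar R := e0_ x.2 (ztr act x.1 (cell i)).

Lemma measurable_oppV : measurable_fun setT (fun a : rVb => (- (a : 'rV[R]_d)) : rVb).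
Proof.
apply: (@measurability _ _ _ rVb setT _ (@open 'rV[R]_d)) => //.
move=> _ [B oB <-]; rewrite setTI; apply: sub_sigma_algebra.
by apply: open_comp => // x _; exact: opp_continuous.
Qed.

Lemma measurable_base_fun i : measurable_fun setT (base_fun i).
Proof.
pose D : set (rVb * Z) := (fun x => (act (- x.1) x.2.1, x.2.2)) @^-1` cell i.
have mD : measurable D.
  have m : measurable_fun setT (fun x : rVb * Z => (act (- x.1) x.2.1, x.2.2)).
    apply: measurable_fun_pair; last exact: (measurableT_comp measurable_snd measurable_snd).
    have mp : measurable_fun setT (fun x : rVb * Z => ((- (x.1 : 'rV[R]_d)) : rVb, x.2.1)).
      apply: measurable_fun_pair; first exact: (measurableT_comp measurable_oppV measurable_fst).
      exact: (measurableT_comp measurable_fst measurable_snd).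
    exact: (measurableT_comp (measurable_act act_measurable) mp).
  by rewrite -[X in measurable X]setTI; apply: m => //; exact: measurable_cell.
have := @measurable_eta0_section _ _ _ _ _ _ _ _ _ poi _ rVb D mD.
congr (measurable_fun setT _); apply/funext => -[a w] /=; congr (eta0 _ _ _ _).
by apply/seteqP; split=> z; [move/xsectionP|move=> h; apply/xsectionP].
Qed.

Lemma ztr0 C : ztr act 0 C = C.
Proof. by apply/seteqP; split=> -[y r]; rewrite /ztr /= oppr0 act0. Qed.

(** For [a = 0] a dense sequence of L^2; in general its image under [U a], by [ush_sep], but given
    by a formula jointly measurable in [a] and the sample point. *)
Definition sep a n : L2 Pr := toL2 (qlev (fun i w => base_fun i (a, w)) n).

Lemma measurable_base_fun_at a i : measurable_fun setT (fun w => base_fun i (a, w)).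
Proof.
have h : measurable_fun setT (fun w : T => (a : rVb, w)) by exact: measurable_fun_pair.
exact: (measurableT_comp (measurable_base_fun i) h).
Qed.

Lemma sep_dense v (e : R) : 0 < e -> exists n, N (v - sep 0 n) < e.
Proof.
move=> e0; have vH : v \in L2meas Pr (eta_gen eta).
  elim/toL2W: v => f fL; rewrite inE /=; exists (MkL2fun fL); first exact: toL2E.
  by rewrite -Omega_gen; exact: (L2pred_cmeas fL).
apply: (qlev_dense mark_genE (mu := fun w C => eta w C) (cov := cover rho0) _ _ _ _ _ _ _ _ _ _ vH e0).
- by move=> C mC; exact: pp_measurable.
- by move=> w F mF tF; apply: measure_semi_bigcup => //; exact: bigcup_measurable.
- by move=> w C; exact: measure_ge0.
- by move=> w A B mA mB AB; apply: measureU.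
- by move=> k; exact: measurable_cover.
- exact: coverT.
- move=> k; have := eta_fin poi (measurable_cover rho0 k) (cover_fin rho0 nu_levy k).
  by apply: filterS => w [m ->]; rewrite ltry.
- exact: measurable_base_fun_at.
- by move=> i; apply: filterS (eta0_ae nu_levy poi) => w; rewrite /base_fun /= ztr0 => ->.
- by move=> _ [C mC [A mA <-]]; exists C, A.
Qed.

Lemma ush_sep a n : U a (sep 0 n) = sep a n.
Proof.
pose f (i : seq nat * nat) (e : cylType R (@measurable _ Z)) : \bar R := e (cell i).
have mf i : measurable_fun setT (f i) by apply: measurable_cyl_eval; exact: measurable_cell.
have mF := measurable_qlev n mf.
have meta := measurable_eta_map poi.
have LF : qlev f n \o eta_map eta \in L2p.
  have [M hM] := qlev_bound R n; apply: (@bounded_L2pred _ _ _ _ _ M).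
  - have /cmeasurable_funP[m1 m2] := mF; apply/cmeasurable_funP.
    by split; [exact: (measurableT_comp m1 meta)|exact: (measurableT_comp m2 meta)].
  - by move=> w; case: (hM _ f (eta_map eta w)).
  - by move=> w; case: (hM _ f (eta_map eta w)).
have pe := preserves_eshift act0 actD act_measurable rho0_invariant nu_levy poi.
have E b : toL2 (qlev f n \o (eshift act b \o eta_map eta)) = sep b n.
  apply/toL2_eqP.
  - exact: (law_L2pred meta (pe b) mF LF).
  - by apply: qlev_L2pred => i; exact: measurable_base_fun_at.
  - apply: filterS (eta0_ae nu_levy poi) => w we; apply: qlev_ext => i.
    by rewrite /f /eshift /eta_map /base_fun /= we.
have E0 : sep 0 n = toL2 (qlev f n \o eta_map eta).
  rewrite -E; congr (Defs.toL2 _ _); apply/funext => w /=; apply: qlev_ext => i.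
  by rewrite /f /eshift ztr0.
by rewrite E0 -E; exact: (koopE meta (pe a) _ mF LF).
Qed.

Lemma hmeas_qlev (f : seq nat * nat -> rVb * T -> \bar R) n :
  (forall i, measurable_fun setT (f i)) ->
  hmeas (fun a : rVb => toL2 (qlev (fun i w => f i (a, w)) n)).
Proof.
move=> mf; have mj := measurable_qlev n mf.
have E a : (fun w => qlev f n (a, w)) = qlev (fun i w => f i (a, w)) n.
  by apply/funext => w; apply: qlev_ext.
have LF a : (fun w => qlev f n (a, w)) \in L2p.
  rewrite E; apply: qlev_L2pred => i.
  have h : measurable_fun setT (fun w : T => (a : rVb, w)) by exact: measurable_fun_pair.
  exact: (measurableT_comp (mf i) h).
have := measurable_param_L2 sep_dense mj LF.
by under [X in sys_measurable _ _ X]eq_fun do rewrite E.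
Qed.

(** The error made by replacing the vector by [sep 0 n] does not depend on [a], because [U a] is
    isometric, and [U a (sep 0 n) = sep a n] depends measurably on [a]. *)
Lemma ush_joint_measurable : hmeas (fun x : rVb * L2b => U x.1 x.2).
Proof.
apply: (hmeas_nearest ip sep_dense (fn := fun n (x : rVb * L2b) => U x.1 (sep 0 n))
  (delta := fun n (x : rVb * L2b) => N ((x.2 : L2 Pr) - sep 0 n))).
- move=> n B hB; have := hmeas_qlev n measurable_base_fun hB => mS.
  rewrite (_ : _ @^-1` B = fst @^-1` ((fun a : rVb => sep a n) @^-1` B)).
    by rewrite -[X in measurable X]setTI; exact: measurable_fst.
  by apply/seteqP; split=> x /=; rewrite ush_sep.
- move=> n; have m : hmeas (fun x : rVb * L2b => (x.2 : L2 Pr)).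
    by move=> B hB; rewrite -[X in measurable X]setTI; exact: (@measurable_snd _ _ rVb L2b).
  exact: (hmeas_dist ip (sep 0 n) m).
- move=> n x; have -> : U x.1 (x.2 : L2 Pr) - U x.1 (sep 0 n) = U x.1 ((x.2 : L2 Pr) - sep 0 n).
    by rewrite -scaleN1r addrC -U_lin scaleN1r addrC.
  by rewrite /hnorm U_dot.
- by move=> x e e0; exact: sep_dense.
Qed.

Definition layer (a : 'rV[R]_d) : set Y := X `\` translate act X a.

Definition layer_cell (i : seq nat * nat) : set Y := capseq G i.1 `&` base_cover rho0 i.2.

Lemma measurable_layer a : measurable (layer a).
Proof. by apply: measurableD => //; exact: mtr. Qed.

Lemma measurable_layer_cell i : measurable (layer_cell i).
Proof.
by apply: measurableI; [exact: (measurable_capseqS GE)|exact: measurable_base_cover].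
Qed.

(** Built from [eta0] to be jointly measurable in [a] and the sample point; for fixed [a] it is
    almost surely the value of xi on the cell cut by the layer. *)
Definition layer_fun (i : seq nat * nat) (x : rVb * T) : \bar R :=
  kap (e0_ x.2) (layer_cell i `&` layer x.1).

Lemma measurable_layer_fun i : measurable_fun setT (layer_fun i).
Proof.
pose D : set (rVb * Y) := (snd @^-1` (layer_cell i `&` X)) `\` ((fun x => act (- x.1) x.2) @^-1` X).
have mD : measurable D.
  apply: measurableD; rewrite -[X in measurable X]setTI.
    by apply: measurable_snd => //; apply: measurableI => //; exact: measurable_layer_cell.
  have mp : measurable_fun setT (fun x : rVb * Y => ((- (x.1 : 'rV[R]_d)) : rVb, x.2)).
    by apply: measurable_fun_pair => //; exact: (measurableT_comp measurable_oppV measurable_fst).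
  exact: (measurableT_comp (measurable_act act_measurable) mp).
have := @measurable_marked_section _ _ _ _ _ _ _ _ _ poi _ rVb D mD.
congr (measurable_fun setT _); apply/funext => -[a w]; congr (marked _ _ _) => /=.
rewrite /layer (translateE act0 actD).
apply/seteqP; split=> y; first by move/xsectionP => -[[? ?] ?].
by move=> [? [? ?]]; apply/xsectionP; split.
Qed.

Lemma measurable_layer_fun_at a i : measurable_fun setT (fun w => layer_fun i (a, w)).
Proof.
have h : measurable_fun setT (fun w : T => (a : rVb, w)) by exact: measurable_fun_pair.
exact: (measurableT_comp (measurable_layer_fun i) h).
Qed.

Lemma layer_fun_ae a i : {ae Pr, forall w, layer_fun i (a, w) = xi (layer_cell i `&` layer a) w}.
Proof.
apply: filterS (eta0_ae nu_levy poi) => w we; rewrite /layer_fun /= we -[LHS]/(kap (eta_map eta w) _).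
by rewrite kapE //; apply: measurableI; [exact: measurable_layer_cell|exact: measurable_layer].
Qed.

Definition fsep a n : L2 Pr := toL2 (qlev (fun i w => layer_fun i (a, w)) n).

Lemma hmeas_fsep n : hmeas (fun a : rVb => fsep a n).
Proof. exact: hmeas_qlev measurable_layer_fun. Qed.

Lemma fsep_fibre a n : fsep a n \in L2meas Pr (xi_gen1 act X eta a).
Proof.
have Lq : qlev (fun i w => layer_fun i (a, w)) n \in L2p.
  by apply: qlev_L2pred => i; exact: measurable_layer_fun_at.
apply: L2meas_ae_gen => //; first exact: (@mxi_gen (layer a)).
apply: cmeasurable_sub (@measurable_qsimple _ T R (levset (fun i w => layer_fun i (a, w))) _).
apply: smallest_sub; first exact: sigma_algebra_ae_gen.
move=> _ [k _ <-]; rewrite /levset; case: unpickle => [[i q]|] /=; last first.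
  by case: (sigma_algebra_ae_gen Pr (xi_gen1 act X eta a)).
have h : sys_measurable (ae_gen Pr (xi_gen1 act X eta a)) measurable (fun w => layer_fun i (a, w)).
  have fm : {ae Pr, forall w, xi (layer_cell i `&` layer a) w = layer_fun i (a, w)}.
    by apply: filterS (layer_fun_ae a i) => w ->.
  apply: (ae_gen_ae _ _ fm); first exact: measurable_layer_fun_at.
  move=> B mB; apply: (ae_gen_sub Pr (@mxi_gen (layer a))); apply: sub_gen_smallest.
  exists (layer_cell i `&` layer a); last by exists B.
  split; last exact: subIsetr.
  by apply: measurableI; [exact: measurable_layer_cell|exact: measurable_layer].
have := h _ (emeasurable_itv `]-oo, (ratr q : R)%:E[).
by congr (ae_gen _ _ _); apply/seteqP; split=> w; rewrite /= in_itv.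
Qed.

(** An instance of [qlev_dense] for the random set function sending [C] to xi of [C] cut by the
    layer, almost surely finite on the sets of [base_cover]. *)
Lemma fsep_dense a u (e : R) : u \in L2meas Pr (xi_gen1 act X eta a) -> 0 < e ->
  exists n, N (u - fsep a n) < e.
Proof.
move=> uL e0.
pose mu w C := xi (C `&` layer a) w.
have ml C : measurable C -> measurable (C `&` layer a).
  by move=> mC; apply: measurableI => //; exact: measurable_layer.
apply: (qlev_dense GE (mu := mu) (cov := base_cover rho0) _ _ _ _ _ _ _ _ _ _ uL e0).
- by move=> C mC; apply: (measurable_compound poi); exact: ml.
- move=> w F mF tF; rewrite /mu setI_bigcupl compound_bigcup //.
    by move=> n; exact: ml.
  exact: trivIset_setIr.
- by move=> w C; exact: compound_ge0.
- move=> w A B mA mB AB; rewrite /mu setIUl (compoundU eta w) //; try exact: ml.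
  by apply/eqP; rewrite setIACA AB set0I.
- by move=> k; exact: measurable_base_cover.
- exact: base_coverT.
- move=> k; have mb := measurable_base_cover rho0 k.
  apply: filterS (compound_fin nu_levy poi mb (base_cover_fin rho0 k)) => w.
  apply: le_lt_trans; rewrite [leRHS](_ : _ = mu w (base_cover rho0 k) + xi (base_cover rho0 k `\` layer a) w)%E.
    by rewrite leeDl //; exact: compound_ge0.
  rewrite /mu -(compoundU eta w); first by rewrite setUIDK.
  + exact: ml.
  + by apply: measurableD => //; exact: measurable_layer.
  + by apply/eqP; rewrite setDE setIACA setICr setI0.
- by move=> i; exact: measurable_layer_fun_at.
- exact: layer_fun_ae.
- move=> _ [C [mC CX] [A mA <-]]; exists C, A; split=> //.
  by apply/seteqP; split=> w; rewrite /= /mu (setIidl CX).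
Qed.

Lemma bounded_mul_L2pred (h f : T -> R[i]) (M : R) : cmeasurable measurable h ->
  (forall x, `|complex.Re (h x)| <= M /\ `|complex.Im (h x)| <= M) ->
  f \in L2p -> (fun x => h x * f x) \in L2p.
Proof.
move=> /cmeasurable_funP[h1 h2] hM /L2predP[f1 f2]; apply/L2predP.
have key (k g : T -> R) : measurable_fun setT k -> (forall x, `|k x| <= M) -> rL2 Pr g ->
    rL2 Pr (fun x => k x * g x).
  move=> mk kM gL; apply: (rL2_le (g := fun x => M * g x)).
  - by apply: measurable_funM => //; case: gL.
  - exact: rL2Z.
  - by move=> x; rewrite !normrM ler_wpM2r // (le_trans (kM x)) // ler_norm.
split; [under eq_fun do rewrite cReM; apply: rL2B|under eq_fun do rewrite cImM; apply: rL2D];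
  by apply: key => // x; case: (hM x).
Qed.

Lemma conjc_L2pred (f : T -> R[i]) : f \in L2p -> (fun x => conjc (f x)) \in L2p.
Proof.
move=> /L2predP[f1 f2]; apply/L2predP; split.
  by under eq_fun do rewrite Re_conjc.
by under eq_fun do rewrite Im_conjc; exact: rL2N.
Qed.

Let H n : T -> R[i] := qlev (fun i w => base_fun i (0, w)) n.

Let HL n (f : T -> R[i]) : f \in L2p -> (fun x => H n x * conjc (f x)) \in L2p.
Proof.
move=> fL; have [M hM] := qlev_bound R n; apply: (@bounded_mul_L2pred _ _ M).
- by apply: measurable_qlev => i; exact: measurable_base_fun_at.
- by move=> x; exact: hM.
- exact: conjc_L2pred.
Qed.

(* The multiplier of the bounded function H n turns <h_n, f k> into an inner
   product of square integrable functions. *)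
Let mult n (k : L2 Pr) : L2 Pr := toL2 (fun x => H n x * conjc ((repr k : L2fun Pr) x)).

Let multE n f : f \in L2p -> mult n (toL2 f) = toL2 (fun x => H n x * conjc (f x)).
Proof.
move=> fL; apply/toL2_eqP; [exact/HL/L2fun_pred|exact: HL|].
by apply: filterS (toL2_ae fL) => x ->.
Qed.

(** Both sides are the integral of [conjc (H n) * k * f], which is symmetric in [f] and [k]. *)
Let multC n f k : dot (mult n k) f = dot (mult n f) k.
Proof.
elim/toL2W: f => f fL; elim/toL2W: k => k kL; rewrite (multE n kL) (multE n fL).
rewrite (L2dotE (HL n kL) fL) (L2dotE (HL n fL) kL).
congr cintegral; apply/funext => x; by rewrite !rmorphM /= !conjcK mulrAC.
Qed.

Let mult_mul n f k : L2mulable f k -> dot (sep 0 n) (L2mul f k) = dot (mult n k) f.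
Proof.
elim/toL2W: f => f fL; elim/toL2W: k => k kL; move=> /(L2mulableE fL kL) fk.
have HnL : H n \in L2p by apply: qlev_L2pred => i; exact: measurable_base_fun_at.
rewrite (multE n kL) (L2mul_toL2 fL kL fk) (L2dotE HnL fk) (L2dotE (HL n kL) fL).
congr cintegral; apply/funext => x; by rewrite !rmorphM /= !conjcK -mulrA [f x * _]mulrC.
Qed.

(** Square integrable functions cannot be multiplied continuously in L^2, so the product is tested
    weakly. For fixed [n], [mult_mul] writes the test as [dot (mult n (k x)) (f x)]; approximating
    [f x] by [sep 0 m] and exchanging roles by [multC] leaves a fixed vector paired with [k x]. *)
Lemma hmeas_L2mul dM (M : measurableType dM) (f k : M -> L2 Pr) : hmeas f -> hmeas k ->
  (forall x, L2mulable (f x) (k x)) -> hmeas (fun x => L2mul (f x) (k x)).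
Proof.
move=> mf mk fk; apply: (hmeas_weak ip sep_dense) => n.
apply: (@measurable_fun_nearest _ _ _ (fun m x => complex.Re (dot (mult n (sep 0 m)) (k x)))
  (fun m x => N (f x - sep 0 m))).
- by move=> m; exact: (hmeas_rdot ip (mult n (sep 0 m)) mk).
- by move=> m; exact: (hmeas_dist ip (sep 0 m) mf).
- by move=> x e e0; exact: sep_dense.
- move=> x s hs; rewrite (mult_mul n (fk x)).
  have cs : hcvg dot (fun j => sep 0 (s j)) (f x) by exact: hcvg_seq.
  have := hcvg_rdot ip (w := mult n (k x)) cs.
  by under eq_fun do rewrite multC.
Qed.

End shift_measurability.

(** * The Polish space containing the total space *)

Section polish_product.
Context (R : realType) (d : nat) (V : lmodType R[i]) (dot : V -> V -> R[i]).
Local Notation N u := (hnorm dot u).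

Definition hball (v : V) (e : R) : set V := [set w | N (w - v) < e].

Lemma hball_axioms : inner_product dot -> ball_axioms hball.
Proof.
move=> ip; split.
- by move=> v e e0; rewrite /hball /= subrr (hnorm0 ip).
- by move=> v w e; rewrite /hball /= (hnormBC ip).
- by move=> u v w e f uv vw; rewrite /hball /= (le_lt_trans (hnorm_dist ip v _ _)) // addrC ltrD.
- by move=> v e f ef w h; exact: lt_le_trans h ef.
Qed.

Lemma ball_axiomsE (Q : pseudoMetricType R) : ball_axioms (@ball R Q).
Proof.
split; [exact: ballxx|exact: ball_sym| |exact: le_ball].
by move=> x y z e f; exact: ball_triangle.
Qed.

Definition rat_rV (n : nat) : 'rV[R]_d :=
  if unpickle n is Some m then map_mx ratr (m : 'rV[rat]_d) else 0.

Lemma rat_rV_dense : ball_dense (@ball R 'rV[R]_d) rat_rV.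
Proof.
move=> x e e0; have h j : exists p : rat, `|x 0 j - ratr p| < e by exact: rat_approx.
have [f hf] := choice h; exists (pickle (\row_j f j)); rewrite /rat_rV pickleK.
split=> // i j; rewrite -ball_normE /= ord1 !mxE; exact: hf.
Qed.

Lemma ball_open_rV (x : 'rV[R]_d) e : open (ball x e).
Proof.
have [e0|e0] := ltP 0 e; first exact: ball_open.
rewrite (_ : ball x e = set0); first exact: open0.
by apply/seteqP; split=> // y [e0' _]; have := lt_le_trans e0' e0; rewrite ltxx.
Qed.

Lemma open_rVP (U : set 'rV[R]_d) : open U <-> forall x, U x -> exists2 e : R, 0 < e & ball x e `<=` U.
Proof.
rewrite openE; split=> h x Ux.
  by have /nbhs_ballP[e e0 eU] := h x Ux; exists e.
by apply/nbhs_ballP; have [e e0 eU] := h x Ux; exists e.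
Qed.

Lemma measurable_addV : sys_measurable (sys_prod (@borel 'rV[R]_d) (@borel 'rV[R]_d))
  (@borel 'rV[R]_d) (fun p => p.1 + p.2).
Proof.
apply: sys_measurable_gen; first exact: smallest_sigma_algebra.
move=> U oU; have mb n e : @borel 'rV[R]_d (ball (rat_rV n) e).
  by apply: sub_gen_smallest; exact: ball_open_rV.
have ax := ball_axiomsE 'rV[R]_d.
apply: (rect_measurable ax ax rat_rV_dense rat_rV_dense mb mb).
move=> x y /= Uxy; have [e e0 eU] := (open_rVP U).1 oU _ Uxy.
exists (e / 2); first by rewrite divr_gt0.
move=> [x' y'] [/= xx' yy']; apply: eU; move: xx' yy'; rewrite -!ball_normE /= => xx' yy'.
rewrite opprD addrACA (le_lt_trans (ler_normD _ _)) // [ltRHS](splitr e).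
by rewrite ltrD.
Qed.

End polish_product.

(** A copy of the product that retains the completeness proof, so that the instances declared on it
    can use it. *)
Definition polish (R : realType) (d : nat) (V : lmodType R[i]) (dot : V -> V -> R[i])
  (hV : hilbert dot) : Type := ('rV[R]_d * V)%type.

Section polish_structure.
Context (R : realType) (d : nat) (V : lmodType R[i]) (dot : V -> V -> R[i]) (hV : hilbert dot).
Local Notation Q := (polish d hV).
Local Notation N u := (hnorm dot u).
Let ip := hV.1.

Definition pball (x : Q) (e : R) : set Q := @ball R 'rV[R]_d x.1 e `*` hball dot x.2 e.

Lemma pball_axioms : ball_axioms pball.
Proof.
have [c1 s1 t1 m1] := ball_axiomsE 'rV[R]_d; have [c2 s2 t2 m2] := hball_axioms ip.
split.
- by move=> x e e0; split; [exact: c1|exact: c2].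
- by move=> x y e [h1 h2]; split; [exact: s1|exact: s2].
- by move=> x y z e f [h1 h2] [k1 k2]; split; [exact: t1 k1|exact: t2 k2].
- by move=> x e f ef y [h1 h2]; split; [exact: m1 h1|exact: m2 h2].
Qed.

HB.instance Definition _ := gen_eqMixin Q.
HB.instance Definition _ := gen_choiceMixin Q.
HB.instance Definition _ := isPointed.Build Q (0, 0).
HB.instance Definition _ := hasNbhs.Build Q (nbhs_ (entourage_ pball)).
HB.instance Definition _ := Nbhs_isPseudoMetric.Build R Q erefl
  (bs_center pball_axioms) (bs_sym pball_axioms) (bs_triangle pball_axioms) erefl.

(** The balls of centre [x n] and radius [1 / (n + 1)] in [F] meet pairwise, so the Hilbert
    components of the centres form a Cauchy sequence, to which sequential completeness applies; the
    first component converges by completeness of R^d. *)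
Lemma polish_complete (F : set_system Q) : ProperFilter F -> cauchy F -> cvg F.
Proof.
move=> FF /cauchyP Fc.
have Fc' n : exists x, F (@ball R Q x n.+1%:R^-1) by apply: Fc; rewrite invr_gt0 ltr0n.
have [x Fx] := choice Fc'.
have dist n m : N ((x m).2 - (x n).2) < n.+1%:R^-1 + m.+1%:R^-1.
  have [z [zn zm]] := filter_ex (filterI (Fx n) (Fx m)).
  have [_] := ball_triangle zn (ball_sym zm); exact.
have [l2 xl] : exists l, (fun n => N ((x n).2 - l)) @ \oo --> (0 : R).
  apply: hV.2 => e e0; have e2 : 0 < e / 2 by rewrite divr_gt0.
  have [k _ hk] := near_infty_natSinv_lt (PosNum e2).
  exists k => m n km kn; rewrite (lt_trans (dist n m)) // (splitr e) ltrD //.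
    exact: (hk n kn).
  exact: (hk m km).
have F1c : cauchy ((fun z : Q => z.1) @ F).
  apply/cauchyP => e e0; have [y Fy] := Fc e e0; exists y.1.
  have sub : ball y e `<=` [set z : Q | ball y.1 e z.1].
    by move=> z; rewrite -[ball y e z]/(pball y e z) => -[].
  exact: (filterS sub Fy).
have [l1 Fl] : exists l : 'rV[R]_d, (fun z : Q => z.1) @ F --> l by apply/cvg_ex; exact: cauchy_cvg.
apply/cvg_ex; exists ((l1, l2) : Q); apply/cvg_ballP => e e0.
have e2 : 0 < e / 2 by rewrite divr_gt0.
have F1 : F [set z : Q | ball l1 e z.1] by exact: (Fl _ (nbhsx_ballx l1 e e0)).
have [k _ hk] := near_infty_natSinv_lt (PosNum e2).
have [n [kn xn]] : exists n, (k <= n)%N /\ N ((x n).2 - l2) < e / 2.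
  have := hcvg_near xl e2 => -[m _ hm]; exists (maxn k m); split; first exact: leq_maxl.
  by apply: hm; exact: leq_maxr.
apply: filterS2 F1 (Fx n) => z z1 [_ z2]; split=> //.
rewrite /hball /= (le_lt_trans (hnorm_dist ip (x n).2 _ _)) // (splitr e) ltrD //.
by rewrite (lt_trans z2) //; exact: (hk n kn).
Qed.

HB.instance Definition _ := Uniform_isComplete.Build Q polish_complete.

Lemma open_polishP (U : set Q) : open U <-> rect_open (@ball R 'rV[R]_d) (hball dot) U.
Proof.
rewrite openE; split=> h.
  by move=> x y Uxy; have /nbhs_ballP[e e0 eU] := h (x, y) Uxy; exists e.
by move=> [x y] Uxy; apply/nbhs_ballP; have [e e0 eU] := h x y Uxy; exists e.
Qed.

Lemma hausdorff_polish : hausdorff_space Q.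
Proof.
move=> p q pq; have h (e : R) : 0 < e -> exists z : Q, ball p e z /\ ball q e z.
  by move=> e0; have [z [zp zq]] := pq _ _ (nbhsx_ballx p e e0) (nbhsx_ballx q e e0); exists z.
have h1 : p.1 = q.1.
  apply: (@norm_hausdorff _ 'rV[R]_d) => A B /nbhs_ballP[e e0 eA] /nbhs_ballP[f f0 fB].
  have m0 : 0 < Num.min e f by rewrite lt_min e0.
  have [z [[z1 _] [z2 _]]] := h _ m0; exists z.1; split.
    by apply: eA; apply: le_ball z1; rewrite ge_min lexx.
  by apply: fB; apply: le_ball z2; rewrite ge_min lexx orbT.
have h2 : p.2 = q.2.
  apply/eqP; rewrite -subr_eq0; apply/eqP/(hnorm0_eq0 ip)/eqP.
  rewrite eq_le (hnorm_ge0 dot) andbT; apply/ler_addgt0Pr => e e0; rewrite add0r.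
  have [z [[_ z1] [_ z2]]] := h (e / 2) (divr_gt0 e0 (ltr0Sn R 1)).
  apply/ltW/(le_lt_trans (hnorm_dist ip z.2 _ _)); rewrite (splitr e) ltrD //.
  by rewrite (hnormBC ip).
by case: p q h1 h2 {pq h} => [? ?] [? ?] /= -> ->.
Qed.

Context (q : nat -> V) (q_dense : forall v (e : R), 0 < e -> exists n, N (v - q n) < e).

Let hdense : ball_dense (hball dot) q.
Proof. by move=> v e /(q_dense v)[n vn]; exists n; rewrite /hball /= (hnormBC ip). Qed.

Let rect := basic_rect (@ball R 'rV[R]_d) (hball dot) (rat_rV R d) q.

Let rect_basicP (U : set Q) x : open U -> U x -> exists2 i, rect i x & rect i `<=` U.
Proof.
move=> /open_polishP oU; case: x => x y Uxy.
exact: (basic_rectP (ball_axiomsE _) (hball_axioms ip) (@rat_rV_dense R d) hdense oU Uxy).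
Qed.

Let rect_is_open i : open (rect i : set Q).
Proof.
apply/open_polishP => x y [/= xb yb].
have [e e0 eb] := (open_rVP _).1 (@ball_open_rV R d _ _) _ xb.
have [f f0 fb] := @hopen_ball _ _ _ ip (q i.1.2) i.2.+1%:R^-1 _ yb.
exists (Num.min e f); first by rewrite lt_min e0.
move=> [x' y'] [/= h1 h2]; split.
  by apply: eb; apply: le_ball h1; rewrite ge_min lexx.
by apply: fb; apply: lt_le_trans h2 _; rewrite ge_min lexx orbT.
Qed.

Lemma second_countable_polish : @second_countable Q.
Proof.
exists (range (rect : _ -> set Q)).
  by apply: sub_countable (card_image_le _ _) _; exact: countableP.
split; first by move=> _ [i _ <-]; exact: rect_is_open.
move=> x A /nbhs_interior Ax.
have [i ix iA] := rect_basicP (open_interior A) (nbhs_singleton Ax).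
exists (rect i); first by split=> //; exists i.
by move=> z /iA; exact: interior_subset.
Qed.

(** One inclusion uses separability, through countable unions of rectangles; the other only
    continuity of the two projections. *)
Lemma borel_polish : @borel Q = sys_prod (@borel 'rV[R]_d) (hborel dot).
Proof.
apply/seteqP; split.
  apply: smallest_sub; first exact: smallest_sigma_algebra.
  move=> U /open_polishP oU.
  apply: (rect_measurable (ball_axiomsE _) (hball_axioms ip) (@rat_rV_dense R d) hdense _ _ oU).
    by move=> n e; apply: sub_gen_smallest; exact: ball_open_rV.
  by move=> n e; apply: sub_gen_smallest; exact: hopen_ball.
apply: smallest_sub; first exact: smallest_sigma_algebra.
move=> _ [A mA [B mB <-]].
have sQ : sigma_algebra setT (@borel Q) by exact: smallest_sigma_algebra.
have m1 : sys_measurable (@borel Q) (@borel 'rV[R]_d) fst.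
  apply: sys_measurable_gen => // U /open_rVP oU; apply: sub_gen_smallest.
  apply/open_polishP => x y /= Ux; have [e e0 eU] := oU _ Ux.
  by exists e => // z [/= /eU].
have m2 : sys_measurable (@borel Q) (hborel dot) snd.
  apply: sys_measurable_gen => // U oU; apply: sub_gen_smallest.
  apply/open_polishP => x y /= Uy; have [e e0 eU] := oU _ Uy.
  by exists e => // z [/= _ /eU].
exact: (sigma_algebraI sQ (m1 A mA) (m2 B mB)).
Qed.

End polish_structure.

(** * The product system *)

Section product_system_measurability.
Context (R : realType) (d : nat) (P : set 'rV[R]_d).
Hypotheses (P_closed : closed P) (P_convex : convex_set P)
  (P_cone : forall (t : R) a, 0 <= t -> P a -> P (t *: a))
  (P_pointed : P `&` [set a | P (- a)] = [set 0]).
Context dY (Y : measurableType dY) (act : 'rV[R]_d -> Y -> Y).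
Hypotheses (act0 : forall y, act 0 y = y)
  (actD : forall a b y, act (a + b) y = act a (act b y))
  (act_measurable : sys_measurable (sys_prod (@borel 'rV[R]_d) (@measurable dY Y))
      (@measurable dY Y) (fun ay => act ay.1 ay.2)).
Context (rho0 : {sigma_finite_measure set Y -> \bar R}).
Hypothesis rho0_invariant : forall a B, measurable B -> rho0 (translate act B a) = rho0 B.
Context (X : set Y) (X_measurable : measurable X).
Hypothesis X_shift : forall a, P a -> translate act X a `<=` X.
Context (nu : {measure set (posR R) -> \bar R}).
Hypothesis nu_levy : (\int[nu]_r (Num.min (pos_val r) 1)%:E < +oo)%E.
Context dO (T : measurableType dO) (Pr : probability T R).
Local Notation Z := (Y * posR R)%type.
Context (eta : T -> {measure set Z -> \bar R}).
Hypothesis poi : poisson_process Pr (rho0 \x nu)%E eta.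
Hypothesis Omega_gen : @measurable dO T = complete_gen Pr (eta_gen eta).
Context (G : nat -> set Y).
Hypothesis GE : @measurable dY Y = <<s range G>>.
Local Notation dot := (L2dot Pr).
Local Notation N := (hnorm (L2dot Pr)).
Local Notation U := (ush act poi Omega_gen).
Let ip := L2_inner_product Pr.
Let mxi_gen D : xi_gen eta D `<=` measurable := xi_gen_measurable poi (D := D).
Local Notation rVb := (g_sigma_algebraType (@open 'rV[R]_d)).
Local Notation L2b := (sys_type (0 : L2 Pr) (hopen dot)).
Local Notation hmeas f := (sys_measurable measurable (hborel dot) f).
Local Notation E := (cpp_fibre P act X Pr eta).
Local Notation mul := (cpp_mul P act X Pr eta).
Local Notation SE := (cpp_sigma P act X Pr eta).
Local Notation Fib a := (L2meas Pr (xi_gen1 act X eta a)).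
Local Notation fs := (fsep act rho0 X Pr eta G).
Let mulP := cpp_mul_val P_convex P_cone P_pointed act0 actD act_measurable rho0_invariant
  X_measurable X_shift nu_levy poi Omega_gen.
Let ush_joint := @ush_joint_measurable _ _ _ _ _ act0 actD act_measurable _ rho0_invariant _ nu_levy _ _ _ _ poi Omega_gen _ GE.
Let sepD := sep_dense act0 act_measurable nu_levy poi Omega_gen GE.
Let fsF a n : fs a n \in Fib a := fsep_fibre act0 actD act_measurable X_measurable nu_levy poi GE a n.
Let fsD a u e := @fsep_dense _ _ _ _ _ act0 actD act_measurable _ _ X_measurable _ nu_levy _ _ _ _ poi _ GE a u e.
Let hfs n := @hmeas_fsep _ _ _ _ _ act0 actD act_measurable _ _ X_measurable _ nu_levy _ _ _ _ poi Omega_gen _ GE n.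
Let EV (a : P) (u : E a) : (val u : L2 Pr) \in Fib (val a). Proof. exact: valP. Qed.

Let p0 : P := SigSub (mem_set (cone0 P_pointed)).
Let x0 : {a : P & E a} := Tagged E (0 : E p0).
Local Notation Pb := (sys_type p0 (borel_cone P)).
Local Notation Eb := (sys_type x0 SE).

Let sP : sigma_algebra setT (borel_cone P).
Proof. by apply: sigma_algebra_preimage_sys; exact: smallest_sigma_algebra. Qed.

Let sE : sigma_algebra setT SE.
Proof. by apply: sigma_algebra_preimage_sys; exact: smallest_sigma_algebra. Qed.

Let PbE : @measurable _ Pb = borel_cone P. Proof. exact: sys_type_measurable. Qed.
Let EbE : @measurable _ Eb = SE. Proof. exact: sys_type_measurable. Qed.

Let m_val : sys_measurable (borel_cone P) (@borel 'rV[R]_d) (fun a : P => val a).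
Proof. by move=> B mB; exists B => //; rewrite setTI. Qed.

Let m_tag : sys_measurable SE (@borel 'rV[R]_d) (fun x => val (tag x)).
Proof. by move=> B /m_val; exact: cpp_proj_measurable. Qed.

Let m_tagged : sys_measurable SE (hborel dot) (fun x => val (tagged x) : L2 Pr).
Proof.
move=> B mB; exists (setT `*` B); last by rewrite setTI; apply/seteqP; split=> x /=; [case|split].
apply: sub_gen_smallest; exists setT; last by exists B.
by exists setT; [apply: sub_gen_smallest; exact: openT|rewrite setTI preimage_setT].
Qed.

Let to_SE (W : Type) (S : set (set W)) (g : W -> {a : P & E a}) : sigma_algebra setT S ->
  sys_measurable S (@borel 'rV[R]_d) (fun x => val (tag (g x))) ->
  sys_measurable S (hborel dot) (fun x => val (tagged (g x)) : L2 Pr) ->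
  sys_measurable S SE g.
Proof.
move=> sS g1 g2 _ [C mC <-]; rewrite setTI.
apply: (sys_measurable_pair (f := fun x => tag (g x)) (g := fun x => val (tagged (g x)) : L2 Pr)
  sS _ g2 mC).
by move=> _ [B mB <-]; rewrite setTI; exact: g1.
Qed.

Let EEbE : @measurable _ (Eb * Eb)%type = sys_prod SE SE.
Proof. by rewrite measurable_prod_measurableType EbE. Qed.

Let SET : SE setT.
Proof. by case: sE => S0 SC _; rewrite -(setD0 setT); exact: SC. Qed.

Lemma cpp_mul_measurable : sys_measurable (sys_prod SE SE) SE (fun xy => mul xy.1 xy.2).
Proof.
have sEE : sigma_algebra setT (sys_prod SE SE) by exact: smallest_sigma_algebra.
have m1 : sys_measurable (sys_prod SE SE) SE fst.
  move=> B SB; apply: sub_gen_smallest; exists B => //; exists setT => //.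
  by apply/seteqP; split=> x /=; [case|split].
have m2 : sys_measurable (sys_prod SE SE) SE snd.
  move=> B SB; apply: sub_gen_smallest; exists setT => //; exists B => //.
  by apply/seteqP; split=> x /=; [case|split].
apply: to_SE => //.
  rewrite (_ : (fun x => _) = fun xy : _ * _ => val (tag xy.1) + val (tag xy.2)); last first.
    by apply/funext => -[x y]; have [] := mulP x y.
  have mp : sys_measurable (sys_prod SE SE) (sys_prod (@borel 'rV[R]_d) (@borel 'rV[R]_d))
      (fun xy : _ * _ => (val (tag xy.1), val (tag xy.2))).
    by apply: sys_measurable_pair => // B /m_tag; [exact: m1|exact: m2].
  exact: (sys_measurable_comp mp (@measurable_addV R d)).
rewrite (_ : (fun x => _) = fun xy : {a : P & E a} * {a : P & E a} => L2mul (val (tagged xy.1) : L2 Pr)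
    (U (val (tag xy.1)) (val (tagged xy.2)))); last first.
  by apply/funext => -[x y]; have [] := mulP x y.
rewrite -EEbE; apply: (@hmeas_L2mul _ _ _ _ _ act0 act_measurable _ _ nu_levy _ _ _ _ poi Omega_gen _ GE
  _ (Eb * Eb)%type (fun xy : Eb * Eb => val (tagged xy.1) : L2 Pr)
  (fun xy : Eb * Eb => U (val (tag xy.1)) (val (tagged xy.2)))).
- by rewrite EEbE => B /m_tagged; exact: m1.
- have mp : sys_measurable (@measurable _ (Eb * Eb)%type) (@measurable _ (rVb * L2b)%type)
      (fun xy : Eb * Eb => (val (tag xy.1) : rVb, val (tagged xy.2) : L2b)).
    rewrite [X in sys_measurable _ X]measurable_prod_measurableType EEbE.
    apply: sys_measurable_pair => //.
      by move=> B /m_tag; exact: m1.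
    by move=> B /m_tagged; exact: m2.
  exact: (sys_measurable_comp mp ush_joint).
- move=> xy; exact: (fibre_mulable act0 actD act_measurable rho0_invariant X_measurable
    nu_levy poi Omega_gen (EV _) (EV _)).
Qed.

(** The first component of a section is the inclusion of [P], which is always measurable, so only
    the vector component matters. *)
Lemma msectionP (s : forall a : P, E a) : msection SE s <->
  sys_measurable (borel_cone P) (hborel dot) (fun a => val (s a) : L2 Pr).
Proof.
split=> ms; first by move=> B /m_tagged; exact: ms.
by apply: to_SE.
Qed.

Let hsec (s : forall a : P, E a) : msection SE s -> hmeas (fun a : Pb => val (s a) : L2 Pr).
Proof. by move=> /msectionP ms; rewrite PbE. Qed.

Let hsecV (s : forall a : P, E a) : hmeas (fun a : Pb => val (s a) : L2 Pr) -> msection SE s.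
Proof. by rewrite PbE => /msectionP. Qed.

Let cmeasPb (f : P -> R[i]) : cmeasurable (borel_cone P) f <->
  measurable_fun (setT : set Pb) (fun a => complex.Re (f a)) /\
  measurable_fun (setT : set Pb) (fun a => complex.Im (f a)).
Proof.
have h (g : P -> R) : sys_measurable (borel_cone P) measurable g <-> measurable_fun (setT : set Pb) g.
  split=> [mg _ B mB|mg B mB]; first by rewrite setTI PbE; exact: mg.
  by have := mg measurableT B mB; rewrite setTI PbE.
by split=> -[h1 h2]; split; exact/h.
Qed.

Definition fsec n (a : P) : E a := MkL2sub (fsF (val a) n).

Let hfsec n : hmeas (fun a : Pb => val (fsec n a) : L2 Pr).
Proof. by rewrite PbE => B /(hfs n) /= h; exact: (m_val h). Qed.

Lemma fsec_dense (a : P) (v : E a) (e : R) : 0 < e ->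
  exists n, hnorm (cpp_dot P act X Pr eta (a := a)) (v - fsec n a) < e.
Proof. by move=> e0; have [n vn] := fsD (EV v) e0; exists n. Qed.

Lemma cpp_field : measurable_field (cpp_dot P act X Pr eta) SE.
Proof.
split.
- by apply: hsecV; exact: (hmeas_cst ip sepD Pb 0).
- by move=> c s t /hsec ms /hsec mt; apply: hsecV; exact: (hmeas_lin ip sepD c ms mt).
- move=> s t /hsec ms /hsec mt; apply/cmeasPb; split.
    exact: (hmeas_rdot2 ip sepD ms mt).
  have mt' : hmeas (fun a : Pb => 'i%C *: (val (t a) : L2 Pr) + 0).
    exact: (hmeas_lin ip sepD 'i%C mt (hmeas_cst ip sepD Pb 0)).
  have := hmeas_rdot2 ip sepD ms mt' => m.
  have := measurable_funN m; congr (measurable_fun setT _); apply/funext => a.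
  by rewrite /cpp_dot (Im_dot ip) /= addr0.
(* Only inner products with measurable sections are known to be measurable. Duality within each
   fibre against the dense [fsec m] gives the norm of [t a], polarisation then gives the distances
   to [fsec n a], and [hmeas_nearest] concludes. *)
- move=> t ht; apply: hsecV.
  have mr n : measurable_fun (setT : set Pb) (fun a => complex.Re (dot (val (fsec n a)) (val (t a)))).
    have /ht/cmeasPb[m _] := hsecV (hfsec n).
    by under eq_fun do rewrite (rdotC ip).
  have mN n : measurable_fun (setT : set Pb) (fun a => N (val (fsec n a))).
    have := hmeas_dist ip 0 (hfsec n); congr (measurable_fun setT _); apply/funext => a.
    by rewrite subr0.
  have mt : measurable_fun (setT : set Pb) (fun a => N (val (t a))).
    apply/sys_measurable_funP; apply: real_rat_measurable; first exact: sigma_algebra_measurable.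
    move=> q.
    (* A norm below [q] is at most some rational [p] below [q], and a norm bound by [p] is a
       countable conjunction by [hnorm_le_dense] in the fibre. *)
    rewrite (_ : mkset _ = \bigcup_(p in [set p : rat | 0 <= (ratr p : R) /\ ratr p < (ratr q : R)])
      \bigcap_m [set a | complex.Re (dot (val (fsec m a)) (val (t a))) - ratr p * N (val (fsec m a)) <= 0]).
      apply: sigma_algebra_countable; first exact: sigma_algebra_measurable.
      move=> p; apply: (@bigcap_measurableType _ Pb) => m _.
      have mm : measurable_fun (setT : set Pb) (fun a =>
          complex.Re (dot (val (fsec m a)) (val (t a))) - ratr p * N (val (fsec m a))).
        by apply: measurable_funB => //; apply: measurable_funM.
      have := mm measurableT `]-oo, 0%R]%classic (measurable_itv _).
      by rewrite setTI; congr measurable; apply/seteqP; split=> a; rewrite /= in_itv.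
    have ipE (a : P) : inner_product (cpp_dot P act X Pr eta (a := a)) by exact: (cpp_hilbert act X poi a).1.
    have le_p (a : P) (p : rat) : 0 <= (ratr p : R) -> (N (val (t a)) <= ratr p <->
        forall m, complex.Re (dot (val (fsec m a)) (val (t a))) <= ratr p * N (val (fsec m a))).
      exact: (hnorm_le_dense (ipE a) (@fsec_dense a) (t a)).
    apply/seteqP; split=> a /=.
      move=> h; have [p] := rat_in_itvoo h; rewrite in_itv /= => /andP[p1 p2].
      have p0' : 0 <= (ratr p : R) by rewrite (le_trans (hnorm_ge0 dot (val (t a)))) // ltW.
      exists p => // m _ /=; rewrite subr_le0; exact: ((le_p a p p0').1 (ltW p1)).
    move=> [p [p1 p2] hp]; apply: le_lt_trans p2; apply/(le_p a p p1) => m.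
    by have := hp m Logic.I; rewrite /= subr_le0.
  have md n : measurable_fun (setT : set Pb) (fun a => N ((val (t a) : L2 Pr) - val (fsec n a))).
    have E a : N ((val (t a) : L2 Pr) - val (fsec n a)) = Num.sqrt (N (val (t a)) ^+ 2 -
        2 * complex.Re (dot (val (fsec n a)) (val (t a))) + N (val (fsec n a)) ^+ 2).
      by rewrite (rdotC ip) -(hnormB_sqr ip) sqrtr_sqr ger0_norm // (hnorm_ge0 dot).
    under eq_fun do rewrite E.
    apply: (measurableT_comp (continuous_measurable_fun (@sqrt_continuous R))).
    apply: measurable_funD; last exact: measurable_funX.
    by apply: measurable_funB; [exact: measurable_funX|exact: measurable_funM].
  apply: (hmeas_nearest ip sepD hfsec md) => // a e e0.
  exact: fsD (EV (t a)) e0.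
- exists fsec; split=> [n|a v e e0]; first exact: hsecV.
  have [n vn] := fsec_dense v e0.
  exists 1%N, (fun=> 1), (fun=> fsec n a); split=> [_|]; first by exists n.
  by rewrite big_ord1 scale1r.
Qed.

Lemma cpp_standard : standard_borel R SE.
Proof.
pose Q := polish d (L2_hilbert Pr).
pose f (x : {a : P & E a}) : Q := (val (tag x), val (tagged x) : L2 Pr).
have bQ := borel_polish d (L2_hilbert Pr) sepD.
exists Q, f; split.
- exact: hausdorff_polish.
- exact: (second_countable_polish d (L2_hilbert Pr) sepD).
- by move=> x y [xy1 xy2]; apply: cpp_ext.
- rewrite bQ; have ME : @measurable _ (rVb * L2b)%type = sys_prod (@borel 'rV[R]_d) (hborel dot).
    by rewrite measurable_prod_measurableType.
  rewrite -ME.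
  (* The fibre over [a] is the closure of the [fs a n], so lying in it means being, for every [k],
     at distance less than [1 / (k + 1)] from some [fs a n]; each such condition is measurable in
     the pair. *)
  have -> : range f = (fst @^-1` P) `&` \bigcap_k \bigcup_n
      [set x : rVb * L2b | N ((x.2 : L2 Pr) - fs x.1 n) < k.+1%:R^-1].
    apply/seteqP; split=> [_ [[a v] _ <-]|[a v] [/= Pa hv]].
      split=> /=; first exact: set_mem (valP a).
      move=> k _; have [n vn] := fsD (EV v) (ltac:(by rewrite invr_gt0 ltr0n) : 0 < k.+1%:R^-1).
      by exists n.
    have vF : v \in Fib a.
      apply: (cs_closed (L2meas_closed_subspace Pr (@mxi_gen (X `\` translate act X a)))) => e e0.
      have [k _ hk] := near_infty_natSinv_lt (PosNum e0).
      have [n _ vn] := hv k Logic.I; exists (fs a n); first exact: fsF.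
      by apply: lt_trans vn _; exact: (hk k (leqnn k)).
    by exists (Tagged E (MkL2sub vF : E (SigSub (mem_set Pa)))).
  apply: measurableI.
    rewrite -[X in measurable X]setTI; apply: (@measurable_fst _ _ rVb L2b) => //.
    rewrite -[P]setCK; apply: (@measurableC _ rVb); apply: sub_sigma_algebra.
    exact: closed_openC.
  apply: bigcap_measurableType => k _; apply: bigcup_measurable => n _.
  have m1 : hmeas (fun x : rVb * L2b => (x.2 : L2 Pr)).
    by move=> B hB; rewrite -[X in measurable X]setTI; exact: (@measurable_snd _ _ rVb L2b).
  have m2 : hmeas (fun x : rVb * L2b => fs x.1 n).
    move=> B /(hfs n) mS; rewrite -[X in measurable X]setTI.
    exact: (@measurable_fst _ _ rVb L2b measurableT _ mS).
  have := hmeas_dist2 ip sepD m1 m2 measurableT (measurable_itv `]-oo, (k.+1%:R^-1 : R)[).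
  by rewrite setTI; congr measurable; apply/seteqP; split=> x; rewrite /= in_itv.
apply/seteqP; split; last first.
  move=> _ [B mB <-]; rewrite setTI; rewrite bQ in mB; move: B mB.
  exact: (sys_measurable_pair sE m_tag m_tagged).
have sS : sigma_algebra setT (preimage_set_system setT f (@borel Q)).
  by apply: sigma_algebra_preimage_sys; exact: smallest_sigma_algebra.
have T0 : @borel 'rV[R]_d setT by apply: sub_gen_smallest; exact: openT.
have T1 : hborel dot setT.
  by apply: sub_gen_smallest => u _; exists 1.
move=> B mB; have : sys_measurable (preimage_set_system setT f (@borel Q)) SE id.
  apply: to_SE => // A mA.
    exists (A `*` setT); last by rewrite setTI; apply/seteqP; split=> x /=; [case|split].
    by rewrite bQ; apply: sub_gen_smallest; exists A => //; exists setT.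
  exists (setT `*` A); last by rewrite setTI; apply/seteqP; split=> x /=; [case|split].
  by rewrite bQ; apply: sub_gen_smallest; exists setT => //; exists A.
exact.
Qed.

Lemma cpp_product_system : product_system (cpp_dot P act X Pr eta) SE mul.
Proof.
split.
- exact: cpp_standard.
- exact: cpp_proj_measurable.
- by apply/seteqP; split=> // a _; exists (Tagged E (0 : E a)).
- by move=> a; exact: (cpp_hilbert act X poi a).
- by move=> a; exists (fun n => fsec n a) => v e e0; exact: fsec_dense.
- by move=> a; exact: (cpp_nonzero act X poi a).
- exact: cpp_mul_measurable.
- exact: (cpp_mulA P_convex P_cone P_pointed act0 actD act_measurable rho0_invariant
    X_measurable X_shift nu_levy poi Omega_gen).
- by move=> x y; have [] := mulP x y.
- move=> a b c; exact: (cpp_mul_unitary P_convex P_cone P_pointed act0 actD act_measurable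
    rho0_invariant X_measurable X_shift nu_levy poi Omega_gen).
- exact: cpp_field.
Qed.

End product_system_measurability.

Theorem mainTheorem4 (R : realType) (d : nat) (P : set 'rV[R]_d)
  (P_closed : closed P)
  (P_convex : convex_set P)
  (P_cone : forall (t : R) a, 0 <= t -> P a -> P (t *: a))
  (P_generating : forall x, exists a b, [/\ P a, P b & x = a - b])
  (P_pointed : P `&` [set a | P (- a)] = [set 0])
  (dY : measure_display) (Y : measurableType dY)
  (Y_cgen : countably_generated (@measurable dY Y))
  (act : 'rV[R]_d -> Y -> Y)
  (act0 : forall y, act 0 y = y)
  (actD : forall a b y, act (a + b) y = act a (act b y))
  (act_measurable :
    sys_measurable (sys_prod (@borel 'rV[R]_d) (@measurable dY Y))
      (@measurable dY Y) (fun ay => act ay.1 ay.2))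
  (rho0 : {sigma_finite_measure set Y -> \bar R})
  (rho0_invariant : forall a B, measurable B ->
    rho0 (translate act B a) = rho0 B)
  (X : set Y) (X_measurable : measurable X)
  (X_shift : forall a, P a -> translate act X a `<=` X)
  (X_pure : \bigcap_(a in P) translate act X a = set0)
  (nu : {measure set (posR R) -> \bar R})
  (nu_levy : (\int[nu]_r (Num.min (pos_val r) 1)%:E < +oo)%E)
  (dO : measure_display) (Omega : measurableType dO)
  (Pr : probability Omega R)
  (eta : Omega -> {measure set (Y * posR R) -> \bar R})
  (eta_poisson : poisson_process Pr (rho0 \x nu)%E eta)
  (Omega_gen : @measurable dO Omega = complete_gen Pr (eta_gen eta)) :
  product_system (cpp_dot P act X Pr eta) (cpp_sigma P act X Pr eta)
    (cpp_mul P act X Pr eta).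
Proof.
have [G GE] := Y_cgen.
exact: (cpp_product_system P_closed P_convex P_cone P_pointed act0 actD act_measurable
  rho0_invariant X_measurable X_shift nu_levy eta_poisson Omega_gen GE).
Qed.
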